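(* Let $P,Q,A_1,\dots,A_r,B_1,\dots,B_s\in\mathbb{C}^{N\times N}$ be pairwise commuting matrices such that $\Re(P)>0$, $\Re(Q)>0$ and $A_i+\ell I$, $B_j+\ell I$ are invertible for all integers $\ell\ge0$, $1\le i\le r$, $1\le j\le s$. Let $x>0$ and $y,z\in\mathbb{C}$. Then $${}_{r}E_{s}\left[(x,P,Q;yz)\left|\begin{matrix}A_1,\dots,A_r\\ B_1,\dots,B_s\end{matrix}\right.\right]=\Gamma(B_1)\cdots\Gamma(B_s)\Gamma^{-1}(A_1)\cdots\Gamma^{-1}(A_r)\sum_{n=0}^\infty\Gamma(A_1+nI)\cdots\Gamma(A_r+nI)\,\Gamma^{-1}(B_1+nI)\cdots\Gamma^{-1}(B_s+nI)\,\frac{y^n(z-1)^n}{n!}\;{}_{r}E_{s}\left[(x,P,nP+Q;y)\left|\begin{matrix}A_1+nI,\dots,A_r+nI\\ B_1+nI,\dots,B_s+nI\end{matrix}\right.\right].$$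
   Context: $I$ is the identity matrix in $\mathbb{C}^{N\times N}$; $t^{M}=\exp(M\ln t)$ for $t>0$; $\Re(M)>0$ means that every eigenvalue of $M$ has positive real part. $\Gamma^{-1}(M)$ is the entire function $1/\Gamma$ applied to $M$ (holomorphic functional calculus); if $M+\ell I$ is invertible for all integers $\ell\ge0$, it is invertible with inverse $\Gamma(M)$. For $x>0$, $\Gamma(M,x)=\int_x^\infty u^{M-I}e^{-u}du$. Pochhammer symbol: $(M)_0=I$, $(M)_\ell=M(M+I)\cdots(M+(\ell-1)I)$. The generalized incomplete exponential matrix function is $${}_rE_s\left[(x,P,Q;z)\left|\begin{matrix}A_1,\dots,A_r\\ B_1,\dots,B_s\end{matrix}\right.\right]=\sum_{\ell=0}^\infty \frac{z^\ell}{\ell!}\prod_{i=1}^r(A_i)_\ell\Big[\prod_{j=1}^s(B_j)_\ell\Big]^{-1}\Gamma(\ell P+Q,x)\Gamma^{-1}(\ell P+Q).$$ The identity is understood for those $y,z\in\mathbb{C}$ for which the series involved converge. *)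

(* Defs.v *)
From HB Require Import structures.
From mathcomp Require Import all_boot all_order all_algebra.
From mathcomp Require Import all_classical all_reals all_analysis.
From mathcomp Require Import complex.

Set Implicit Arguments.
Unset Strict Implicit.
Unset Printing Implicit Defensive.

Import Order.TTheory GRing.Theory Num.Theory.
Import numFieldNormedType.Exports.

Local Open Scope classical_set_scope.
Local Open Scope complex_scope.
Local Open Scope ring_scope.

(* The usual topology of C: R[i] is a numFieldType, and the topology its
   modulus induces is already defined on the regular module R[i]^o. *)
HB.instance Definition _ (R : realType) :=
  NormedModule.copy R[i] R[i]^o.

(* Pitfall: the Re, Im of ssrnum land in R[i], those of complex.v in R. *)

Definition cintegral (R : realType) (D : set R) (f : R -> R[i]) : R[i] :=
  (\int[lebesgue_measure]_(u in D) complex.Re (f u)) +i*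
  (\int[lebesgue_measure]_(u in D) complex.Im (f u)).

Definition mxintegral (R : realType) (N : nat) (D : set R)
    (F : R -> 'M[R[i]]_N) : 'M[R[i]]_N :=
  \matrix_(i, j) cintegral D (fun u => F u i j).

Definition cexp (R : realType) (z : R[i]) : R[i] :=
  (expR (complex.Re z))%:C * (cos (complex.Im z) +i* sin (complex.Im z)).

(* t^z = exp(z ln t), for t > 0. *)
Definition cpow (R : realType) (t : R) (z : R[i]) : R[i] :=
  cexp ((ln t)%:C * z).

(* Euler's integral; meant for 0 < Re z. *)
Definition euler_gamma (R : realType) (z : R[i]) : R[i] :=
  cintegral `]0, +oo[ (fun u => cpow u (z - 1) * (expR (- u))%:C).

(* The entire function 1/Gamma, continued from the right half-plane by
   1/Gamma(z) = z (z+1) ... (z+n-1) / Gamma(z+n), with n > |Re z|. *)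
Definition rgamma (R : realType) (z : R[i]) : R[i] :=
  let n := (Num.truncn `|complex.Re z|).+1 in
  (\prod_(k < n) (z + k%:R)) / euler_gamma (z + n%:R).

Definition mxexp (R : realType) (N : nat) (M : 'M[R[i]]_N) : 'M[R[i]]_N :=
  limn (series (fun k : nat => (k`!%:R)^-1 *: M ^+ k)).

(* t^M = exp(M ln t), for t > 0. *)
Definition mxpow (R : realType) (N : nat) (t : R) (M : 'M[R[i]]_N) :
    'M[R[i]]_N :=
  mxexp ((ln t)%:C *: M).

(* The sum of the moduli of the entries bounds the spectral radius. *)
Definition contour_radius (R : realType) (N : nat) (M : 'M[R[i]]_N) : R :=
  1 + \sum_i \sum_j complex.Re `|M i j|.

(* Holomorphic functional calculus for an entire function f:
   f(M) = 1/(2 pi i) \oint_{|w| = rho} f(w) (w I - M)^{-1} dw,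
   with w = rho e^{i t} and dw = i w dt. *)
Definition mxholo (R : realType) (N : nat) (f : R[i] -> R[i])
    (M : 'M[R[i]]_N) : 'M[R[i]]_N :=
  let w t := (contour_radius M)%:C * cexp (0 +i* t) in
  ((2 * pi)^-1)%:C *:
    mxintegral `[0, 2 * pi] (fun t => (f (w t) * w t) *: invmx ((w t)%:M - M)).

Definition mxrgamma (R : realType) (N : nat) (M : 'M[R[i]]_N) : 'M[R[i]]_N :=
  mxholo (@rgamma R) M.

(* Gamma(M) is the inverse of (1/Gamma)(M), which is invertible exactly when
   M + l I is invertible for all l >= 0. *)
Definition mxgamma (R : realType) (N : nat) (M : 'M[R[i]]_N) : 'M[R[i]]_N :=
  invmx (mxrgamma M).

Definition mxigamma (R : realType) (N : nat) (M : 'M[R[i]]_N) (x : R) :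
    'M[R[i]]_N :=
  mxintegral `[x, +oo[ (fun u => (expR (- u))%:C *: mxpow u (M - 1%:M)).

Definition mxpoch (R : realType) (N : nat) (M : 'M[R[i]]_N) (l : nat) :
    'M[R[i]]_N :=
  \prod_(k < l) (M + k%:R%:M).

Definition pos_spectrum (R : realType) (N : nat) (M : 'M[R[i]]_N) : Prop :=
  forall a : R[i], eigenvalue M a -> 0 < complex.Re a.

(* General term of the series
   {}_r E_s[(x, P, Q; z) | A_1, ..., A_r; B_1, ..., B_s]. *)
Definition rEs_term (R : realType) (N r s : nat) (x : R) (P Q : 'M[R[i]]_N)
    (z : R[i]) (A : 'I_r -> 'M[R[i]]_N) (B : 'I_s -> 'M[R[i]]_N)
    (l : nat) : 'M[R[i]]_N :=
  (z ^+ l / l`!%:R) *: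
    ((\prod_(i < r) mxpoch (A i) l) *m invmx (\prod_(j < s) mxpoch (B j) l)
     *m mxigamma (l%:R *: P + Q) x *m mxrgamma (l%:R *: P + Q)).

Definition rEs (R : realType) (N r s : nat) (x : R) (P Q : 'M[R[i]]_N)
    (z : R[i]) (A : 'I_r -> 'M[R[i]]_N) (B : 'I_s -> 'M[R[i]]_N) :
    'M[R[i]]_N :=
  limn (series (rEs_term x P Q z A B)).

Definition mxshift (R : realType) (N r : nat) (A : 'I_r -> 'M[R[i]]_N)
    (n : nat) : 'I_r -> 'M[R[i]]_N :=
  fun i => A i + n%:R%:M.

(* General term of the sum over n, without the prefactor
   Gamma(B_1)...Gamma(B_s) Gamma^{-1}(A_1)...Gamma^{-1}(A_r). *)
Definition mult_term (R : realType) (N r s : nat) (x : R) (P Q : 'M[R[i]]_N)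
    (y z : R[i]) (A : 'I_r -> 'M[R[i]]_N) (B : 'I_s -> 'M[R[i]]_N)
    (n : nat) : 'M[R[i]]_N :=
  (y ^+ n * (z - 1) ^+ n / n`!%:R) *:
    ((\prod_(i < r) mxgamma (A i + n%:R%:M))
     *m (\prod_(j < s) mxrgamma (B j + n%:R%:M))
     *m rEs x P (n%:R *: P + Q) y (mxshift A n) (mxshift B n)).

(* Main.v *)
(* Write the left-hand side as f(yz), where f(w) = \sum_l C_l w^l. The Pochhammer
   and Gamma factors telescope, so that the n-th term on the right is
   (y(z-1))^n b_n with b_n = \sum_l binom(n+l, n) C_(n+l) y^l: the identity is the
   Taylor re-expansion of f at y, evaluated at yz. If |y| is smaller than the
   radius of convergence, f and \sum_n b_n h^n are both analytic along the segment
   from y to yz and agree near y, hence on the whole half-open segment, and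
   Abel's theorem in a Stolz angle reaches yz, which may lie on the boundary.

   It remains to see that convergence of all the inner series leaves no other
   case than y = 0. The ratio Gamma(M,x)/Gamma(M) is an entire function of M; at
   lP+Q it grows at most polynomially in l, and its values on a common
   eigenvector tend to 1, because Gamma(w,x)/Gamma(w) - 1 = O(exp(- Re w)) in
   sectors. The remaining factors have ratio close to (l+1)^(r-s-1), so f has
   radius of convergence oo if r <= s and at least 1 if r = s+1; in all other
   cases the binomial weights keep the terms of the n-th inner series away from
   0 once n is large. *)

Require Import Defs.
From HB Require Import structures.
From mathcomp Require Import all_boot all_order all_algebra.
From mathcomp Require Import all_classical all_reals all_analysis.
From mathcomp Require Import measurable_realfun spectral complex ring lra.

Set Implicit Arguments.
Unset Strict Implicit.
Unset Printing Implicit Defensive.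

Import Order.TTheory GRing.Theory Num.Theory.
Import numFieldNormedType.Exports.

Local Open Scope classical_set_scope.
Local Open Scope complex_scope.
Local Open Scope ring_scope.

(** * Real-valued modulus and convergence of complex sequences *)

Section ComplexModulus.
Variable R : realType.
Implicit Types (x y z : R[i]) (u v : nat -> R[i]).

(** Analytic functions are handled throughout as coefficient sequences. Cauchy's formulas are needed
    only on circles about 0, where they reduce to the orthogonality of the functions e^(ikt), and an
    identity between entire functions passes to matrices because it forces equality of coefficients.
    The number of factors in [rgamma] depends on z, which hides both analyticity and the functional
    equation. Gauss's products repair this: they converge everywhere to [rgamma], are bounded
    uniformly on discs, and satisfy the functional equation up to a factor tending to 1. They also
    compare 1/Gamma at s + it with 1/Gamma at s, so that Stirling's formula is avoided in the
    estimate of the incomplete ratio. The matrices may fail to be diagonalizable. Upper bounds on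
    the coefficients therefore involve all generalized eigenspaces of P and Q, and the nilpotent
    parts turn bounded values into polynomial growth; the lower bound that excludes the divergent
    cases needs a single common eigenvector. *)

Definition cabs z : R := complex.Re `|z|.

Lemma cabsE z : `|z| = (cabs z)%:C.
Proof. by rewrite /cabs normc_def. Qed.

Lemma cabs_ge0 z : 0 <= cabs z.
Proof. by rewrite -lecR -cabsE normr_ge0. Qed.

Lemma cabsD x y : cabs (x + y) <= cabs x + cabs y.
Proof. by rewrite -lecR rmorphD /= -!cabsE ler_normD. Qed.

Lemma cabsM x y : cabs (x * y) = cabs x * cabs y.
Proof. by apply: complexI; rewrite rmorphM /= -!cabsE normrM. Qed.

Lemma cabsN x : cabs (- x) = cabs x.
Proof. by rewrite /cabs normrN. Qed.

Lemma cabsB x y : cabs (x - y) = cabs (y - x).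
Proof. by rewrite -cabsN opprB. Qed.

Lemma cabs0 : cabs 0 = 0.
Proof. by rewrite /cabs normr0. Qed.

Lemma cabs1 : cabs 1 = 1.
Proof. by rewrite /cabs normr1. Qed.

Lemma cabs_eq0 z : (cabs z == 0) = (z == 0).
Proof.
rewrite -[RHS]normr_eq0 cabsE; apply/eqP/eqP => [->//|].
by move/complexI.
Qed.

Lemma cabs_gt0 z : (0 < cabs z) = (z != 0).
Proof. by rewrite lt_def cabs_ge0 andbT cabs_eq0. Qed.

Lemma cabsX z n : cabs (z ^+ n) = cabs z ^+ n.
Proof. by elim: n => [|n IH]; rewrite ?expr0 ?cabs1// !exprS cabsM IH. Qed.

Lemma cabsV z : cabs z^-1 = (cabs z)^-1.
Proof.
have [->|z0] := eqVneq z 0; first by rewrite invr0 cabs0 invr0.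
apply: (@mulfI _ (cabs z)); first by rewrite cabs_eq0.
by rewrite -cabsM !divff ?cabs1 ?cabs_eq0.
Qed.

Lemma cabsR (a : R) : cabs a%:C = `|a|.
Proof. by rewrite /cabs normc_def /= expr0n addr0 sqrtr_sqr. Qed.

Lemma cabs_nat n : cabs n%:R = n%:R.
Proof. by rewrite -(rmorph_nat (real_complex R)) cabsR ger0_norm. Qed.

Lemma cabs_sum (I : Type) (r : seq I) (P : pred I) (F : I -> R[i]) :
  cabs (\sum_(i <- r | P i) F i) <= \sum_(i <- r | P i) cabs (F i).
Proof.
elim/big_ind2: _ => // [|x1 x2 y1 y2 h1 h2]; first by rewrite cabs0.
by rewrite (le_trans (cabsD _ _)) ?lerD.
Qed.

Lemma cabs_prod (I : Type) (r : seq I) (P : pred I) (F : I -> R[i]) :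
  cabs (\prod_(i <- r | P i) F i) = \prod_(i <- r | P i) cabs (F i).
Proof. by rewrite (big_morph cabs cabsM cabs1). Qed.

Lemma cabs_sqr z : cabs z ^+ 2 = complex.Re z ^+ 2 + complex.Im z ^+ 2.
Proof.
by rewrite /cabs normc_def /= sqr_sqrtr // addr_ge0 // sqr_ge0.
Qed.

Lemma cabs_Re z : `|complex.Re z| <= cabs z.
Proof. by rewrite -lecR -cabsE normc_ge_Re. Qed.

Lemma cabs_Im z : `|complex.Im z| <= cabs z.
Proof.
rewrite -(@ler_pXn2r _ 2) ?nnegrE ?cabs_ge0 //.
by rewrite cabs_sqr real_normK ?num_real // lerDr sqr_ge0.
Qed.

Lemma cabs_le z : cabs z <= `|complex.Re z| + `|complex.Im z|.
Proof.
rewrite -(@ler_pXn2r _ 2) ?nnegrE ?cabs_ge0 ?addr_ge0 //.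
rewrite cabs_sqr sqrrD !real_normK ?num_real // lerD2r lerDl.
by rewrite mulrn_wge0 // mulr_ge0.
Qed.

Lemma cabs_sub_ge x y : cabs x - cabs y <= cabs (x - y).
Proof. by rewrite lerBlDr (le_trans _ (cabsD _ _))// subrK. Qed.

(** Error bounds are real here, whereas moduli and radii of balls in [R[i]] lie in [R[i]];
    [ccvg_entry] and [cvg_entry] connect this notion with the topology of matrices. *)
Definition ccvg u l := forall e : R, 0 < e ->
  exists n0, forall n, (n0 <= n)%N -> cabs (u n - l) < e.


Lemma ccvg_cst l : ccvg (fun=> l) l.
Proof. by move=> e e0; exists 0%N => n _; rewrite subrr cabs0. Qed.

Lemma ccvg_near u v l : (exists n0, forall n, (n0 <= n)%N -> u n = v n) ->
  ccvg u l -> ccvg v l.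
Proof.
move=> [n0 uv] ul e /ul[n1 H]; exists (maxn n0 n1) => n.
by rewrite geq_max => /andP[a b]; rewrite -uv // H.
Qed.

Lemma ccvg_ext u v l : u =1 v -> ccvg u l -> ccvg v l.
Proof. by move=> uv; apply: ccvg_near; exists 0%N. Qed.

Lemma ccvgD u v a b : ccvg u a -> ccvg v b -> ccvg (fun n => u n + v n) (a + b).
Proof.
move=> ua vb e e0; have e2 : 0 < e / 2 by rewrite divr_gt0.
have [n0 H0] := ua _ e2; have [n1 H1] := vb _ e2.
exists (maxn n0 n1) => n; rewrite geq_max => /andP[/H0 h0 /H1 h1].
rewrite opprD addrACA (le_lt_trans (cabsD _ _)) // [ltRHS]splitr.
exact: ltrD.
Qed.

Lemma ccvgZ c u a : ccvg u a -> ccvg (fun n => c * u n) (c * a).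
Proof.
move=> ua e e0; have c0 : 0 < cabs c + 1 by rewrite ltr_wpDl ?cabs_ge0.
have [n0 H] := ua _ (divr_gt0 e0 c0); exists n0 => n /H.
rewrite ltr_pdivlMr // => h; rewrite -mulrBr cabsM (le_lt_trans _ h) // mulrC.
by rewrite ler_wpM2l ?cabs_ge0 // lerDl.
Qed.

Lemma ccvgN u a : ccvg u a -> ccvg (fun n => - u n) (- a).
Proof.
by move=> ua e /ua[n0 H]; exists n0 => n /H; rewrite -opprD cabsN.
Qed.

Lemma ccvgB u v a b : ccvg u a -> ccvg v b -> ccvg (fun n => u n - v n) (a - b).
Proof. by move=> ua /ccvgN vb; exact: ccvgD. Qed.

Lemma ccvg_unique u a b : ccvg u a -> ccvg u b -> a = b.
Proof.
move=> ua ub; apply/eqP; rewrite -subr_eq0 -cabs_eq0; apply/eqP/le_anti.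
rewrite cabs_ge0 andbT; apply/ler_addgt0Pr => e e0; rewrite add0r.
have e2 : 0 < e / 2 by rewrite divr_gt0.
have [n0 H0] := ua _ e2; have [n1 H1] := ub _ e2.
have := H0 _ (leq_maxl n0 n1); have := H1 _ (leq_maxr n0 n1).
set n := maxn _ _ => h1 h0; rewrite -(subrKA (u n)) (le_trans (cabsD _ _)) //.
by rewrite [leRHS]splitr lerD // ltW // cabsB.
Qed.

Lemma ccvg_bounded u a : ccvg u a -> exists2 B, 0 <= B & forall n, cabs (u n) <= B.
Proof.
move=> /(_ 1 ltr01)[n0 H].
exists (cabs a + 1 + \sum_(k < n0) cabs (u k)).
  by rewrite !addr_ge0 ?cabs_ge0 ?sumr_ge0 // => i _; exact: cabs_ge0.
move=> n; have [/H h|lt_n] := leqP n0 n.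
  rewrite ler_wpDr ?sumr_ge0 // => [i _|]; first exact: cabs_ge0.
  have -> : u n = a + (u n - a) by rewrite addrC subrK.
  by rewrite (le_trans (cabsD _ _)) // lerD2l ltW.
rewrite ler_wpDl ?addr_ge0 ?cabs_ge0 // (bigD1 (Ordinal lt_n)) //=.
by rewrite lerDl sumr_ge0 // => i _; exact: cabs_ge0.
Qed.

Lemma ccvgM u v a b : ccvg u a -> ccvg v b -> ccvg (fun n => u n * v n) (a * b).
Proof.
move=> ua vb; have [B B0 hB] := ccvg_bounded ua.
suff h : ccvg (fun n => u n * (v n - b)) 0.
  have := ccvgD h (ccvgZ b ua); rewrite add0r mulrC; apply: ccvg_ext => n.
  by rewrite mulrBr [b * _]mulrC subrK.
move=> e e0; have c0 : 0 < B + 1 by rewrite ltr_wpDl.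
have [n0 H] := vb _ (divr_gt0 e0 c0); exists n0 => n /H.
rewrite ltr_pdivlMr // => h; rewrite subr0 cabsM (le_lt_trans _ h) // mulrC.
by rewrite ler_wpM2l ?cabs_ge0 // (le_trans (hB n)) // lerDl.
Qed.

Lemma ccvg_sum (I : Type) (r : seq I) (P : pred I) (F : I -> nat -> R[i]) (L : I -> R[i]) :
  (forall i, P i -> ccvg (F i) (L i)) ->
  ccvg (fun n => \sum_(i <- r | P i) F i n) (\sum_(i <- r | P i) L i).
Proof.
move=> h; elim: r => [|i r IH].
  by rewrite big_nil; apply: ccvg_ext (ccvg_cst 0) => n; rewrite big_nil.
rewrite big_cons; have := IH; case: ifP => [Pi|nPi] IH'.
  by apply: ccvg_ext (ccvgD (h _ Pi) IH') => n; rewrite big_cons Pi.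
by apply: ccvg_ext IH' => n; rewrite big_cons nPi.
Qed.

Lemma ccvg_shift k u l : ccvg (fun n => u (n + k)%N) l <-> ccvg u l.
Proof.
split=> ul e /ul[n0 H].
  exists (n0 + k)%N => n h; have kn := leq_trans (leq_addl _ _) h.
  by have := H (n - k)%N; rewrite subnK //; apply; rewrite leq_subRL // addnC.
by exists n0 => n h; apply: H; exact: leq_trans h (leq_addr _ _).
Qed.

Lemma ccvg_cabs_le u l B : ccvg u l ->
  (exists n0, forall n, (n0 <= n)%N -> cabs (u n) <= B) -> cabs l <= B.
Proof.
move=> ul [n1 hB]; apply/ler_addgt0Pr => e /ul[n0 H].
have := H _ (leq_maxl n0 n1); have := hB _ (leq_maxr n0 n1).
set n := maxn _ _ => h1 h0; rewrite -[l](subKr (u n)) addrC.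
rewrite (le_trans (cabsD _ _)) // cabsN addrC lerD // ltW //.
Qed.

Lemma ccvg_Re u l : ccvg u l -> (fun n => complex.Re (u n)) @ \oo --> complex.Re l.
Proof.
move=> ul; apply/cvgrPdist_lt => e /ul[n0 H]; exists n0 => // n /= /H.
by rewrite cabsB; apply: le_lt_trans; rewrite -raddfB cabs_Re.
Qed.

Lemma ccvg_Im u l : ccvg u l -> (fun n => complex.Im (u n)) @ \oo --> complex.Im l.
Proof.
move=> ul; apply/cvgrPdist_lt => e /ul[n0 H]; exists n0 => // n /= /H.
by rewrite cabsB; apply: le_lt_trans; rewrite -raddfB cabs_Im.
Qed.

Lemma ccvg_ReIm u l : (fun n => complex.Re (u n)) @ \oo --> complex.Re l ->
  (fun n => complex.Im (u n)) @ \oo --> complex.Im l -> ccvg u l.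
Proof.
move=> /cvgrPdist_lt hR /cvgrPdist_lt hI e e0.
have e2 : 0 < e / 2 by rewrite divr_gt0.
have [n0 _ H0] := hR _ e2; have [n1 _ H1] := hI _ e2.
exists (maxn n0 n1) => n; rewrite geq_max => /andP[/H0 h0 /H1 h1].
rewrite cabsB (le_lt_trans (cabs_le _)) // [ltRHS]splitr.
by apply: ltrD; rewrite raddfB.
Qed.

Lemma ccvg_real (a : nat -> R) (l : R) : a @ \oo --> l ->
  ccvg (fun n => (a n)%:C) l%:C.
Proof. by move=> al; apply: ccvg_ReIm => //=; exact: cvg_cst. Qed.

Lemma ccvg_squeeze u l (e : nat -> R) : e @ \oo --> (0 : R) ->
  (exists n0, forall n, (n0 <= n)%N -> cabs (u n - l) <= e n) -> ccvg u l.
Proof.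
move=> /cvgrPdist_lt e0 [n0 H] d /e0[n1 _ H1].
exists (maxn n0 n1) => n; rewrite geq_max => /andP[/H h0 /H1 /=].
by rewrite sub0r normrN; apply: le_lt_trans; rewrite (le_trans h0) // ler_norm.
Qed.

Lemma ccvg_cabs u l : ccvg u l -> (fun n => cabs (u n)) @ \oo --> cabs l.
Proof.
move=> ul; apply/cvgrPdist_lt => e /ul[n0 H]; exists n0 => // n /= /H.
apply: le_lt_trans; rewrite ler_norml lerNl opprB cabs_sub_ge /=.
by rewrite cabsB cabs_sub_ge.
Qed.

End ComplexModulus.

(** * Complex series and power series *)

Lemma addrKC (V : zmodType) (x y : V) : x + y - x = y.
Proof. by rewrite addrC addKr. Qed.

Section ComplexSeries.
Variable R : realType.
Implicit Types (u v : nat -> R[i]) (M : nat -> R).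

Definition cseries u s := ccvg (fun n => \sum_(k < n) u k) s.

Definition rsummable M := exists B, forall n, \sum_(k < n) M k <= B.

Lemma rsummable_tail M : (forall k, 0 <= M k) -> rsummable M ->
  forall e, 0 < e -> exists J, forall n, (J <= n)%N ->
    \sum_(k < n) M k - \sum_(k < J) M k < e.
Proof.
move=> M0 [B hB] e e0; pose a n := \sum_(k < n) M k.
have nd : nondecreasing_seq a.
  apply/nondecreasing_seqP => n; rewrite /a big_ord_recr /= lerDl //.
have cv : cvgn a.
  by apply: nondecreasing_is_cvgn => //; exists B => _ [n _ <-]; exact: hB.
have /cvgrPdist_lt /(_ e e0) [J _ HJ] := cv.
exists J => n Jn; have := HJ J (leqnn _).
rewrite ger0_norm ?subr_ge0 ?nondecreasing_cvgn_le //.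
by apply: le_lt_trans; rewrite lerD2r (nondecreasing_cvgn_le nd cv).
Qed.

Lemma cseries_tail u s M J e : cseries u s -> (forall k, cabs (u k) <= M k) ->
  (forall n, (J <= n)%N -> \sum_(k < n) M k - \sum_(k < J) M k < e) ->
  cabs (s - \sum_(k < J) u k) <= e.
Proof.
move=> us uM H; apply: (ccvg_cabs_le (ccvgB us (ccvg_cst _))).
exists J => n Jn; rewrite -(subnKC Jn) big_split_ord /= addrKC.
rewrite (le_trans (cabs_sum _ _ _)) //.
have := H _ (leq_addr (n - J)%N J); rewrite big_split_ord /= addrKC => /ltW.
by apply: le_trans; apply: ler_sum => i _; exact: uM.
Qed.

Lemma rsummable_cseries u M : (forall k, cabs (u k) <= M k) -> rsummable M ->
  exists s, cseries u s.
Proof.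
move=> uM [B hB].
have aux (f : R[i] -> R) : (forall z, `|f z| <= cabs z) ->
    cvgn (fun n => \sum_(k < n) f (u k)).
  move=> fz; have : cvgn (series (fun k => f (u k))).
    apply: normed_cvg; apply: nondecreasing_is_cvgn.
      apply/nondecreasing_seqP => n; rewrite /normed_series_of /= !seriesEnat /= big_nat_recr //= lerDl //.
    exists B => _ [n _ <-]; rewrite /normed_series_of /= seriesEnat /= big_mkord (le_trans _ (hB n)) //.
    by apply: ler_sum => i _; rewrite (le_trans (fz _)).
  by rewrite seriesEnat /=; under eq_fun do rewrite big_mkord.
exists (limn (fun n => \sum_(k < n) complex.Re (u k)) +i*
        limn (fun n => \sum_(k < n) complex.Im (u k))).
apply: ccvg_ReIm => /=.
  have := aux (@complex.Re R) (@cabs_Re R).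
  by under eq_fun do rewrite -raddf_sum.
have := aux (@complex.Im R) (@cabs_Im R).
by under eq_fun do rewrite -raddf_sum.
Qed.

Lemma cseries_cabs_le u s M B : cseries u s -> (forall k, cabs (u k) <= M k) ->
  (forall n, \sum_(k < n) M k <= B) -> cabs s <= B.
Proof.
move=> us uM hB; apply: (ccvg_cabs_le us); exists 0%N => n _.
by rewrite (le_trans (cabs_sum _ _ _)) // (le_trans _ (hB n)) // ler_sum.
Qed.

Lemma cseries_unique u a b : cseries u a -> cseries u b -> a = b.
Proof. exact: ccvg_unique. Qed.

Lemma cseries_ext u v s : u =1 v -> cseries u s -> cseries v s.
Proof.
move=> uv; apply: ccvg_ext => n; apply: eq_bigr => k _; exact: uv.
Qed.

Lemma cseriesD u v a b : cseries u a -> cseries v b ->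
  cseries (fun k => u k + v k) (a + b).
Proof.
by move=> ua vb; apply: ccvg_ext (ccvgD ua vb) => n; rewrite big_split.
Qed.

Lemma cseriesZ c u a : cseries u a -> cseries (fun k => c * u k) (c * a).
Proof.
by move=> ua; apply: ccvg_ext (ccvgZ c ua) => n; rewrite mulr_sumr.
Qed.

Lemma cseries_finite n u : (forall k, (n <= k)%N -> u k = 0) ->
  cseries u (\sum_(k < n) u k).
Proof.
move=> u0 e e0; exists n => m nm; rewrite -(subnKC nm) big_split_ord /=.
rewrite addrKC big1 ?cabs0 // => i _; apply: u0; exact: leq_addr.
Qed.

Lemma cseries_term0 u s : cseries u s -> ccvg u 0.
Proof.
move=> us; have := ccvgB (proj2 (ccvg_shift 1 _ _) us) us; rewrite subrr.
by apply: ccvg_ext => n; rewrite addn1 big_ord_recr /= addrKC.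
Qed.

(** Beyond an index [J] fixed by the dominating series the tails are small uniformly in [n]; the
    first [J] terms converge as a finite sum. This is dominated convergence for series. *)
Lemma tannery (u : nat -> nat -> R[i]) v M (S : nat -> R[i]) T :
  rsummable M -> (forall n k, cabs (u n k) <= M k) ->
  (forall k, ccvg (u^~ k) (v k)) ->
  (forall n, cseries (u n) (S n)) -> cseries v T -> ccvg S T.
Proof.
move=> sM uM uv uS vT e e0.
have M0 k : 0 <= M k by rewrite (le_trans _ (uM 0%N k)) ?cabs_ge0.
have vM k : cabs (v k) <= M k.
  by apply: (ccvg_cabs_le (uv k)); exists 0%N => n _; exact: uM.
have e4 : 0 < e / 4 by rewrite divr_gt0.
have [J HJ] := rsummable_tail M0 sM e4.
have [n0 H] := ccvg_sum (index_enum 'I_J) (fun k _ => uv k) (P := predT) e4.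
exists n0 => n /H h.
have h1 := cseries_tail (uS n) (uM n) HJ.
have h2 := cseries_tail vT vM HJ.
have -> : S n - T = (S n - \sum_(k < J) u n k) +
  ((\sum_(k < J) u n k - \sum_(k < J) v k) - (T - \sum_(k < J) v k)) by ring.
rewrite (le_lt_trans (cabsD _ _)) //.
have := cabsD (\sum_(k < J) u n k - \sum_(k < J) v k) (- (T - \sum_(k < J) v k)).
rewrite cabsN; lra.
Qed.

(** Partial sums by antidiagonals and by squares are both sums over rows of truncated rows, so
    Tannery's theorem, dominated by the absolute row sums [M], gives them the limit of the sum by
    rows. *)
Lemma double_series (u : nat -> nat -> R[i]) (B : R) :
  (forall n, \sum_(j < n) \sum_(k < n) cabs (u j k) <= B) ->
  exists (r : nat -> R[i]) (s : R[i]), [/\ forall j, cseries (u j) (r j),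
    cseries r s,
    cseries (fun n => \sum_(j < n.+1) u j (n - j)%N) s &
    ccvg (fun n => \sum_(j < n) \sum_(k < n) u j k) s].
Proof.
move=> hB.
pose a j n := \sum_(k < n) cabs (u j k).
have a0 j n : 0 <= a j n by rewrite sumr_ge0 // => k _; exact: cabs_ge0.
have nd j : nondecreasing_seq (a j).
  by apply/nondecreasing_seqP => n; rewrite /a big_ord_recr /= lerDl cabs_ge0.
have aB j n : a j n <= B.
  pose m := maxn n j.+1; apply: le_trans (hB m).
  rewrite (bigD1 (Ordinal (leq_maxr n j.+1))) //= ler_wpDr //.
    by rewrite sumr_ge0 // => i _; exact: (a0 i m).
  by apply: (nd j); exact: leq_maxl.
have cv j : cvgn (a j).
  by apply: nondecreasing_is_cvgn => //; exists B => _ [n _ <-].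
pose M j := limn (a j).
have aM j n : a j n <= M j by apply: nondecreasing_cvgn_le.
have sM : rsummable M.
  exists B => n.
  have h : (fun m => \sum_(j < n) a j m) @ \oo --> \sum_(j < n) M j.
    elim: n => [|n IH].
      by under eq_fun do rewrite big_ord0; rewrite big_ord0; exact: cvg_cst.
    under eq_fun do rewrite big_ord_recr /=.
    by rewrite big_ord_recr; apply: cvgD IH _; exact: cv.
  rewrite -(cvg_lim (@Rhausdorff R) h); apply: limr_le; first by apply/cvg_ex; exists (\sum_(j < n) M j).
  exists n => // m /= nm; apply: le_trans (hB m).
  by rewrite -(subnKC nm) big_split_ord /= lerDl sumr_ge0 // => i _; exact: a0.
have hr j : exists s, cseries (u j) s.
  by apply: (@rsummable_cseries _ (fun k => cabs (u j k))) => //; exists B => n; exact: aB.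
have [r hr'] := choice hr.
have rM j : cabs (r j) <= M j.
  exact: (cseries_cabs_le (M := fun k => cabs (u j k)) (hr' j) (fun k => lexx _) (aM j)).
have [s hs] := rsummable_cseries rM sM.
have sum_aM j (n : nat) (Q : pred 'I_n) : cabs (\sum_(k < n | Q k) u j k) <= M j.
  apply: le_trans (cabs_sum _ _ _) _; apply: le_trans (aM j n).
  by rewrite /a [leRHS](bigID Q) /= lerDl sumr_ge0 // => i _; exact: cabs_ge0.
have M0 j : 0 <= M j by rewrite (le_trans (a0 j 0%N)).
exists r, s; split => //.
(* The first [n] antidiagonals contain [n - j] entries of row [j], and none once [j] reaches [n]. *)
- apply: (@tannery (fun n j => if (j < n)%N then \sum_(k < n - j) u j k else 0) r M
    _ s) => //.
  + by move=> n j; case: ifP => _; rewrite ?cabs0 ?M0 // sum_aM.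
  + move=> j; have := hr' j; rewrite /cseries -(ccvg_shift j) => h.
    apply/(ccvg_shift j.+1); apply: ccvg_near (proj2 (ccvg_shift 1 _ _) (hr' j)).
    exists 0%N => n _; have -> : (n + j.+1 - j = n + 1)%N.
      by rewrite addnS -addSn addnK addn1.
    by rewrite ltn_addl.
  + move=> n; have -> : \sum_(m < n) \sum_(j < m.+1) u j (m - j)%N =
      \sum_(j < n) (if (j < n)%N then \sum_(k < n - j) u j k else 0).
      elim: n => [|n IH]; first by rewrite !big_ord0.
      rewrite big_ord_recr IH /= [RHS]big_ord_recr /= ltnSn. rewrite subSnn big_ord1.
      rewrite big_ord_recr /= subnn addrA; congr (_ + _).
      rewrite -big_split /=; apply: eq_bigr => j _.
      by rewrite ltn_ord ltnS (ltnW (ltn_ord j)) subSn ?(ltnW (ltn_ord j)) // big_ord_recr.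
    by apply: cseries_finite => k nk; rewrite ltnNge nk.
- apply: (@tannery (fun n j => if (j < n)%N then \sum_(k < n) u j k else 0) r M
    _ s) => //.
  + by move=> n j; case: ifP => _; rewrite ?cabs0 ?M0 // sum_aM.
  + move=> j; apply: ccvg_near (hr' j).
    by exists j.+1 => n jn; rewrite jn.
  + move=> n; have -> : \sum_(j < n) \sum_(k < n) u j k =
      \sum_(j < n) (if (j < n)%N then \sum_(k < n) u j k else 0).
      by apply: eq_bigr => j _; rewrite ltn_ord.
    by apply: cseries_finite => k nk; rewrite ltnNge nk.
Qed.

End ComplexSeries.

(** * Power series: re-expansion, identity theorem, Abel's theorem *)

Section PowerSeries.
Variable R : realType.
Implicit Types (c d : nat -> R[i]) (w h z : R[i]).

Definition psum c w s := cseries (fun k => c k * w ^+ k) s.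

(** The supremum of such [t] is the radius of convergence; boundedness stands in for it, so that no
    limit superior is needed. *)
Definition bounded_at c (t : R) := exists B, forall k, cabs (c k) * t ^+ k <= B.

Lemma bounded_at_le c t1 t2 : 0 <= t1 -> t1 <= t2 ->
  bounded_at c t2 -> bounded_at c t1.
Proof.
move=> t0 t12 [B hB]; exists B => k; apply: le_trans (hB k).
by rewrite ler_wpM2l ?cabs_ge0 // lerXn2r // nnegrE // (le_trans t0).
Qed.

Lemma geometric_sum_le (q : R) n : 0 <= q -> q < 1 ->
  \sum_(k < n) q ^+ k <= (1 - q)^-1.
Proof.
move=> q0 q1; have q1' : 0 < 1 - q by rewrite subr_gt0.
rewrite -(ler_pM2l q1') divff ?gt_eqF // -opprB mulNr -subrX1 opprB.
by rewrite gerBl exprn_ge0.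
Qed.

Lemma bounded_at_summable c t rho : 0 <= t -> t < rho -> bounded_at c rho ->
  rsummable (fun k => cabs (c k) * t ^+ k).
Proof.
move=> t0 tr [B hB]; have r0 : 0 < rho by apply: le_lt_trans tr.
have B0 : 0 <= B by rewrite (le_trans _ (hB 0%N)) // expr0 mulr1 cabs_ge0.
exists (B / (1 - t / rho)) => n.
have q1 : t / rho < 1 by rewrite ltr_pdivrMr // mul1r.
have q0 : 0 <= t / rho by rewrite divr_ge0 // ltW.
apply: le_trans (ler_wpM2l B0 (geometric_sum_le n q0 q1)).
rewrite mulr_sumr; apply: ler_sum => k _.
rewrite expr_div_n mulrA ler_pdivlMr ?exprn_gt0 // mulrAC ler_wpM2r ?exprn_ge0 //.
Qed.

Lemma psum_ex c w rho : cabs w < rho -> bounded_at c rho -> exists s, psum c w s.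
Proof.
move=> wr cb; apply: (@rsummable_cseries _ _ (fun k => cabs (c k) * cabs w ^+ k)).
  by move=> k; rewrite cabsM cabsX.
by apply: bounded_at_summable cb; rewrite ?cabs_ge0.
Qed.

Lemma psum_bounded_at c w s : psum c w s -> bounded_at c (cabs w).
Proof.
move=> /cseries_term0 /ccvg_bounded[B _ hB]; exists B => k.
by rewrite -cabsX -cabsM.
Qed.

(** The square of side [K] lies in the triangle n + l < 2K, whose antidiagonals are the ones that
    the binomial theorem sums. *)
Lemma square_le_triangle (a : nat -> nat -> R) K : (forall n l, 0 <= a n l) ->
  \sum_(n < K) \sum_(l < K) a n l <=
  \sum_(m < K + K) \sum_(n < m.+1) a n (m - n)%N.
Proof.
move=> a0.
have -> J : \sum_(m < J) \sum_(n < m.+1) a n (m - n)%N =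
    \sum_(n < J) \sum_(l < J - n) a n l.
  elim: J => [|J IH]; first by rewrite !big_ord0.
  rewrite big_ord_recr IH /= [RHS]big_ord_recr /= subSnn big_ord1.
  rewrite big_ord_recr /= subnn addrA; congr (_ + _).
  rewrite -big_split /=; apply: eq_bigr => j _.
  by rewrite subSn ?(ltnW (ltn_ord j)) // big_ord_recr.
rewrite big_split_ord /= ler_wpDr ?sumr_ge0 // => [n _|]; first by rewrite sumr_ge0.
apply: ler_sum => n _; have e : (K + K - n = K + (K - n))%N by rewrite addnBA // ltnW.
by rewrite e big_split_ord /= lerDl sumr_ge0.
Qed.

Lemma ler_sum_widen (a : nat -> R) K m : (K <= m)%N -> (forall l, 0 <= a l) ->
  \sum_(l < K) a l <= \sum_(l < m) a l.
Proof.
by move=> Km a0; rewrite -(subnKC Km) big_split_ord /= lerDl sumr_ge0.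
Qed.

Lemma row_le_square (a : nat -> nat -> R) K n : (forall n l, 0 <= a n l) ->
  \sum_(l < K) a n l <=
  \sum_(j < maxn K n.+1) \sum_(l < maxn K n.+1) a j l.
Proof.
move=> a0; rewrite (bigD1 (Ordinal (leq_maxr K n.+1))) //= ler_wpDr //.
  by rewrite sumr_ge0 // => i _; rewrite sumr_ge0.
by rewrite (ler_sum_widen (a := a n)) ?leq_maxl.
Qed.

(** [d n] is the Taylor coefficient of index [n] at [w] of the function with coefficients [c]. Only
    convergence of each of these series is asked, which is what the inner series provide at [y]. *)
Definition taylor c w d := forall n,
  cseries (fun l => ('C(n + l, n))%:R * c (n + l)%N * w ^+ l) (d n).

Lemma taylor_unique c w d d' : taylor c w d -> taylor c w d' -> d =1 d'.
Proof. by move=> h h' n; exact: cseries_unique (h n) (h' n). Qed.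

(** The antidiagonal of index m sums to |c_m| (|w| + t)^m by the binomial theorem, so absolute
    convergence at |w| + t controls the whole double array. *)
Lemma taylor_bound c w t rho : 0 <= t -> cabs w + t < rho -> bounded_at c rho ->
  exists B, forall K, \sum_(n < K) \sum_(l < K)
    ('C(n + l, n))%:R * cabs (c (n + l)%N) * cabs w ^+ l * t ^+ n <= B.
Proof.
move=> t0 wt cb.
have [|B hB] := bounded_at_summable _ wt cb; first by rewrite addr_ge0 ?cabs_ge0.
exists B => K; apply: le_trans (hB (K + K)%N).
apply: le_trans (@square_le_triangle (fun n l => ('C(n + l, n))%:R *
  cabs (c (n + l)%N) * cabs w ^+ l * t ^+ n) _ _) _.
  by move=> n l; rewrite !mulr_ge0 ?exprn_ge0 ?cabs_ge0.
apply: ler_sum => m _; rewrite exprDn mulr_sumr; apply: ler_sum => n _.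
have -> : (n + (m - n) = m)%N by rewrite subnKC // -ltnS.
by rewrite -mulr_natl le_eqVlt; apply/orP; left; apply/eqP; ring.
Qed.

Lemma taylor_ex c w rho : cabs w < rho -> bounded_at c rho ->
  exists d, taylor c w d /\ forall t, 0 <= t -> cabs w + t < rho -> bounded_at d t.
Proof.
(* Any positive weight [t] with |w| + t < rho would do: dividing by t^n isolates the inner series of
   index n. *)
move=> wr cb; pose t := (rho - cabs w) / 2.
have t0 : 0 < t by rewrite divr_gt0 // subr_gt0.
have ht : cabs w + t < rho by rewrite /t; lra.
have hs n : exists s, cseries (fun l => ('C(n + l, n))%:R * c (n + l)%N * w ^+ l) s.
  have [B hB] := taylor_bound (ltW t0) ht cb.
  apply: (@rsummable_cseries _ _ (fun l => ('C(n + l, n))%:R * cabs (c (n + l)%N) * cabs w ^+ l)).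
    by move=> k; rewrite !cabsM cabs_nat cabsX.
  exists (B / t ^+ n) => K; rewrite ler_pdivlMr ?exprn_gt0 // mulr_suml.
  apply: le_trans (hB (maxn K n.+1)).
  apply: (@row_le_square (fun n l => ('C(n + l, n))%:R *
    cabs (c (n + l)%N) * cabs w ^+ l * t ^+ n)) => i l.
  by rewrite !mulr_ge0 ?exprn_ge0 ?cabs_ge0 // ltW.
have [d hd] := choice hs; exists d; split => // t' t'0 ht'.
have [B hB] := taylor_bound t'0 ht' cb; exists B => n.
have : cseries (fun l => ('C(n + l, n))%:R * c (n + l)%N * w ^+ l * t'%:C ^+ n)
   (d n * t'%:C ^+ n).
  by rewrite mulrC; apply: cseries_ext (cseriesZ _ (hd n)) => l; rewrite mulrC.
have -> : cabs (d n) * t' ^+ n = cabs (d n * t'%:C ^+ n).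
  by rewrite cabsM cabsX cabsR ger0_norm.
move=> hc; apply: (cseries_cabs_le (M := fun l => ('C(n + l, n))%:R * cabs (c (n + l)%N) * cabs w ^+ l * t' ^+ n) hc).
  by move=> k; rewrite !cabsM cabs_nat !cabsX cabsR ger0_norm.
move=> K; apply: le_trans (hB (maxn K n.+1)).
apply: (@row_le_square (fun n l => ('C(n + l, n))%:R *
  cabs (c (n + l)%N) * cabs w ^+ l * t' ^+ n)) => i l.
by rewrite !mulr_ge0 ?exprn_ge0 ?cabs_ge0 // ltW.
Qed.

(* [X n] stands for the [n]-th power of an increment, or for an entry of it. *)
Lemma recenter c w d rho t K (X : nat -> R[i]) : taylor c w d ->
  0 <= t -> cabs w + t < rho -> bounded_at c rho ->
  (forall n, cabs (X n) <= K * t ^+ n) ->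
  exists s, cseries (fun n => d n * X n) s /\
    cseries (fun m => c m * \sum_(n < m.+1) X n * w ^+ (m - n) *+ 'C(m, n)) s.
Proof.
move=> hd t0 wt cb hX.
have K0 : 0 <= K by have := hX 0%N; rewrite expr0 mulr1; apply: le_trans; exact: cabs_ge0.
pose u n l := ('C(n + l, n))%:R * c (n + l)%N * w ^+ l * X n.
have [B hB] := taylor_bound t0 wt cb.
have [|r [s [hr rs ds _]]] := @double_series _ u (B * K).
  move=> J; apply: le_trans (ler_wpM2r K0 (hB J)).
  rewrite mulr_suml; apply: ler_sum => n _; rewrite mulr_suml; apply: ler_sum => l _.
  rewrite /u !cabsM cabs_nat cabsX -!mulrA.
  do 3! [rewrite ler_wpM2l ?exprn_ge0 ?cabs_ge0 ?ler0n //].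
  by rewrite mulrC.
exists s; split.
  apply: cseries_ext rs => n; apply: (cseries_unique (hr n)).
  by rewrite mulrC; apply: cseries_ext (cseriesZ _ (hd n)) => l; rewrite mulrC.
apply: cseries_ext ds => m; rewrite mulr_sumr; apply: eq_bigr => n _.
have e : (n + (m - n) = m)%N by rewrite subnKC // -ltnS.
by rewrite /u e -mulr_natl; ring.
Qed.

Lemma psum_recenter c w d rho h : taylor c w d -> bounded_at c rho ->
  cabs w + cabs h < rho -> exists s, psum c (w + h) s /\ psum d h s.
Proof.
move=> hd cb whr.
have [|s [h1 h2]] := @recenter c w d rho (cabs h) 1 (fun n => h ^+ n) hd
    (cabs_ge0 h) whr cb.
  by move=> n; rewrite mul1r cabsX.
exists s; split => //; apply: cseries_ext h2 => m; congr (_ * _).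
by rewrite exprDn; apply: eq_bigr => i _; rewrite [X in X *+ _]mulrC.
Qed.

(** With r = rho/2 and |h| <= r, each term of index k >= 1 satisfies |h|^k <= (|h|/r) r^k, and the
    sum of the |c_k| r^k is finite. *)
Lemma psum_lipschitz c rho : 0 < rho -> bounded_at c rho ->
  exists2 C, 0 <= C & forall h s, cabs h <= rho / 2 -> psum c h s ->
    cabs (s - c 0%N) <= C * cabs h.
Proof.
move=> r0 cb; have r2 : 0 < rho / 2 by rewrite divr_gt0.
have [|B hB] := bounded_at_summable (ltW r2) _ cb; first by lra.
have B0 : 0 <= B by have := hB 0%N; rewrite big_ord0.
exists (B / (rho / 2)); first by rewrite divr_ge0 // ltW.
move=> h s hr hs; apply: (ccvg_cabs_le (ccvgB hs (ccvg_cst (c 0%N)))).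
exists 1%N => -[//|n] _; rewrite big_ord_recl expr0 mulr1 addrKC.
rewrite (le_trans (cabs_sum _ _ _)) // -mulrA.
apply: le_trans (ler_wpM2r _ (hB n.+1)); last first.
  by rewrite mulr_ge0 ?cabs_ge0 // invr_ge0 ltW.
rewrite big_ord_recl /= mulrDl ler_wpDl //.
  by rewrite !mulr_ge0 ?cabs_ge0 ?invr_ge0 ?expr0 // ltW.
rewrite mulr_suml; apply: ler_sum => k _.
rewrite cabsM cabsX /bump /= add1n -mulrA ler_wpM2l ?cabs_ge0 //.
rewrite exprSr [in leRHS]exprSr -[leRHS]mulrA; rewrite [X in _ <= _ * X]mulrA divff ?gt_eqF // mul1r.
by rewrite ler_wpM2r ?cabs_ge0 // lerXn2r // nnegrE ?cabs_ge0 // ltW.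
Qed.

(** Once the coefficients below n vanish, dividing by h^n leaves a series with constant term c_n
    that still vanishes at points h arbitrarily close to 0, so the Lipschitz bound forces c_n =
    0. *)
Lemma psum_identity c rho : 0 < rho -> bounded_at c rho ->
  (forall e, 0 < e -> exists2 h, 0 < cabs h < e & psum c h 0) ->
  forall n, c n = 0.
Proof.
move=> r0 cb H n; elim/ltn_ind: n => n IH.
have cbn : bounded_at (fun k => c (n + k)%N) rho.
  have [B hB] := cb; exists (B / rho ^+ n) => k.
  by rewrite ler_pdivlMr ?exprn_gt0 // -mulrA -exprD [(k + n)%N]addnC.
have [C C0 hC] := psum_lipschitz r0 cbn.
apply/eqP; rewrite -cabs_eq0; apply/eqP/le_anti; rewrite cabs_ge0 andbT.
apply/ler_addgt0Pr => e e0; rewrite add0r.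
have C1 : 0 < C + 1 by rewrite ltr_wpDl.
have [|h /andP[h0 h1] hs] := H (Num.min (rho / 2) (e / (C + 1))).
  by rewrite lt_min !divr_gt0.
move: h1; rewrite lt_min => /andP[h1 h2].
have hs' : psum (fun k => c (n + k)%N) h 0.
  have hn : h ^+ n != 0 by rewrite expf_neq0 // -cabs_gt0.
  rewrite -(mulr0 (h ^+ n)^-1); apply: ccvg_ext (ccvgZ _ ((ccvg_shift n _ _).2 hs)) => m.
  rewrite addnC big_split_ord /= big1 ?add0r => [|i _]; last by rewrite IH ?mul0r.
  rewrite mulr_sumr; apply: eq_bigr => i _; rewrite exprD mulrCA mulKf //.
have := hC h 0 (ltW h1) hs'; rewrite sub0r cabsN addn0 => /le_trans; apply.
rewrite (le_trans _ (ltW (_ : (C + 1) * cabs h < e))) ?ler_wpM2r ?cabs_ge0 ?lerDl //.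
by rewrite mulrC -ltr_pdivlMr.
Qed.

(** Summation by parts, applied to the deviations of the partial sums from [s]. *)
Lemma abel_partial_sum (a r : nat -> R[i]) s z n :
  (forall k, r k = \sum_(j < k) a j - s) ->
  \sum_(k < n) a k * z ^+ k - s =
  r n * z ^+ n + (1 - z) * \sum_(k < n) r k.+1 * z ^+ k.
Proof.
move=> hr; elim: n => [|n IH].
  by rewrite !big_ord0 mulr0 addr0 expr0 mulr1 hr big_ord0.
rewrite !big_ord_recr /= addrAC IH.
have -> : a n = r n.+1 - r n by rewrite !hr big_ord_recr /=; ring.
by rewrite exprS; ring.
Qed.

(** From some index on the deviations [r k] are small, and there the geometric sum 1/(1 - |zeta|) is
    compensated by the Stolz condition; the finitely many earlier ones are killed by the factor 1 -
    zeta. *)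
Lemma abel_stolz (a : nat -> R[i]) s K (zeta A : nat -> R[i]) :
  cseries a s -> ccvg zeta 1 ->
  (forall m, cabs (zeta m) < 1) ->
  (forall m, cabs (1 - zeta m) <= K * (1 - cabs (zeta m))) ->
  (forall m, psum a (zeta m) (A m)) -> ccvg A s.
Proof.
move=> as_ z1 zlt1 zK hA.
pose r k := \sum_(j < k) a j - s.
have r0 : ccvg r 0 by rewrite -[0](subrr s); apply: ccvgB (ccvg_cst s).
have [B B0 rB] := ccvg_bounded r0.
have K0 : 0 <= K.
  have := le_trans (cabs_ge0 _) (zK 0%N); rewrite pmulr_lge0 // subr_gt0 //.
(* Three contributions share [e]: [e1] from the boundary term, [e1] from the first [J] indices and
   [K * e1] from the others. *)
move=> e e0; pose e1 := e / (K + 3).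
have e10 : 0 < e1 by rewrite divr_gt0 // ltr_wpDl.
have [J HJ] := r0 _ e10.
pose D := J%:R * B + 1.
have D0 : 0 < D by rewrite ltr_wpDl // mulr_ge0.
have [m0 Hm] := z1 _ (divr_gt0 e10 D0).
exists m0 => m /Hm; rewrite cabsB ltr_pdivlMr // => hm.
suff : cabs (A m - s) <= e1 + cabs (1 - zeta m) * D + K * e1.
  move=> h; apply: le_lt_trans h _.
  have -> : e = e1 * (K + 3) by rewrite divfK // gt_eqF // ltr_wpDl.
  lra.
apply: (ccvg_cabs_le (ccvgB (hA m) (ccvg_cst s))).
exists J => n Jn; rewrite (@abel_partial_sum a r) // (le_trans (cabsD _ _)) //.
set q := cabs (zeta m); have q0 : 0 <= q := cabs_ge0 _; have q1 : q < 1 := zlt1 m.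
have h1 : cabs (r n * zeta m ^+ n) <= e1.
  rewrite cabsM cabsX -[leRHS]mulr1 ler_pM ?cabs_ge0 ?exprn_ge0 //.
    by have := HJ _ Jn; rewrite subr0 => /ltW.
  by rewrite exprn_ile1 // ltW.
rewrite -addrA lerD // cabsM.
have h2 : cabs (\sum_(k < n) r k.+1 * zeta m ^+ k) <= J%:R * B + e1 / (1 - q).
  apply: le_trans (cabs_sum _ _ _) _; rewrite -(subnKC Jn) big_split_ord /=.
  apply: lerD.
    have -> : J%:R * B = \sum_(k < J) B by rewrite sumr_const card_ord mulr_natl.
    apply: ler_sum => k _; rewrite cabsM cabsX -[leRHS]mulr1.
    by rewrite ler_pM ?cabs_ge0 ?exprn_ge0 // exprn_ile1 // ltW.
  apply: le_trans (ler_wpM2l (ltW e10) (geometric_sum_le (n - J)%N q0 q1)).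
  rewrite mulr_sumr; apply: ler_sum => k _; rewrite cabsM cabsX.
  rewrite ler_pM ?cabs_ge0 ?exprn_ge0 //.
    have := HJ (J + k).+1 (leqW (leq_addr _ _)); rewrite subr0 => /ltW //.
  by rewrite -/q exprD ler_piMl ?exprn_ge0 // exprn_ile1 // ltW.
apply: le_trans (ler_wpM2l (cabs_ge0 _) h2) _; rewrite mulrDr lerD //.
  by rewrite ler_wpM2l ?cabs_ge0 // /D lerDl.
have q1' : 0 < 1 - q by rewrite subr_gt0.
rewrite mulrCA mulrC ler_wpM2r ?(ltW e10) // ler_pdivrMr //; exact: zK.
Qed.

Lemma psum_pow0 c : psum c 0 (c 0%N).
Proof.
have := @cseries_finite _ 1 (fun k => c k * 0 ^+ k).
rewrite big_ord1 expr0 mulr1; apply => -[//|k] _.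
by rewrite exprS mul0r mulr0.
Qed.

(* On the segment from [y] to [v] both sides are power series near every point,
   so their agreement near [y] propagates; the (possibly boundary) endpoint is
   reached by Abel's theorem in a Stolz angle. *)
Lemma taylor_series_sum c b rho y v L L' :
  bounded_at c rho -> cabs y < rho -> psum c v L ->
  taylor c y b -> psum b (v - y) L' -> L = L'.
Proof.
move=> cb yr cv hb bv.
have [h0|h0] := eqVneq v y.
  rewrite h0 subrr in bv; have -> := cseries_unique bv (psum_pow0 b).
  rewrite h0 in cv; apply: (cseries_unique cv).
  by apply: cseries_ext (hb 0%N) => l; rewrite bin0 mul1r add0n.
(* Convergence at [v] extends the bound on the coefficients to |v|, so that [v] lies in the closed
   disc and every earlier point of the segment in the open one. *)
pose rho' := Num.max rho (cabs v).
have cb' : bounded_at c rho'.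
  by rewrite /rho'; case: leP => // _; exact: psum_bounded_at cv.
have yr' : cabs y < rho' by rewrite lt_max yr.
have vr' : cabs v <= rho' by rewrite le_max lexx orbT.
pose h := v - y; pose pt (t : R) := y + t%:C * h.
have h_gt0 : 0 < cabs h by rewrite cabs_gt0 subr_eq0.
have pt_le (t : R) : 0 <= t -> t < 1 -> cabs (pt t) < rho'.
  move=> t0 t1; have -> : pt t = (1 - t)%:C * y + t%:C * v.
    by rewrite /pt /h rmorphB /= rmorph1; ring.
  apply: le_lt_trans (cabsD _ _) _; rewrite !cabsM !cabsR.
  rewrite !ger0_norm // ?subr_ge0 ?(ltW t1) //.
  have -> : rho' = (1 - t) * rho' + t * rho' by ring.
  by apply: ltr_leD; [rewrite ltr_pM2l // subr_gt0|rewrite ler_wpM2l].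
(* The side conditions sit under the existential so that choice yields total functions of [t];
   outside [0, 1[ the values are arbitrary. *)
have hF (t : R) : exists s, 0 <= t -> t < 1 -> psum c (pt t) s.
  have [[t0 t1]|H] := pselect (0 <= t /\ t < 1); last by exists 0 => t0 t1; case: H.
  by have [s hs] := psum_ex (pt_le t t0 t1) cb'; exists s.
have [F HF] := choice hF.
have bb := psum_bounded_at bv; rewrite -/h in bb bv.
have th_le (t : R) : 0 <= t -> t < 1 -> cabs (t%:C * h) < cabs h.
  by move=> t0 t1; rewrite cabsM cabsR ger0_norm // gtr_pMl.
have hG (t : R) : exists s, 0 <= t -> t < 1 -> psum b (t%:C * h) s.
  have [[t0 t1]|H] := pselect (0 <= t /\ t < 1); last by exists 0 => t0 t1; case: H.
  by have [s hs] := psum_ex (th_le t t0 t1) bb; exists s.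
have [G HG] := choice hG.
(* Re-expanding both series at parameter [T] makes [F - G] a single power series in the
   displacement, on a radius governed by the distances to the two boundary circles. *)
have loc (T : R) : 0 <= T -> T < 1 -> exists d, exists2 eta : R, 0 < eta &
    bounded_at d (eta * cabs h) /\
    (forall s : R, `|s| < eta -> 0 <= T + s -> T + s < 1 ->
      psum d (s%:C * h) (F (T + s) - G (T + s))).
  move=> T0 T1; have [d1 [hd1 bd1]] := taylor_ex (pt_le T T0 T1) cb'.
  have [d2 [hd2 bd2]] := taylor_ex (th_le T T0 T1) bb.
  pose m := Num.min (rho' - cabs (pt T)) (cabs h - cabs (T%:C * h)).
  have m0 : 0 < m by rewrite lt_min !subr_gt0 pt_le // th_le.
  pose eta := m / 2 / cabs h.
  have eta0 : 0 < eta by rewrite !divr_gt0.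
  have etah : eta * cabs h = m / 2 by rewrite divfK // gt_eqF.
  have hm1 : m <= rho' - cabs (pt T) by rewrite ge_min lexx.
  have hm2 : m <= cabs h - cabs (T%:C * h) by rewrite ge_min lexx orbT.
  exists (fun n => d1 n - d2 n), eta => //; split.
    have [|| B1 hB1] := bd1 (eta * cabs h); first by rewrite etah; lra.
      by rewrite etah; lra.
    have [|| B2 hB2] := bd2 (eta * cabs h); first by rewrite etah; lra.
      by rewrite etah; lra.
    exists (B1 + B2) => k; apply: le_trans (lerD (hB1 k) (hB2 k)).
    rewrite -mulrDl ler_wpM2r ?exprn_ge0 //; first by rewrite etah; lra.
    by rewrite (le_trans (cabsD _ _)) // cabsN.
  move=> s hs Ts0 Ts1.
  have sh : cabs (s%:C * h) < m / 2 by rewrite cabsM cabsR -etah ltr_pM2r.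
  have [|s1 [h1 h1']] := psum_recenter hd1 cb' (h := s%:C * h); first by lra.
  have [|s2 [h2 h2']] := psum_recenter hd2 bb (h := s%:C * h); first by lra.
  have e1 : s1 = F (T + s).
    apply: (cseries_unique h1); have := HF _ Ts0 Ts1.
    by rewrite /pt rmorphD /= mulrDl addrA.
  have e2 : s2 = G (T + s).
    apply: (cseries_unique h2); have := HG _ Ts0 Ts1.
    by rewrite rmorphD /= mulrDl.
  rewrite -e1 -e2; rewrite -mulN1r.
  apply: cseries_ext (cseriesD h1' (cseriesZ (-1) h2')) => k.
  by rewrite mulN1r mulrBl.
pose E := [set T : R | 0 <= T < 1 /\ forall t, 0 <= t -> t <= T -> F t = G t].
(* Zeros of [F - G] accumulating at [T] annihilate the local series, so [F - G] vanishes on both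
   sides of [T], although zeros may be known on one side only. *)
have extend T : 0 <= T -> T < 1 ->
    (forall e : R, 0 < e -> exists s : R, [/\ 0 < `|s| < e, 0 <= T + s, T + s < 1 &
      F (T + s) = G (T + s)]) ->
    exists2 eta : R, 0 < eta & forall s : R, `|s| < eta -> 0 <= T + s -> T + s < 1 -> F (T + s) = G (T + s).
  move=> T0 T1 acc; have [d [eta eta0 [db hd]]] := loc T T0 T1.
  exists eta => // s hs Ts0 Ts1.
  have d0 : forall n, d n = 0.
    apply: (psum_identity _ db); first by rewrite mulr_gt0.
    move=> e e0; have [|s' [/andP[s'0 s'e] T0' T1' FG]] := acc (Num.min eta (e / cabs h)).
      by rewrite lt_min eta0 divr_gt0.
    move: s'e; rewrite lt_min => /andP[s'1 s'2].
    exists (s'%:C * h).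
      rewrite cabsM cabsR mulr_gt0 //= -ltr_pdivlMr //.
    by have := hd _ s'1 T0' T1'; rewrite FG subrr.
  apply/eqP; rewrite -subr_eq0; apply/eqP; apply: (cseries_unique (hd _ hs Ts0 Ts1)).
  have := @cseries_finite R 0%N (fun k => d k * (s%:C * h) ^+ k).
  by rewrite big_ord0; apply => k _; rewrite d0 mul0r.
(* Near [y] the agreement is the re-expansion itself, since [b] is the Taylor sequence of [c] at
   [y]. *)
have [eta0 eta00 H0] : exists2 eta : R, 0 < eta < 1 & forall s, 0 <= s -> s <= eta -> F s = G s.
  pose eta := Num.min (1 / 2) ((rho' - cabs y) / 2 / cabs h).
  have eta0 : 0 < eta by rewrite lt_min !divr_gt0 // subr_gt0.
  have eta1 : eta <= 1 / 2 by rewrite ge_min lexx.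
  exists eta; first by rewrite eta0; lra.
  move=> s s0 se; have s1 : s < 1 by lra.
  have hs : cabs (s%:C * h) <= (rho' - cabs y) / 2.
    rewrite cabsM cabsR ger0_norm // -ler_pdivlMr // (le_trans se) //.
    by rewrite ge_min lexx orbT.
  have [|s' [h1 h2]] := psum_recenter hb cb' (h := s%:C * h); first by lra.
  by rewrite -(cseries_unique h1 (HF _ s0 s1)) (cseries_unique h2 (HG _ s0 s1)).
have E0 : E eta0 by case/andP: eta00 => a a1; split; [rewrite a1 ltW|].
have supE : has_sup E.
  by split; [exists eta0|exists 1 => t [/andP[_ /ltW]]].
(* If agreement failed at [T], the supremum of [E] would be at most [T] < 1; the agreement below the
   supremum accumulates there, and [extend] pushes past it. *)
have E_all T : 0 <= T -> T < 1 -> F T = G T.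
  move=> T0 T1; apply: contrapT => FG.
  pose S := sup E.
  have ST : S <= T.
    apply: ge_sup; first by exists eta0.
    move=> t [_ ht]; rewrite leNgt; apply/negP => Tt; apply: FG.
    by apply: ht => //; exact: ltW.
  have S_gt0 : 0 < S by case/andP: eta00 => a _; rewrite (lt_le_trans a) // ub_le_sup //; exact: supE.2.
  have below t : 0 <= t -> t < S -> F t = G t.
    move=> t0 tS; have [t' Et' tt'] := sup_gt supE.1 tS.
    by case: Et' => _; apply => //; exact: ltW.
  have [||| eta eta_gt0 H] := extend S; rewrite ?(ltW S_gt0) ?(le_lt_trans ST) //.
    move=> e e0; exists (- (Num.min S e / 2)).
    have m0 : 0 < Num.min S e by rewrite lt_min S_gt0.
    have mS : Num.min S e <= S by rewrite ge_min lexx.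
    have me : Num.min S e <= e by rewrite ge_min lexx orbT.
    split; [|lra|lra|apply: below; lra].
    by rewrite normrN gtr0_norm; lra.
  pose m := Num.min eta (1 - S).
  have m0 : 0 < m by rewrite lt_min eta_gt0 subr_gt0 (le_lt_trans ST).
  have m1 : m <= eta by rewrite ge_min lexx.
  have m2 : m <= 1 - S by rewrite ge_min lexx orbT.
  have : E (S + m / 2).
    split; first by apply/andP; split; lra.
    move=> t t0 tS; have [ltS|leS] := ltP t S; first exact: below.
    have := H (t - S); rewrite subrKC; apply => //; last by lra.
    by rewrite ger0_norm; lra.
  move=> /(ub_le_sup supE.2); rewrite -/S; lra.
pose tau n : R := n.+1%:R^-1; pose t n := 1 - tau n.
have tau0 n : 0 < tau n by rewrite invr_gt0.
have tau1 n : tau n <= 1 by rewrite invf_le1 // ler1n.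
have tauc : ccvg (fun n => (tau n)%:C) 0.
  by have := ccvg_real (cvg_harmonic (R := R)); rewrite rmorph0.
have t0 n : 0 <= t n by rewrite subr_ge0.
have t1 n : t n < 1 by rewrite gtrBl.
(* The series [b] is approached along a radius, so the Stolz constant is 1. *)
have GL : ccvg (fun n => G (t n)) L'.
  apply: (@abel_stolz (fun k => b k * h ^+ k) L' 1 (fun n => (t n)%:C)) => //.
  - by rewrite -[1]subr0; have := ccvgB (ccvg_cst 1) tauc; apply: ccvg_ext => n; rewrite /t rmorphB rmorph1.
  - by move=> n; rewrite cabsR ger0_norm.
  - move=> n; rewrite mul1r cabsR ger0_norm // /t rmorphB rmorph1 opprB addrCA subrr addr0.
    by rewrite subKr cabsR gtr0_norm.
  - move=> n; apply: cseries_ext (HG _ (t0 n) (t1 n)) => k.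
    by rewrite exprMn; ring.
suff FL : ccvg (fun n => F (t n)) L.
  apply: (ccvg_unique FL); apply: ccvg_ext GL => n; rewrite E_all //.
have ptE n : pt (t n) = v - (tau n)%:C * h.
  by rewrite /pt /t rmorphB rmorph1 /h; ring.
(* If |v| <= |y|, then [v] is interior to the disc of radius [rho'], and continuity at [v]
   suffices. *)
have [vy|yv] := leP (cabs v) (cabs y).
  have [d [hd db]] := taylor_ex (le_lt_trans vy yr') cb'.
  pose eta := (rho' - cabs v) / 2.
  have eta_gt0 : 0 < eta by rewrite divr_gt0 // subr_gt0 (le_lt_trans vy).
  have [||C C0 hC] := psum_lipschitz eta_gt0 (db eta _ _); [exact: ltW|by rewrite /eta; lra|].
  have d0 : d 0%N = L.
    apply: (cseries_unique _ cv).
    by apply: cseries_ext (hd 0%N) => l; rewrite bin0 mul1r add0n.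
  have [n0 Hn0] := tauc _ (divr_gt0 (divr_gt0 eta_gt0 (ltr0n R 2)) h_gt0).
  apply: (@ccvg_squeeze _ _ _ (fun n => C * cabs h * tau n)).
    rewrite -(mulr0 (C * cabs h)); apply: cvgMr; exact: cvg_harmonic.
  exists n0 => n /Hn0; rewrite subr0 cabsR gtr0_norm // ltr_pdivlMr // => hn.
  have ch : cabs (- ((tau n)%:C * h)) = tau n * cabs h.
    by rewrite cabsN cabsM cabsR gtr0_norm.
  have [|s [h1 h2]] := psum_recenter hd cb' (h := - ((tau n)%:C * h)).
    by rewrite ch; rewrite /eta in hn; lra.
  have es : s = F (t n).
    by apply: (cseries_unique h1); have := HF _ (t0 n) (t1 n); rewrite ptE.
  have := hC _ _ _ h2; rewrite es d0 ch => /(_ (ltW hn)) /le_trans; apply.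
  by rewrite mulrAC mulrA.
have v0 : v != 0 by rewrite -cabs_gt0 (le_lt_trans (cabs_ge0 y)).
have cv0 : 0 < cabs v by rewrite cabs_gt0.
(* Divided by [v], the segment is zeta = 1 - tau (1 - y/v), and |zeta| <= 1 - tau (1 - q). As q < 1,
   it stays in a Stolz angle with constant |1 - y/v| / (1 - q). *)
pose q := cabs y / cabs v.
have q1 : q < 1 by rewrite ltr_pdivrMr // mul1r.
have q0 : 0 <= q by rewrite divr_ge0 ?cabs_ge0.
pose zeta n := pt (t n) / v.
have zE n : zeta n = (t n)%:C + (tau n)%:C * (y / v).
  by rewrite /zeta ptE /h /t rmorphB rmorph1; field.
have zE' n : 1 - zeta n = (tau n)%:C * (1 - y / v).
  by rewrite zE /t rmorphB rmorph1; ring.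
have zb n : cabs (zeta n) <= 1 - tau n * (1 - q).
  rewrite zE (le_trans (cabsD _ _)) // cabsM !cabsR cabsM cabsV -/q.
  by rewrite (ger0_norm (t0 n)) (gtr0_norm (tau0 n)) /t; lra.
apply: (@abel_stolz (fun k => c k * v ^+ k) L (cabs (1 - y / v) / (1 - q)) zeta) => //.
- have := ccvgB (ccvg_cst 1) (ccvgZ (1 - y / v) tauc); rewrite mulr0 subr0.
  by apply: ccvg_ext => n; rewrite mulrC -zE' subKr.
- by move=> n; apply: le_lt_trans (zb n) _; rewrite gtrBl mulr_gt0 // subr_gt0.
- move=> n; rewrite zE' cabsM cabsR gtr0_norm // mulrAC ler_pdivlMr ?subr_gt0 //.
  rewrite mulrAC mulrC ler_wpM2l ?cabs_ge0 //; have := zb n; lra.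
- move=> n; apply: cseries_ext (HF _ (t0 n) (t1 n)) => k.
  by rewrite -mulrA -exprMn /zeta [v * _]mulrC divfK.
Qed.

End PowerSeries.

(** * Entire functions of matrices *)

Section EntireCalculus.
Variable R : realType.
Implicit Types (a b c d : nat -> R[i]) (w z : R[i]).

Definition entire a := forall t : R, 0 <= t -> bounded_at a t.

Lemma entire_summable a t : 0 <= t -> entire a ->
  rsummable (fun k => cabs (a k) * t ^+ k).
Proof.
move=> t0 ea; apply: (@bounded_at_summable _ _ _ (t + 1)); rewrite ?ltrDl //.
by apply: ea; rewrite addr_ge0.
Qed.

Lemma entire_psum_ex a z : entire a -> exists s, psum a z s.
Proof.
move=> ea; apply: (@psum_ex _ _ _ (cabs z + 1)); rewrite ?ltrDl //.
by apply: ea; rewrite addr_ge0 ?cabs_ge0.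
Qed.

(** Radii are treated one at a time; uniqueness of Taylor coefficients makes the sequence found for
    one radius serve for all. *)
Lemma entire_taylor a w : entire a -> exists d, taylor a w d /\ entire d.
Proof.
move=> ea.
have h t : 0 <= t -> exists d, taylor a w d /\ bounded_at d t.
  move=> t0; have h1 : cabs w < cabs w + t + 1 by rewrite -addrA ltrDl ltr_wpDl.
  have h2 : bounded_at a (cabs w + t + 1) by apply: ea; rewrite !addr_ge0 ?cabs_ge0.
  have [d [hd bd]] := taylor_ex h1 h2; exists d; split => //.
  by apply: bd => //; rewrite ltrDl.
have [d [hd _]] := h 0 (lexx 0).
exists d; split => // t /h [d' [hd' [B hB]]].
by exists B => k; rewrite (taylor_unique hd hd').
Qed.

Definition cauchy_prod a b n := \sum_(j < n.+1) a j * b (n - j)%N.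

Lemma cauchy_prod_summable a b t n B C : 0 <= t ->
  (forall n, \sum_(k < n) cabs (a k) * t ^+ k <= B) ->
  (forall n, \sum_(k < n) cabs (b k) * t ^+ k <= C) ->
  \sum_(p < n) \sum_(q < n) cabs (a p) * t ^+ p * (cabs (b q) * t ^+ q) <= B * C.
Proof.
move=> t0 hB hC; under eq_bigr do rewrite -mulr_sumr.
rewrite -mulr_suml ler_pM // ?sumr_ge0 // => i _;
  by rewrite mulr_ge0 ?cabs_ge0 ?exprn_ge0.
Qed.

Lemma entire_cauchy_prod a b : entire a -> entire b -> entire (cauchy_prod a b).
Proof.
move=> ea eb t t0.
have [B hB] := entire_summable t0 ea; have [C hC] := eb t t0.
exists (B * C) => n; apply: le_trans (ler_wpM2r _ (cabs_sum _ _ _)) _.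
  exact: exprn_ge0.
have C0 : 0 <= C.
  by apply: le_trans (hC 0%N); rewrite expr0 mulr1 cabs_ge0.
apply: le_trans (ler_wpM2r C0 (hB n.+1)).
rewrite !mulr_suml; apply: ler_sum => j _; rewrite cabsM.
have -> : t ^+ n = t ^+ j * t ^+ (n - j) by rewrite -exprD subnKC // -ltnS.
rewrite mulrACA ler_wpM2l // mulr_ge0 ?cabs_ge0 ?exprn_ge0 //.
Qed.

(** [X] stands for the powers of a number or for one entry of the powers of a matrix, so that the
    scalar and the matrix product rules share this rearrangement. *)
Lemma cauchy_prod_series a b t K (X : nat -> R[i]) : entire a -> entire b -> 0 <= t ->
  (forall n, cabs (X n) <= K * t ^+ n) ->
  exists s, cseries (fun n => cauchy_prod a b n * X n) s /\
    ccvg (fun n => \sum_(p < n) \sum_(q < n) a p * b q * X (p + q)%N) s.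
Proof.
move=> ea eb t0 hX.
have K0 : 0 <= K by have := hX 0%N; rewrite expr0 mulr1; apply: le_trans; exact: cabs_ge0.
have [B hB] := entire_summable t0 ea; have [C hC] := entire_summable t0 eb.
have [|r [s [_ _ h1 h2]]] :=
    @double_series _ (fun p q => a p * b q * X (p + q)%N) (B * C * K).
  move=> n; apply: le_trans (ler_wpM2r K0 (cauchy_prod_summable n t0 hB hC)).
  rewrite mulr_suml; apply: ler_sum => p _; rewrite mulr_suml; apply: ler_sum => q _.
  rewrite !cabsM; apply: le_trans (ler_wpM2l _ (hX _)) _.
    by rewrite mulr_ge0 ?cabs_ge0.
  by rewrite exprD le_eqVlt; apply/orP; left; apply/eqP; ring.
exists s; split => //; apply: cseries_ext h1 => n.
rewrite /cauchy_prod mulr_suml; apply: eq_bigr => j _.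
by rewrite subnKC // -ltnS.
Qed.

Lemma psum_cauchy_prod a b z s t : entire a -> entire b -> psum a z s -> psum b z t ->
  psum (cauchy_prod a b) z (s * t).
Proof.
move=> ea eb hs ht.
have [|r [h1 h2]] := @cauchy_prod_series a b (cabs z) 1 (fun n => z ^+ n) ea eb (cabs_ge0 z).
  by move=> n; rewrite cabsX mul1r.
have -> : s * t = r; last by [].
apply: (ccvg_unique _ h2); apply: ccvg_ext (ccvgM hs ht) => n.
rewrite mulr_suml; apply: eq_bigr => p _; rewrite mulr_sumr; apply: eq_bigr => q _.
by rewrite exprD; ring.
Qed.

Section Matrices.
Variable N : nat.
Implicit Types (M X Y Z : 'M[R[i]]_N).

(** Submultiplicative, and the quantity that [contour_radius] exceeds by 1. *)
Definition mxn M : R := \sum_i \sum_j cabs (M i j).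

Lemma mxn_ge0 M : 0 <= mxn M.
Proof. by rewrite sumr_ge0 // => i _; rewrite sumr_ge0 // => j _; exact: cabs_ge0. Qed.

Lemma row_le_mxn M i : \sum_j cabs (M i j) <= mxn M.
Proof.
rewrite /mxn [leRHS](bigD1 i) //= lerDl sumr_ge0 // => k _.
by rewrite sumr_ge0 // => j _; exact: cabs_ge0.
Qed.

Lemma entry_le_mxn M i j : cabs (M i j) <= mxn M.
Proof.
apply: le_trans (row_le_mxn M i); rewrite [leRHS](bigD1 j) //= lerDl sumr_ge0 // => k _.
exact: cabs_ge0.
Qed.

Lemma mxnM X Y : mxn (X *m Y) <= mxn X * mxn Y.
Proof.
rewrite /mxn mulr_suml; apply: ler_sum => i _.
apply: (@le_trans _ _ (\sum_j \sum_k cabs (X i k) * cabs (Y k j))).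
  apply: ler_sum => j _; rewrite mxE; apply: le_trans (cabs_sum _ _ _) _.
  by apply: ler_sum => k _; rewrite cabsM.
rewrite exchange_big /= mulr_suml; apply: ler_sum => k _; rewrite -mulr_sumr.
by rewrite ler_wpM2l ?cabs_ge0 // row_le_mxn.
Qed.

Lemma mxnD X Y : mxn (X + Y) <= mxn X + mxn Y.
Proof.
rewrite /mxn -big_split; apply: ler_sum => i _ /=; rewrite -big_split /=.
by apply: ler_sum => j _; rewrite mxE cabsD.
Qed.

Lemma mxnZ (c : R[i]) M : mxn (c *: M) = cabs c * mxn M.
Proof.
rewrite /mxn mulr_sumr; apply: eq_bigr => i _; rewrite mulr_sumr.
by apply: eq_bigr => j _; rewrite mxE cabsM.
Qed.

Lemma mxnN M : mxn (- M) = mxn M.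
Proof. by rewrite -scaleN1r mxnZ cabsN cabs1 mul1r. Qed.

Lemma mxn0 : mxn 0 = 0.
Proof. by rewrite /mxn big1 // => i _; rewrite big1 // => j _; rewrite mxE cabs0. Qed.

(** Stated for entries because [mxn] of the identity is [N], so that the corresponding bound on
    [mxn (M ^+ k)] can fail at k = 0. *)
Lemma entryX_le M k i j : cabs ((M ^+ k) i j) <= mxn M ^+ k.
Proof.
case: k => [|k].
  rewrite !expr0 -[1]/(1%:M) mxE; case: (_ == _); by rewrite ?cabs1 ?cabs0.
apply: le_trans (entry_le_mxn _ _ _) _; elim: k => [|k IH]; first by rewrite !expr1.
rewrite exprS [leRHS]exprS; apply: le_trans (mxnM _ _) _.
by rewrite ler_wpM2l ?mxn_ge0.
Qed.

(** Kept as a relation, so that contour integrals, improper integrals and matrix products can each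
    be shown to be the value of a power series at [M]. *)
Definition mxpsum a M X := forall i j, cseries (fun k => a k * (M ^+ k) i j) (X i j).

Lemma mxpsum_ex a M : entire a -> exists X, mxpsum a M X.
Proof.
move=> ea; have h i j : exists s, cseries (fun k => a k * (M ^+ k) i j) s.
  apply: (@rsummable_cseries _ _ (fun k => cabs (a k) * mxn M ^+ k)).
    by move=> k; rewrite cabsM ler_wpM2l ?cabs_ge0 ?entryX_le.
  by apply: entire_summable; rewrite ?mxn_ge0.
exists (\matrix_(i, j) projT1 (cid (h i j))) => i j; rewrite mxE.
exact: (projT2 (cid (h i j))).
Qed.

Lemma mxpsum_unique a M X Y : mxpsum a M X -> mxpsum a M Y -> X = Y.
Proof. by move=> hX hY; apply/matrixP => i j; exact: cseries_unique (hX i j) (hY i j). Qed.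

Lemma mxpsum_ext a b M X : a =1 b -> mxpsum a M X -> mxpsum b M X.
Proof. by move=> ab hX i j; apply: cseries_ext (hX i j) => k; rewrite ab. Qed.

Lemma comm_scalar_mxC M w : GRing.comm (w%:M : 'M[R[i]]_N) M.
Proof. by rewrite /GRing.comm -[LHS]/(_ *m _) -[RHS]/(_ *m _) scalar_mxC. Qed.

(** A scalar matrix commutes with [M], so the binomial theorem applies as for numbers, with the
    entries of M^n in the role of h^n. *)
Lemma mxpsum_recenter a w d M X : entire a -> taylor a w d ->
  mxpsum a (M + w%:M) X -> mxpsum d M X.
Proof.
move=> ea hd hX i j.
have h1 : cabs w + mxn M < cabs w + mxn M + 1 by rewrite ltrDl.
have h2 : bounded_at a (cabs w + mxn M + 1).
  by apply: ea; rewrite !addr_ge0 ?cabs_ge0 ?mxn_ge0.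
have [n|s [h3 h4]] := recenter (K := 1) (X := fun n => (M ^+ n) i j) hd (mxn_ge0 M) h1 h2.
  by rewrite mul1r entryX_le.
have -> : X i j = s; last by [].
apply: (cseries_unique (hX i j)); apply: cseries_ext h4 => m; congr (_ * _).
rewrite [M + _]addrC exprDn_comm; last exact: comm_scalar_mxC.
rewrite summxE; apply: eq_bigr => n _.
have -> : (w%:M : 'M[R[i]]_N) ^+ (m - n) = (w ^+ (m - n))%:M.
  elim: (m - n)%N => [|k IH]; first by rewrite !expr0.
  by rewrite !exprS IH -[_ * _]/(_ *m _) -scalar_mxM.
rewrite mulmxnE; congr (_ *+ _).
have -> : (w ^+ (m - n))%:M * M ^+ n = w ^+ (m - n) *: M ^+ n by exact: mul_scalar_mx.
by rewrite mxE mulrC.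
Qed.

Lemma mxpsum_cauchy_prod a b M X Y : entire a -> entire b ->
  mxpsum a M X -> mxpsum b M Y -> mxpsum (cauchy_prod a b) M (X *m Y).
Proof.
move=> ea eb hX hY i j.
have [|r [h1 h2]] := @cauchy_prod_series a b (mxn M) 1 (fun n => (M ^+ n) i j) ea eb (mxn_ge0 M).
  by move=> n; rewrite mul1r entryX_le.
have -> : (X *m Y) i j = r; last by [].
rewrite mxE; apply: (ccvg_unique _ h2).
apply: ccvg_ext (ccvg_sum (index_enum _) (P := predT)
  (fun l _ => ccvgM (hX i l) (hY l j))) => n.
under eq_bigr do rewrite mulr_suml; rewrite exchange_big; apply: eq_bigr => p _ /=.
under eq_bigr do rewrite mulr_sumr; rewrite exchange_big; apply: eq_bigr => q _ /=.
rewrite exprD mxE mulr_sumr; apply: eq_bigr => l _; ring.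
Qed.

Lemma ccvg_mulmx_entry m (u : nat -> 'M[R[i]]_N) X (v : 'M[R[i]]_(m, N)) i j :
  (forall i j, ccvg (fun n => u n i j) (X i j)) ->
  ccvg (fun n => (v *m u n) i j) ((v *m X) i j).
Proof.
move=> uX; rewrite mxE; under eq_fun do rewrite mxE.
by apply: ccvg_sum => l _; apply: ccvgZ.
Qed.

Lemma ccvg_mulmxr_entry m (u : nat -> 'M[R[i]]_N) X (v : 'M[R[i]]_(N, m)) i j :
  (forall i j, ccvg (fun n => u n i j) (X i j)) ->
  ccvg (fun n => (u n *m v) i j) ((X *m v) i j).
Proof.
move=> uX; rewrite mxE; under eq_fun do rewrite mxE.
by apply: ccvg_sum => l _; rewrite mulrC; apply: ccvg_ext (ccvgZ _ (uX _ _)) => n; rewrite mulrC.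
Qed.

Lemma mxpsum_partial a M X : mxpsum a M X ->
  forall i j, ccvg (fun n => (\sum_(k < n) a k *: M ^+ k) i j) (X i j).
Proof.
move=> hX i j; apply: ccvg_ext (hX i j) => n; rewrite summxE.
by apply: eq_bigr => k _; rewrite mxE.
Qed.

Lemma mxpsum_comm a M X Z : M *m Z = Z *m M -> mxpsum a M X -> X *m Z = Z *m X.
Proof.
move=> MZ /mxpsum_partial hX; apply/matrixP => i j.
apply: (ccvg_unique (ccvg_mulmxr_entry Z i j hX)).
apply: ccvg_ext (ccvg_mulmx_entry Z i j hX) => n; congr (fun_of_matrix _ i j).
rewrite mulmx_suml mulmx_sumr; apply: eq_bigr => k _.
rewrite -scalemxAl -scalemxAr; congr (_ *: _); apply/esym.
have h : GRing.comm Z M by exact/esym.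
exact: esym (commrX k h).
Qed.

Lemma eigenX (v : 'rV[R[i]]_N) M w k : v *m M = w *: v -> v *m M ^+ k = w ^+ k *: v.
Proof.
move=> vM; elim: k => [|k IH]; first by rewrite !expr0 scale1r mulmx1.
by rewrite exprSr -[_ * _]/(_ *m _) mulmxA IH -scalemxAl vM scalerA -exprSr.
Qed.

Lemma mxpsum_eigen a M X (v : 'rV[R[i]]_N) w s : mxpsum a M X ->
  v *m M = w *: v -> psum a w s -> v *m X = s *: v.
Proof.
move=> /mxpsum_partial hX vM hs; apply/rowP => j.
apply: (ccvg_unique (ccvg_mulmx_entry v 0 j hX)).
rewrite mxE mulrC; apply: ccvg_ext (ccvgZ _ hs) => n.
rewrite mulmx_sumr summxE mulr_sumr; apply: eq_bigr => k _.
by rewrite -scalemxAr (eigenX _ vM) scalerA [in RHS]mxE mulrC.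
Qed.

End Matrices.
End EntireCalculus.

(** * The exponential series *)

Section ComplexExponential.
Variable R : realType.
Implicit Types (z w : R[i]).

Definition inv_fact (k : nat) : R[i] := (k`!%:R)^-1.

Lemma cexpD z w : cexp (z + w) = cexp z * cexp w.
Proof.
case: z => a b; case: w => c d; rewrite /cexp /= expRD cosD sinD rmorphM /=.
by rewrite mulrACA; congr (_ * _); simpc; congr (_ +i* _); rewrite addrC.
Qed.

Lemma cabs_cexp z : cabs (cexp z) = expR (complex.Re z).
Proof.
rewrite /cexp cabsM cabsR ger0_norm ?expR_ge0 //.
suff -> : cabs (cos (complex.Im z) +i* sin (complex.Im z)) = 1 by rewrite mulr1.
by rewrite /cabs normc_def /= cos2Dsin2 sqrtr1.
Qed.

Lemma cexp0 : cexp 0 = 1 :> R[i].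
Proof. by rewrite /cexp /= expR0 cos0 sin0 mul1r. Qed.

Lemma cexp_neq0 z : cexp z != 0.
Proof. by rewrite -cabs_gt0 cabs_cexp expR_gt0. Qed.

Lemma cexp_real (a : R) : cexp a%:C = (expR a)%:C.
Proof. by rewrite /cexp /= cos0 sin0 mulr1. Qed.

Lemma cexpX z n : cexp z ^+ n = cexp (z *+ n).
Proof. by elim: n => [|n IH]; rewrite ?expr0 ?mulr0n ?cexp0 // exprS IH mulrS cexpD. Qed.

Lemma cexpN z : cexp (- z) = (cexp z)^-1.
Proof.
by apply: (mulfI (cexp_neq0 z)); rewrite -cexpD subrr cexp0 divff ?cexp_neq0.
Qed.

Lemma psum_expR (a : R) : psum inv_fact a%:C (expR a)%:C.
Proof.
have h := is_cvg_series_exp_coeff a; rewrite /psum /cseries.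
have : (fun n => \sum_(k < n) exp_coeff a k) @ \oo --> expR a.
  have -> : (fun n => \sum_(k < n) exp_coeff a k) = series (exp_coeff a).
    by apply/funext => n; rewrite seriesEnat /= big_mkord.
  exact: h.
move/ccvg_real; apply: ccvg_ext => n; rewrite rmorph_sum; apply: eq_bigr => k _.
by rewrite /exp_coeff /= rmorphM /= fmorphV rmorph_nat rmorphXn mulrC.
Qed.

Lemma entire_inv_fact : entire inv_fact.
Proof.
move=> t t0; have := psum_bounded_at (psum_expR t).
by rewrite cabsR ger0_norm.
Qed.

(** Written in the shape of [cos_coeff] and [sin_coeff], with boolean factors selecting the
    parity. *)
Lemma imagX (b : R) k : (0 +i* b) ^+ k =
  ((~~ odd k)%:R * (-1) ^+ k./2 * b ^+ k) +i* ((odd k)%:R * (-1) ^+ k.-1./2 * b ^+ k).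
Proof.
elim: k => [|k IH]; first by rewrite !expr0 /= !mul1r mul0r mul0r.
rewrite exprS IH /=; case: (boolP (odd k)) => ok /=; simpc.
  have e : uphalf k = (k.-1)./2.+1 by case: k ok {IH} => // k.
  by rewrite e !exprS; congr (_ +i* _); rewrite ?mul1r ?mul0r //; ring.
by rewrite !exprS; congr (_ +i* _); rewrite ?mul1r ?mul0r ?mulr0 ?oppr0 //; ring.
Qed.

Lemma psum_expi (b : R) : psum inv_fact (0 +i* b) (cos b +i* sin b).
Proof.
have E k : inv_fact k * (0 +i* b) ^+ k = cos_coeff b k +i* sin_coeff b k.
  rewrite imagX /inv_fact -(rmorph_nat (real_complex R)) -fmorphV /=.
  rewrite /cos_coeff /sin_coeff /=; simpc.
  by congr (_ +i* _); rewrite mulrC.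
rewrite /psum /cseries; apply: ccvg_ReIm => /=.
  have -> : (fun n => complex.Re (\sum_(k < n) inv_fact k * (0 +i* b) ^+ k)) =
      series (cos_coeff b).
    apply/funext => n; rewrite seriesEnat /= big_mkord raddf_sum.
    by apply: eq_bigr => k _; rewrite E.
  by rewrite unlock; exact: is_cvg_series_cos_coeff.
have -> : (fun n => complex.Im (\sum_(k < n) inv_fact k * (0 +i* b) ^+ k)) =
    series (sin_coeff b).
  apply/funext => n; rewrite seriesEnat /= big_mkord raddf_sum.
  by apply: eq_bigr => k _; rewrite E.
by rewrite unlock; exact: is_cvg_series_sin_coeff.
Qed.

(** binom(n+l, n) / (n+l)! = 1 / (n! l!): the exponential series reproduces itself up to its value
    at [w]. *)
Lemma taylor_inv_fact w s : psum inv_fact w s ->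
  taylor inv_fact w (fun n => s * inv_fact n).
Proof.
move=> hs n; rewrite mulrC; apply: cseries_ext (cseriesZ _ hs) => l.
rewrite mulrA; congr (_ * _); rewrite /inv_fact.
have := bin_fact (leq_addr l n); rewrite addKn => e.
have f0 m : (m`!)%:R != 0 :> R[i] by rewrite pnatr_eq0 -lt0n fact_gt0.
rewrite -e !natrM; field; rewrite !f0 /= pnatr_eq0 -lt0n bin_gt0 leq_addr //.
Qed.

(** [cexp] is built from real functions. The exponential series is re-expanded at the real part, and
    the imaginary increment then contributes the cosine and sine series. *)
Lemma psum_cexp z : psum inv_fact z (cexp z).
Proof.
case: z => a b; have -> : a +i* b = a%:C + (0 +i* b) by simpc.
have h0 : 0 <= cabs a%:C + cabs (0 +i* b) + 1 by rewrite !addr_ge0 ?cabs_ge0.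
have lt1 : cabs a%:C + cabs (0 +i* b) < cabs a%:C + cabs (0 +i* b) + 1 by rewrite ltrDl.
have [s [h1 h2]] := psum_recenter (taylor_inv_fact (psum_expR a)) (entire_inv_fact h0) lt1.
have -> : cexp (a%:C + (0 +i* b)) = s; last by [].
apply: (cseries_unique _ h2).
have := cseriesZ (expR a)%:C (psum_expi b).
have -> : (expR a)%:C * (cos b +i* sin b) = cexp (a%:C + (0 +i* b)) by rewrite /cexp /= addr0 add0r.
by apply: cseries_ext => k; rewrite mulrA.
Qed.

End ComplexExponential.

(** * Contour integrals *)

Section ComplexIntegral.
Variable R : realType.
Local Notation mu := (@lebesgue_measure R).
Implicit Types (D : set R) (f : R -> R[i]) (g : R -> R).

Definition rintg D g := mu.-integrable D (EFin \o g).

Definition cmeas D f := measurable_fun D (fun u => complex.Re (f u)) /\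
  measurable_fun D (fun u => complex.Im (f u)).

Definition cintg D f := rintg D (fun u => complex.Re (f u)) /\
  rintg D (fun u => complex.Im (f u)).

Lemma rintg_le D g1 g2 : measurable D -> measurable_fun D g1 -> rintg D g2 ->
  (forall u, D u -> `|g1 u| <= g2 u) -> rintg D g1.
Proof.
rewrite /rintg => mD m1 i2 h; apply: (@le_integrable _ _ _ mu D mD (EFin \o g1) (EFin \o g2) _ _ i2).
  by apply/measurable_EFinP; exact: m1.
by move=> u Du /=; rewrite lee_fin (le_trans (h u Du)) // ler_norm.
Qed.

Lemma eq_rintg D g1 g2 : measurable D -> (forall u, D u -> g1 u = g2 u) ->
  rintg D g1 -> rintg D g2.
Proof.
rewrite /rintg => mD h; apply: (@eq_integrable _ _ _ mu D mD) => u /set_mem Du /=; by rewrite h.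
Qed.

Lemma rintgZ D g (k : R) : measurable D -> rintg D g -> rintg D (fun u => k * g u).
Proof. by move=> mD ig; exact: (@integrableZl _ _ _ mu D mD k _ ig). Qed.

Lemma rintgD D g1 g2 : measurable D -> rintg D g1 -> rintg D g2 ->
  rintg D (fun u => g1 u + g2 u).
Proof. by move=> mD i1 i2; exact: (@integrableD _ _ _ mu D mD _ _ i1 i2). Qed.

Lemma rdct D (f_ : nat -> R -> R) g h : measurable D ->
  (forall n, measurable_fun D (f_ n)) ->
  (forall u, D u -> (f_ n u) @[n --> \oo] --> h u) ->
  rintg D g -> (forall n u, D u -> `|f_ n u| <= g u) ->
  rintg D h /\ (\int[mu]_(u in D) f_ n u) @[n --> \oo] --> \int[mu]_(u in D) h u.
Proof.
move=> mD mf fh ig fg.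
have [|||||ih _ hc] := @dominated_convergence _ _ _ mu D mD
    (fun n => EFin \o f_ n) (EFin \o h) (EFin \o g).
- by move=> n; apply/measurable_EFinP; exact: mf.
- by apply/measurable_EFinP; apply: (measurable_fun_cvg mf fh).
- by apply: aeW => u Du; apply: cvg_EFin; [exact: nearW|exact: fh].
- exact: ig.
- by apply: aeW => u n Du /=; rewrite lee_fin fg.
split => //; apply: fine_cvg; rewrite fineK; first exact: hc.
exact: integrable_fin_num ih.
Qed.

Lemma cintg_dom D f g : measurable D -> cmeas D f -> rintg D g ->
  (forall u, D u -> cabs (f u) <= g u) -> cintg D f.
Proof.
move=> mD [mR mI] ig fg.
by split; apply: (rintg_le mD _ ig) => // u Du; rewrite (le_trans _ (fg u Du)) ?cabs_Re ?cabs_Im.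
Qed.

Lemma cdct D (f_ : nat -> R -> R[i]) g f : measurable D ->
  (forall n, cmeas D (f_ n)) ->
  (forall u, D u -> ccvg (fun n => f_ n u) (f u)) ->
  rintg D g -> (forall n u, D u -> cabs (f_ n u) <= g u) ->
  cintg D f /\ ccvg (fun n => cintegral D (f_ n)) (cintegral D f).
Proof.
move=> mD mf ff ig fg.
have [|||iR cR] := @rdct D (fun n u => complex.Re (f_ n u)) g (fun u => complex.Re (f u)) mD _ _ ig _.
- by move=> n; case: (mf n).
- by move=> u Du; exact: ccvg_Re (ff u Du).
- by move=> n u Du; rewrite (le_trans (cabs_Re _)) ?fg.
have [|||iI cI] := @rdct D (fun n u => complex.Im (f_ n u)) g (fun u => complex.Im (f u)) mD _ _ ig _.
- by move=> n; case: (mf n).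
- by move=> u Du; exact: ccvg_Im (ff u Du).
- by move=> n u Du; rewrite (le_trans (cabs_Im _)) ?fg.
by split => //; apply: ccvg_ReIm.
Qed.

Lemma eq_cintegral D f1 f2 : (forall u, D u -> f1 u = f2 u) ->
  cintegral D f1 = cintegral D f2.
Proof.
move=> h; rewrite /cintegral; congr (_ +i* _); apply: eq_Rintegral => u /set_mem Du;
  by rewrite h.
Qed.

Lemma cintegralD D f1 f2 : measurable D -> cintg D f1 -> cintg D f2 ->
  cintegral D (fun u => f1 u + f2 u) = cintegral D f1 + cintegral D f2.
Proof.
move=> mD [r1 i1] [r2 i2]; rewrite /cintegral; simpc.
congr (_ +i* _).
  rewrite -RintegralD //; apply: eq_Rintegral => u _.
  by rewrite raddfD.
rewrite -RintegralD //; apply: eq_Rintegral => u _.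
by rewrite raddfD.
Qed.

Lemma cintgD D f1 f2 : measurable D -> cintg D f1 -> cintg D f2 ->
  cintg D (fun u => f1 u + f2 u).
Proof.
move=> mD [r1 i1] [r2 i2]; split.
  by apply: eq_rintg (rintgD mD r1 r2) => // u _; rewrite raddfD.
by apply: eq_rintg (rintgD mD i1 i2) => // u _; rewrite raddfD.
Qed.

Lemma cintgZ D f c : measurable D -> cintg D f -> cintg D (fun u => c * f u).
Proof.
move=> mD [r1 i1]; case: c => a b; split.
  apply: eq_rintg (rintgD mD (rintgZ a mD r1) (rintgZ (- b) mD i1)) => // u _ /=.
  by case: (f u) => x y /=; rewrite mulNr.
apply: eq_rintg (rintgD mD (rintgZ a mD i1) (rintgZ b mD r1)) => // u _ /=.
by case: (f u) => x y /=.
Qed.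

Lemma cintegralZ D f c : measurable D -> cintg D f ->
  cintegral D (fun u => c * f u) = c * cintegral D f.
Proof.
move=> mD [r1 i1]; case: c => a b; rewrite /cintegral; simpc.
congr (_ +i* _).
  rewrite -!RintegralZl // -RintegralB //; try exact: rintgZ.
  by apply: eq_Rintegral => u _; case: (f u).
rewrite -!RintegralZl // -RintegralD //; try exact: rintgZ.
by apply: eq_Rintegral => u _; case: (f u).
Qed.

Lemma cintegral0 D : cintegral D (fun=> 0) = 0.
Proof.
by rewrite /cintegral /= /Rintegral integral0.
Qed.

Lemma cintg0 D : measurable D -> cintg D (fun=> 0).
Proof. by move=> mD; split; exact: integrable0. Qed.

Lemma cintegral_sum (I : Type) (r : seq I) D (F : I -> R -> R[i]) : measurable D ->
  (forall i, cintg D (F i)) ->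
  cintg D (fun u => \sum_(i <- r) F i u) /\
  cintegral D (fun u => \sum_(i <- r) F i u) = \sum_(i <- r) cintegral D (F i).
Proof.
move=> mD h; elim: r => [|i r [IH1 IH2]].
  under eq_fun do rewrite big_nil; rewrite big_nil cintegral0; split => //.
  exact: cintg0.
under eq_fun do rewrite big_cons; rewrite big_cons cintegralD // IH2; split => //.
exact: cintgD.
Qed.

(** The factor 2 comes from bounding real and imaginary parts separately; it persists in
    [cauchy_estimate] and [gamma_split], where constants do not matter. *)
Lemma cintegral_le D f g : measurable D -> cmeas D f -> rintg D g ->
  (forall u, D u -> cabs (f u) <= g u) ->
  cabs (cintegral D f) <= 2 * \int[mu]_(u in D) g u.
Proof.
move=> mD mf ig fg; have [iR iI] := cintg_dom mD mf ig fg.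
apply: le_trans (cabs_le _) _; rewrite /cintegral /= mulr_natl mulr2n.
have aux (h : R -> R) : rintg D h -> (forall u, D u -> `|h u| <= g u) ->
    `|\int[mu]_(u in D) h u| <= \int[mu]_(u in D) g u.
  move=> ih hg; apply: le_trans (@le_normr_Rintegral _ _ _ mu D h mD ih) _.
  apply: le_Rintegral => //.
  exact: integrable_norm.
apply: lerD; apply: aux => // u Du; rewrite (le_trans _ (fg u Du)) ?cabs_Re ?cabs_Im //.
Qed.

Lemma cmeas_cst D c : cmeas D (fun=> c).
Proof. by split; exact: measurable_cst. Qed.

Lemma cmeasD D f1 f2 : cmeas D f1 -> cmeas D f2 -> cmeas D (fun u => f1 u + f2 u).
Proof.
move=> [a b] [c d]; split.
  by under eq_fun do rewrite raddfD; exact: measurable_funD.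
by under eq_fun do rewrite raddfD; exact: measurable_funD.
Qed.

Lemma cmeasM D f1 f2 : cmeas D f1 -> cmeas D f2 -> cmeas D (fun u => f1 u * f2 u).
Proof.
move=> [a b] [c d]; split.
  rewrite (_ : (fun _ => _) = (fun u => complex.Re (f1 u) * complex.Re (f2 u) -
    complex.Im (f1 u) * complex.Im (f2 u))); last first.
    by apply/funext => u; case: (f1 u) => ? ?; case: (f2 u).
  by apply: measurable_funB; exact: measurable_funM.
rewrite (_ : (fun _ => _) = (fun u => complex.Re (f1 u) * complex.Im (f2 u) +
    complex.Im (f1 u) * complex.Re (f2 u))); last first.
  by apply/funext => u; case: (f1 u) => ? ?; case: (f2 u) => ? ? /=.
by apply: measurable_funD; exact: measurable_funM.
Qed.

Lemma cmeas_sum (I : Type) (r : seq I) D (F : I -> R -> R[i]) :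
  (forall i, cmeas D (F i)) -> cmeas D (fun u => \sum_(i <- r) F i u).
Proof.
move=> h; elim: r => [|i r IH].
  by under eq_fun do rewrite big_nil; exact: cmeas_cst.
by under eq_fun do rewrite big_cons; exact: cmeasD.
Qed.

Lemma cmeasX D f n : cmeas D f -> cmeas D (fun u => f u ^+ n).
Proof.
move=> mf; elim: n => [|n IH]; first by under eq_fun do rewrite expr0; exact: cmeas_cst.
by under eq_fun do rewrite exprS; exact: cmeasM.
Qed.

Lemma cmeas_real D g : measurable_fun D g -> cmeas D (fun u => (g u)%:C).
Proof. by move=> mg; split => //=; exact: measurable_cst. Qed.

Lemma measurable_sin D : measurable_fun D (@sin R).
Proof.
apply: measurable_funTS; apply: continuous_measurable_fun; exact: continuous_sin.
Qed.

Lemma measurable_cos D : measurable_fun D (@cos R).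
Proof.
apply: measurable_funTS; apply: continuous_measurable_fun; exact: continuous_cos.
Qed.

Lemma cmeas_cexp D f : cmeas D f -> cmeas D (fun u => cexp (f u)).
Proof.
move=> [a b]; rewrite /cexp; apply: cmeasM.
  by apply: cmeas_real; exact: (measurableT_comp (@measurable_expR R)).
split => /=.
  by apply: (measurableT_comp (@measurable_cos setT)).
by apply: (measurableT_comp (@measurable_sin setT)).
Qed.

Lemma cmeasN D f : cmeas D f -> cmeas D (fun u => - f u).
Proof.
move=> mf; have -> : (fun u => - f u) = (fun u => -1 * f u).
  by apply/funext => u; rewrite mulN1r.
by apply: cmeasM mf; exact: cmeas_cst.
Qed.

Lemma cintg_cmeas D f : measurable D -> cintg D f -> cmeas D f.
Proof.
move=> mD [/integrableP[m1 _] /integrableP[m2 _]].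
by split; apply/measurable_EFinP.
Qed.

Lemma cmeas_lim D (f_ : nat -> R -> R[i]) f : (forall n, cmeas D (f_ n)) ->
  (forall u, D u -> ccvg (fun n => f_ n u) (f u)) -> cmeas D f.
Proof.
move=> mf ff; split.
  apply: (measurable_fun_cvg (h := fun n u => complex.Re (f_ n u))).
    by move=> n; case: (mf n).
  by move=> u Du; exact: ccvg_Re (ff u Du).
apply: (measurable_fun_cvg (h := fun n u => complex.Im (f_ n u))).
  by move=> n; case: (mf n).
by move=> u Du; exact: ccvg_Im (ff u Du).
Qed.

Lemma cmeas_cpow D z : cmeas D (fun u => cpow u z).
Proof.
apply: cmeas_cexp; apply: cmeasM; last exact: cmeas_cst.
by apply: cmeas_real; apply: measurable_funTS; exact: measurable_ln.
Qed.

End ComplexIntegral.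

(** * Cauchy's formulas on circles about 0 *)

Section CircleIntegral.
Variable R : realType.
Local Notation mu := (@lebesgue_measure R).
Local Notation D := (`[0, 2 * pi]%classic : set R).

Definition circ (rho t : R) : R[i] := rho%:C * cexp (0 +i* t).

Lemma realC_neq0 (x : R) : x != 0 -> x%:C != 0 :> R[i].
Proof. by rewrite -(rmorph0 (real_complex R)) (inj_eq (@complexI R)). Qed.

Lemma measurable_circle : measurable D.
Proof. exact: measurable_itv. Qed.

Lemma Rintegral_cst_circle (c : R) : \int[mu]_(t in D) c = 2 * pi * c.
Proof.
have pi0 : (0 : R) < 2 * pi by rewrite mulr_gt0 ?pi_gt0.
rewrite /Rintegral integral_cst //= lebesgue_measure_itv /= lte_fin pi0.
by rewrite -EFinD -EFinM /= subr0 mulrC.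
Qed.

Lemma rintg_cst_circle (c : R) : rintg D (fun=> c).
Proof.
apply: continuous_compact_integrable; first exact: segment_compact.
by apply: continuous_subspaceT => x; exact: cvg_cst.
Qed.

Lemma cabs_circ rho t : 0 <= rho -> cabs (circ rho t) = rho.
Proof.
by move=> r0; rewrite /circ cabsM cabsR ger0_norm // cabs_cexp /= expR0 mulr1.
Qed.

Lemma cmeas_circ rho : cmeas D (circ rho).
Proof.
apply: cmeasM; first exact: cmeas_cst.
by apply: cmeas_cexp; split => /=; [exact: measurable_cst|exact: measurable_id].
Qed.

Lemma sin_nat2pi n : sin (n%:R * (2 * pi)) = 0 :> R.
Proof.
have -> : n%:R * (2 * pi) = 0 + (pi *+ 2) *+ n :> R.
  by rewrite add0r -[RHS]mulr_natl -[pi *+ 2]mulr_natl.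
rewrite (@periodicn _ _ (@sin R) (pi *+ 2)) ?sin0 //.
by move=> x; rewrite mulr2n addrA !sinDpi opprK.
Qed.

Lemma cos_nat2pi n : cos (n%:R * (2 * pi)) = 1 :> R.
Proof.
have -> : n%:R * (2 * pi) = 0 + (pi *+ 2) *+ n :> R.
  by rewrite add0r -[RHS]mulr_natl -[pi *+ 2]mulr_natl.
rewrite (@periodicn _ _ (@cos R) (pi *+ 2)) ?cos0 //.
by move=> x; rewrite mulr2n addrA !cosDpi opprK.
Qed.

(** The frequency is real in order to cover differences of naturals of either sign. *)
Lemma Rintegral_cos_circle (m : R) : m != 0 -> sin (m * (2 * pi)) = 0 ->
  \int[mu]_(t in D) cos (m * t) = 0.
Proof.
move=> m0 hs; have pi0 : (0 : R) < 2 * pi by rewrite mulr_gt0 ?pi_gt0.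
have dF (x : R) : is_derive x 1 (fun t => m^-1 * sin (m * t)) (cos (m * x)).
  apply: is_derive_eq; rewrite /GRing.scale /=; field; exact: m0.
rewrite /Rintegral (@continuous_FTC2 _ _ (fun t => m^-1 * sin (m * t)) 0 (2 * pi)) //.
- by rewrite hs !mulr0 sin0 mulr0 subee.
- apply: continuous_subspaceT => x; apply: continuous_comp; last exact: continuous_cos.
  by apply: cvgM; [exact: cvg_cst|exact: cvg_id].
- have cF (x : R) : {for x, continuous (fun t : R => m^-1 * sin (m * t))}.
    apply: differentiable_continuous; apply/derivable1_diffP; by case: (dF x).
  split; first by move=> x _; case: (dF x).
    by apply: cvg_at_right_filter; exact: cF.
  by apply: cvg_at_left_filter; exact: cF.
- by move=> x _; rewrite derive1E; case: (dF x).
Qed.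

Lemma Rintegral_sin_circle (m : R) : m != 0 -> cos (m * (2 * pi)) = 1 ->
  \int[mu]_(t in D) sin (m * t) = 0.
Proof.
move=> m0 hs; have pi0 : (0 : R) < 2 * pi by rewrite mulr_gt0 ?pi_gt0.
have dF (x : R) : is_derive x 1 (fun t => - m^-1 * cos (m * t)) (sin (m * x)).
  apply: is_derive_eq; rewrite /GRing.scale /=; field; exact: m0.
rewrite /Rintegral (@continuous_FTC2 _ _ (fun t => - m^-1 * cos (m * t)) 0 (2 * pi)) //.
- by rewrite hs !mulr0 cos0 subee.
- apply: continuous_subspaceT => x; apply: continuous_comp; last exact: continuous_sin.
  by apply: cvgM; [exact: cvg_cst|exact: cvg_id].
- have cF (x : R) : {for x, continuous (fun t : R => - m^-1 * cos (m * t))}.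
    apply: differentiable_continuous; apply/derivable1_diffP; by case: (dF x).
  split; first by move=> x _; case: (dF x).
    by apply: cvg_at_right_filter; exact: cF.
  by apply: cvg_at_left_filter; exact: cF.
- by move=> x _; rewrite derive1E; case: (dF x).
Qed.

Lemma cintegral_fourier (j k : nat) :
  cintegral D (fun t => cexp (0 +i* t) ^+ k / cexp (0 +i* t) ^+ j) =
  if j == k then (2 * pi)%:C else 0.
Proof.
have E t : cexp (0 +i* t) ^+ k / cexp (0 +i* t) ^+ j =
    cexp (0 +i* ((k%:R - j%:R) * t)) :> R[i].
  rewrite !cexpX -cexpN -cexpD; congr cexp.
  have imE n : (0 +i* t) *+ n = 0 +i* (n%:R * t) :> R[i].
    by elim: n => [|n IH]; rewrite ?mul0r // mulrSr IH; simpc; rewrite -natr1 mulrDl mul1r.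
  by rewrite !imE; simpc; rewrite mulrBl.
rewrite (eq_cintegral (f2 := fun t => cexp (0 +i* ((k%:R - j%:R) * t)))) //.
have F t : cexp (0 +i* ((k%:R - j%:R) * t)) =
    cos ((k%:R - j%:R) * t) +i* sin ((k%:R - j%:R) * t) :> R[i].
  by rewrite /cexp /= expR0 mul1r.
rewrite /cintegral; case: eqVneq => jk.
  congr (_ +i* _).
    under eq_Rintegral do rewrite F jk subrr mul0r /= cos0.
    by rewrite Rintegral_cst_circle mulr1.
  under eq_Rintegral do rewrite F jk subrr mul0r /= sin0.
  by rewrite Rintegral_cst_circle mulr0.
have m0 : k%:R - j%:R != 0 :> R by rewrite subr_eq0 eqr_nat eq_sym.
congr (_ +i* _).
  under eq_Rintegral do rewrite F /=.
  apply: Rintegral_cos_circle => //.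
  by rewrite mulrBl sinB !sin_nat2pi mulr0 mul0r subrr.
under eq_Rintegral do rewrite F /=.
apply: Rintegral_sin_circle => //.
by rewrite mulrBl cosB !sin_nat2pi !cos_nat2pi mulr0 addr0 mulr1.
Qed.

Lemma cintg_circ rho c k j : 0 < rho ->
  cintg D (fun t => c * (circ rho t ^+ k / circ rho t ^+ j)) /\
  cintegral D (fun t => c * (circ rho t ^+ k / circ rho t ^+ j)) =
  if j == k then (2 * pi)%:C * c else 0.
Proof.
move=> r0; have r0' : rho%:C != 0 by rewrite realC_neq0 // gt_eqF.
have E t : c * (circ rho t ^+ k / circ rho t ^+ j) =
   (c * (rho%:C ^+ k / rho%:C ^+ j)) * (cexp (0 +i* t) ^+ k / cexp (0 +i* t) ^+ j).
  by rewrite /circ !exprMn invfM; ring.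
have i1 : cintg D (fun t => cexp (0 +i* t) ^+ k / cexp (0 +i* t) ^+ j).
  apply: (@cintg_dom _ _ _ (fun=> 1) measurable_circle).
  - have -> : (fun t : R => cexp (0 +i* t) ^+ k / cexp (0 +i* t) ^+ j) =
       (fun t => cexp (0 +i* t) ^+ k * cexp (- (0 +i* t)) ^+ j).
      by apply/funext => t; rewrite cexpN exprVn.
    have m1 : cmeas D (fun t : R => 0 +i* t).
      by split => /=; [exact: measurable_cst|exact: measurable_id].
    apply: cmeasM; apply: cmeasX; apply: cmeas_cexp => //.
    exact: cmeasN.
  - exact: rintg_cst_circle.
  - by move=> u _; rewrite cabsM cabsV !cabsX cabs_cexp /= expR0 !expr1n invr1 mulr1.
have -> := funext E; split; first exact: cintgZ measurable_circle i1.
rewrite (cintegralZ _ measurable_circle i1).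
rewrite cintegral_fourier; case: eqVneq => [->|_]; last by rewrite mulr0.
by rewrite divff ?expf_neq0 // mulr1 mulrC.
Qed.

(** The partial sums are integrated termwise, orthogonality keeps only the index [j], and dominated
    convergence passes to the sum. The integrand is measurable as a limit of the partial sums. *)
Lemma cintegral_coef a (f : R[i] -> R[i]) rho j : 0 < rho -> entire a ->
  (forall z, psum a z (f z)) ->
  cmeas D (fun t => f (circ rho t) / circ rho t ^+ j) /\
  cintegral D (fun t => f (circ rho t) / circ rho t ^+ j) = (2 * pi)%:C * a j.
Proof.
move=> r0 ea hf.
pose T K t := \sum_(k < K) a k * (circ rho t ^+ k / circ rho t ^+ j).
have [B hB] := entire_summable (ltW r0) ea.
have mT K : cmeas D (T K).
  apply: cmeas_sum => k; apply: cmeasM; first exact: cmeas_cst.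
  (* The inverse of a point of the circle is again of the form [circ], which makes the quotient
     visibly measurable. *)
  have -> : (fun t => circ rho t ^+ k / circ rho t ^+ j) =
      (fun t => circ rho t ^+ k * (circ rho^-1 (- t)) ^+ j).
    apply/funext => t; congr (_ * _); rewrite -exprVn; congr (_ ^+ _).
    rewrite /circ invfM -cexpN fmorphV; congr (_ * cexp _); by simpc.
  apply: cmeasM; apply: cmeasX; first exact: cmeas_circ.
  apply: cmeasM; first exact: cmeas_cst.
  apply: cmeas_cexp; split => /=; first exact: measurable_cst.
  exact: measurable_funN.
have cT t : D t -> ccvg (fun K => T K t) (f (circ rho t) / circ rho t ^+ j).
  move=> _; rewrite mulrC; apply: ccvg_ext (ccvgZ _ (hf (circ rho t))) => K.
  by rewrite mulr_sumr; apply: eq_bigr => k _; ring.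
have bT K t : D t -> cabs (T K t) <= B / rho ^+ j.
  move=> _; apply: le_trans (cabs_sum _ _ _) _.
  rewrite ler_pdivlMr ?exprn_gt0 // mulr_suml; apply: le_trans (hB K).
  apply: ler_sum => k _; rewrite !cabsM cabsV !cabsX cabs_circ ?(ltW r0) //.
  by rewrite mulrA divfK // expf_neq0 // gt_eqF.
split; first exact: cmeas_lim mT cT.
have [_ h] := cdct measurable_circle mT cT (rintg_cst_circle _) bT.
apply: (ccvg_unique h).
apply: (@ccvg_near _ (fun=> (2 * pi)%:C * a j)); last exact: ccvg_cst.
exists j.+1 => K jK.
have [_ ->] := cintegral_sum (index_enum 'I_K) measurable_circle
   (fun k : 'I_K => (cintg_circ (a k) k j r0).1).
rewrite (bigD1 (Ordinal jK)) //= big1 ?addr0 => [|k kj].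
  by have [_ ->] := cintg_circ (a j) j j r0; rewrite eqxx.
have [_ ->] := cintg_circ (a k) k j r0.
by rewrite ifN // eq_sym; apply: contra_neq kj => e; apply: val_inj.
Qed.

Lemma cauchy_estimate a (f : R[i] -> R[i]) rho B j : 0 < rho -> entire a ->
  (forall z, psum a z (f z)) -> (forall z, cabs z = rho -> cabs (f z) <= B) ->
  cabs (a j) * rho ^+ j <= 2 * B.
Proof.
move=> r0 ea hf fB; have [mf e] := cintegral_coef j r0 ea hf.
have pi0 : (0 : R) < 2 * pi by rewrite mulr_gt0 ?pi_gt0.
have := cintegral_le measurable_circle mf (rintg_cst_circle (B / rho ^+ j)) _.
rewrite e Rintegral_cst_circle cabsM cabsR gtr0_norm // => h.
have {}h : 2 * pi * cabs (a j) <= 2 * (2 * pi * (B / rho ^+ j)).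
  apply: h => t _; rewrite cabsM cabsV cabsX cabs_circ ?(ltW r0) //.
  by rewrite ler_wpM2r ?invr_ge0 ?exprn_ge0 ?(ltW r0) // fB // cabs_circ // ltW.
rewrite -ler_pdivlMr ?exprn_gt0 // -(ler_pM2l pi0) (le_trans h) // le_eqVlt.
by apply/orP; left; apply/eqP; ring.
Qed.

(** The coefficient integrals over the unit circle converge by dominated convergence, Cauchy's
    estimates bound them uniformly at every radius, and Tannery's theorem sums the limits. This is
    meant for Gauss's products. *)
Lemma entire_limit (a : nat -> nat -> R[i]) (f_ : nat -> R[i] -> R[i]) (f : R[i] -> R[i]) :
  (forall n, entire (a n)) -> (forall n z, psum (a n) z (f_ n z)) ->
  (forall z, ccvg (fun n => f_ n z) (f z)) ->
  (forall rho : R, exists B, forall n z, cabs z <= rho -> cabs (f_ n z) <= B) ->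
  exists2 c, entire c & forall z, psum c z (f z).
Proof.
move=> ea hf ff loc.
have pi0 : (2 * pi)%:C != 0 :> R[i].
  by rewrite realC_neq0 // gt_eqF // mulr_gt0 ?pi_gt0.
pose c j := (2 * pi)%:C^-1 * cintegral D (fun t => f (circ 1 t) / circ 1 t ^+ j).
have ac j : ccvg (fun n => a n j) (c j).
  have [B hB] := loc 1.
  pose g n t := f_ n (circ 1 t) / circ 1 t ^+ j.
  have mg n : cmeas D (g n) := (cintegral_coef j ltr01 (ea n) (hf n)).1.
  have gg t : D t -> ccvg (fun n => g n t) (f (circ 1 t) / circ 1 t ^+ j).
    by move=> _; rewrite mulrC; apply: ccvg_ext (ccvgZ _ (ff (circ 1 t))) => n; rewrite mulrC.
  have gB n t : D t -> cabs (g n t) <= B.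
    by move=> _; rewrite cabsM cabsV cabsX cabs_circ // expr1n invr1 mulr1 hB // cabs_circ.
  have [_ h] := cdct measurable_circle mg gg (rintg_cst_circle _) gB.
  apply: ccvg_ext (ccvgZ (2 * pi)%:C^-1 h) => n.
  by have [_ ->] := cintegral_coef j ltr01 (ea n) (hf n); rewrite mulKf.
have aB (rho : R) : 0 < rho -> exists B, forall n j, cabs (a n j) * rho ^+ j <= B.
  move=> r0; have [B hB] := loc rho; exists (2 * B) => n j.
  by apply: (cauchy_estimate j r0 (ea n) (hf n)) => z hz; apply: hB; rewrite hz.
have ec : entire c.
  move=> t t0; have t1 : 0 < t + 1 by rewrite ltr_wpDl.
  apply: (bounded_at_le t0 (_ : t <= t + 1)); first by rewrite lerDl.
  have [B hB] := aB _ t1; exists B => j; rewrite -ler_pdivlMr ?exprn_gt0 //.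
  apply: (ccvg_cabs_le (ac j)); exists 0%N => n _.
  by rewrite ler_pdivlMr ?exprn_gt0.
exists c => // z; have [s hs] := entire_psum_ex z ec.
suff -> : f z = s by [].
apply: (ccvg_unique (ff z)).
pose rho := cabs z + 1; have r0 : 0 < rho by rewrite ltr_wpDl ?cabs_ge0.
have [B hB] := aB _ r0.
have B0 : 0 <= B by apply: le_trans (hB 0%N 0%N); rewrite mulr_ge0 ?cabs_ge0 ?exprn_ge0 ?(ltW r0).
apply: (@tannery _ (fun n k => a n k * z ^+ k) (fun k => c k * z ^+ k)
   (fun k => B * (cabs z / rho) ^+ k)) => //.
- have q1 : cabs z / rho < 1 by rewrite ltr_pdivrMr // mul1r ltrDl.
  have q0 : 0 <= cabs z / rho by rewrite divr_ge0 ?cabs_ge0 ?ltW.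
  exists (B * (1 - cabs z / rho)^-1) => n; rewrite -mulr_sumr.
  by rewrite ler_wpM2l // geometric_sum_le.
- move=> n k; rewrite cabsM cabsX expr_div_n mulrA ler_pdivlMr ?exprn_gt0 //.
  by rewrite mulrAC ler_wpM2r ?exprn_ge0 ?cabs_ge0.
- by move=> k; rewrite mulrC; apply: ccvg_ext (ccvgZ _ (ac k)) => n; rewrite mulrC.
- by move=> n; exact: hf.
Qed.

(** Neumann series: multiplied by w - M, the partial sums telescope and leave a remainder of order
    (mxn M / |w|)^n. Invertibility of w - M is a by-product. *)
Lemma resolvent_series N (M : 'M[R[i]]_N) w : mxn M < cabs w ->
  forall i j, cseries (fun k => (M ^+ k) i j / w ^+ k) ((w *: invmx (w%:M - M)) i j).
Proof.
move=> Mw; have w0 : 0 < cabs w by apply: le_lt_trans Mw; exact: mxn_ge0.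
have w0' : w != 0 by rewrite -cabs_gt0.
pose q := mxn M / cabs w.
have q0 : 0 <= q by rewrite divr_ge0 ?mxn_ge0 ?ltW.
have q1 : q < 1 by rewrite ltr_pdivrMr // mul1r.
have h i j : exists s, cseries (fun k => (M ^+ k) i j / w ^+ k) s.
  apply: (@rsummable_cseries _ _ (fun k => q ^+ k)).
    move=> k; rewrite cabsM cabsV cabsX expr_div_n ler_wpM2r ?invr_ge0 ?exprn_ge0 ?cabs_ge0 //.
    exact: entryX_le.
  by exists (1 - q)^-1 => n; exact: geometric_sum_le.
pose S := \matrix_(i, j) projT1 (cid (h i j)).
have hS i j : ccvg (fun n => (\sum_(k < n) (w ^+ k)^-1 *: M ^+ k) i j) (S i j).
  rewrite mxE; apply: ccvg_ext (projT2 (cid (h i j))) => n; rewrite summxE.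
  by apply: eq_bigr => k _; rewrite mxE mulrC.
have key : (w%:M - M) *m S = w%:M.
  apply/matrixP => i j; apply: (ccvg_unique (ccvg_mulmx_entry (w%:M - M) i j hS)).
  have tele n : (w%:M - M) *m (\sum_(k < n) (w ^+ k)^-1 *: M ^+ k) =
      w%:M - (w / w ^+ n) *: M ^+ n.
    elim: n => [|n IH].
      by rewrite big_ord0 mulmx0 !expr0 divr1 -[1]/(1%:M) scale_scalar_mx mulr1 subrr.
    have e : M *m M ^+ n = M ^+ n.+1 by rewrite exprS.
    rewrite big_ord_recr /= mulmxDr IH -scalemxAr mulmxBl mul_scalar_mx e.
    rewrite scalerBr scalerA [_^-1 * w]mulrC addrA subrK; congr (_ - _ *: _).
    by rewrite exprS invfM mulrA divff // mul1r.
  have lim0 : ccvg (fun n => ((w / w ^+ n) *: M ^+ n) i j) 0.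
    apply: (@ccvg_squeeze _ _ _ (fun n => cabs w * q ^+ n)).
      rewrite -(mulr0 (cabs w)); apply: cvgMr; apply: cvg_expr.
      by rewrite ger0_norm.
    exists 0%N => n _; rewrite subr0 mxE !cabsM cabsV cabsX expr_div_n mulrA -mulrA.
    rewrite -[leRHS]mulrA ler_wpM2l ?cabs_ge0 // mulrC.
    by rewrite ler_wpM2r ?invr_ge0 ?exprn_ge0 ?cabs_ge0 ?entryX_le.
  have := ccvgB (ccvg_cst ((w%:M : 'M[R[i]]_N) i j)) lim0; rewrite subr0.
  by apply: ccvg_ext => n; rewrite tele [RHS]mxE; congr (_ + _); rewrite [RHS]mxE.
have key' : (w%:M - M) *m (w^-1 *: S) = 1%:M.
  by rewrite -scalemxAr key scale_scalar_mx mulVf.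
have -> : invmx (w%:M - M) = w^-1 *: S.
  have [u1 u2] := mulmx1_unit key'.
  by rewrite -[RHS](mulKmx u1) key' mulmx1.
move=> i j; rewrite scalerA divff // scale1r mxE.
exact: projT2 (cid (h i j)).
Qed.

(** On the contour the integrand is the product of the power series of [f] and the Neumann series;
    orthogonality leaves the diagonal terms a_k M^k, and dominated convergence removes the
    truncation. *)
Lemma mxholo_psum N a f (M : 'M[R[i]]_N) : entire a -> (forall z, psum a z (f z)) ->
  mxpsum a M (mxholo f M).
Proof.
move=> ea hf i j.
have rE : contour_radius M = 1 + mxn M by [].
set rho := contour_radius M in rE.
have r0 : 0 < rho by rewrite rE ltr_pwDl ?mxn_ge0.
have Mr : mxn M < rho by rewrite rE ltrDr.
have [X hX] := mxpsum_ex M ea.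
suff -> : mxholo f M i j = X i j by exact: hX.
rewrite /mxholo !mxE -/rho.
pose T K t := (\sum_(k < K) a k * circ rho t ^+ k) *
   (\sum_(l < K) (M ^+ l) i j / circ rho t ^+ l).
have [A hA] := entire_summable (ltW r0) ea.
pose q := mxn M / rho.
have q0 : 0 <= q by rewrite divr_ge0 ?mxn_ge0 ?ltW.
have q1 : q < 1 by rewrite ltr_pdivrMr // mul1r.
have TE K t : T K t = \sum_(k < K) \sum_(l < K)
   (a k * (M ^+ l) i j) * (circ rho t ^+ k / circ rho t ^+ l).
  rewrite /T mulr_suml; apply: eq_bigr => k _; rewrite mulr_sumr.
  by apply: eq_bigr => l _; ring.
have iT K : cintg D (T K) /\ cintegral D (T K) = (2 * pi)%:C * \sum_(k < K) a k * (M ^+ k) i j.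
  have -> : T K = (fun t => \sum_(k < K) \sum_(l < K)
      (a k * (M ^+ l) i j) * (circ rho t ^+ k / circ rho t ^+ l)).
    by apply/funext => t; exact: TE.
  have h1 (k : 'I_K) := cintegral_sum (index_enum 'I_K) measurable_circle
      (fun l : 'I_K => (cintg_circ (a k * (M ^+ l) i j) k l r0).1).
  have [h2 ->] := cintegral_sum (index_enum 'I_K) measurable_circle (fun k => (h1 k).1).
  split => //; rewrite mulr_sumr; apply: eq_bigr => k _; rewrite (h1 k).2.
  rewrite (bigD1 k) //= big1 ?addr0 => [|l kl].
    by have [_ ->] := cintg_circ (a k * (M ^+ k) i j) k k r0; rewrite eqxx.
  by have [_ ->] := cintg_circ (a k * (M ^+ l) i j) k l r0; rewrite ifN.
have cT t : D t -> ccvg (fun K => T K t)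
    (((f (circ rho t) * circ rho t) *: invmx ((circ rho t)%:M - M)) i j).
  move=> _; have Mw : mxn M < cabs (circ rho t) by rewrite cabs_circ // ltW.
  have := ccvgM (hf (circ rho t)) (resolvent_series Mw i j).
  by rewrite -scalerA [X in _ -> ccvg _ X]mxE.
have bT K t : D t -> cabs (T K t) <= A * (1 - q)^-1.
  move=> _; rewrite /T cabsM; apply: ler_pM; rewrite ?cabs_ge0 //.
    apply: le_trans (cabs_sum _ _ _) (le_trans _ (hA K)).
    by apply: ler_sum => k _; rewrite cabsM cabsX cabs_circ // ltW.
  apply: le_trans (cabs_sum _ _ _) (le_trans _ (geometric_sum_le K q0 q1)).
  apply: ler_sum => k _; rewrite cabsM cabsV cabsX cabs_circ ?(ltW r0) // expr_div_n.
  by rewrite ler_wpM2r ?invr_ge0 ?exprn_ge0 ?(ltW r0) ?entryX_le.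
have mT K : cmeas D (T K).
  exact: cintg_cmeas measurable_circle (iT K).1.
have [_ h] := cdct measurable_circle mT cT (rintg_cst_circle _) bT.
have pi0 : (2 * pi)%:C != 0 :> R[i].
  by rewrite realC_neq0 // gt_eqF // mulr_gt0 ?pi_gt0.
rewrite fmorphV; apply: (mulfI pi0); rewrite mulVKf //.
apply: (ccvg_unique h).
by apply: ccvg_ext (ccvgZ (2 * pi)%:C (hX i j)) => K; rewrite (iT K).2.
Qed.

End CircleIntegral.

(** * The functions Gamma and 1/Gamma *)

Section GaussProducts.
Variable R : realType.
Implicit Types (z : R[i]) (f g : R[i] -> R[i]).

Definition entire_fun f := exists2 a, entire a & forall z, psum a z (f z).

Lemma entire_funM f g : entire_fun f -> entire_fun g ->
  entire_fun (fun z => f z * g z).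
Proof.
move=> [a ea ha] [b eb hb].
by exists (cauchy_prod a b); [exact: entire_cauchy_prod|move=> z; exact: psum_cauchy_prod].
Qed.

Lemma entire_fun_affine (c d : R[i]) : entire_fun (fun z => c + d * z).
Proof.
pose a k := if k == 0%N then c else if k == 1%N then d else 0.
exists a.
  move=> t t0; exists (cabs c + cabs d * t) => -[|[|k]] /=.
  - by rewrite expr0 mulr1 lerDl mulr_ge0 ?cabs_ge0.
  - by rewrite expr1 lerDr cabs_ge0.
  - by rewrite cabs0 mul0r addr_ge0 ?mulr_ge0 ?cabs_ge0.
move=> z; have := @cseries_finite R 2 (fun k => a k * z ^+ k).
rewrite !big_ord_recr big_ord0 /= add0r expr0 mulr1 expr1; apply.
by move=> [|[|k]] //= _; rewrite mul0r.
Qed.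

Lemma entire_fun_cst (c : R[i]) : entire_fun (fun=> c).
Proof.
have [a ea h] := entire_fun_affine c 0; exists a => // z.
by have := h z; rewrite mul0r addr0.
Qed.

Lemma entire_fun_exp (c : R[i]) : entire_fun (fun z => cexp (c * z)).
Proof.
exists (fun k => inv_fact R k * c ^+ k).
  move=> t t0; have [B hB] := entire_inv_fact (mulr_ge0 (cabs_ge0 c) t0).
  by exists B => k; rewrite cabsM cabsX -mulrA -exprMn.
move=> z; apply: cseries_ext (psum_cexp (c * z)) => k.
by rewrite exprMn mulrA.
Qed.

Lemma entire_fun_prod n (F : nat -> R[i] -> R[i]) :
  (forall k, entire_fun (F k)) -> entire_fun (fun z => \prod_(k < n) F k z).
Proof.
move=> h; elim: n => [|n IH].
  by under eq_fun do rewrite big_ord0; exact: entire_fun_cst.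
by under eq_fun do rewrite big_ord_recr /=; exact: entire_funM.
Qed.

(* Gauss: [1/Gamma z] is the limit of [z (z+1) ... (z+n) n^(-z) / n!]; here
   [n = m + 1]. *)
Definition gaussp (m : nat) z : R[i] :=
  (\prod_(k < m.+2) (z + k%:R)) * cexp (- (ln m.+1%:R)%:C * z) / (m.+1)`!%:R.

Lemma entire_gaussp m : entire_fun (gaussp m).
Proof.
apply: entire_funM; last exact: entire_fun_cst.
apply: entire_funM; last exact: entire_fun_exp.
apply: (@entire_fun_prod m.+2 (fun k z => z + k%:R)) => k.
have [a ea h] := entire_fun_affine k%:R 1; exists a => // z.
by have := h z; rewrite mul1r addrC.
Qed.

(** Together with [harmonic_ge], this places the harmonic sum minus the logarithm in [0, 1], which
    is all that is used about Euler's constant. *)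
Lemma harmonic_le m : \sum_(k < m.+1) (k.+1%:R)^-1 <= 1 + ln m.+1%:R :> R.
Proof.
elim: m => [|m IH]; first by rewrite big_ord_recr big_ord0 /= ln1 addr0 add0r invr1.
rewrite big_ord_recr /=; apply: le_trans (lerD IH (lexx _)) _.
rewrite -addrA lerD2l.
have h : ln (m.+1%:R / m.+2%:R) <= - (m.+2%:R)^-1 :> R.
  have -> : m.+1%:R / m.+2%:R = 1 + - (m.+2%:R)^-1 :> R.
    by rewrite -(natr1 m.+1); field; have := ler0n R m; lra.
  apply: le_ln1Dx; rewrite ltrN2 invf_lt1 ?ltr0n // ltr1n //.
have aux (a b c : R) : a - b <= - c -> a + c <= b by lra.
by apply: aux; rewrite -ln_div ?posrE ?ltr0n.
Qed.

Lemma harmonic_ge m : ln m.+1%:R <= \sum_(k < m.+1) (k.+1%:R)^-1 :> R.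
Proof.
elim: m => [|m IH]; first by rewrite big_ord_recr big_ord0 /= ln1 add0r invr1.
have h : ln (m.+2%:R / m.+1%:R) <= (m.+1%:R)^-1 :> R.
  have -> : m.+2%:R / m.+1%:R = 1 + (m.+1%:R)^-1 :> R by rewrite -natr1; field.
  by apply: le_ln1Dx; rewrite (lt_trans (ltrN10 _)) // invr_gt0.
(* The bound already holds with one term fewer on the right, and in that form it telescopes. *)
have {IH} IH : forall m, ln m.+1%:R <= \sum_(k < m) (k.+1%:R)^-1 :> R; last first.
  by rewrite (le_trans (IH _)) // [leRHS]big_ord_recr /= lerDl.
elim=> [|k IHk]; first by rewrite ln1 big_ord0.
rewrite big_ord_recr /=.
have h' : ln (k.+2%:R / k.+1%:R) <= (k.+1%:R)^-1 :> R.
  have -> : k.+2%:R / k.+1%:R = 1 + (k.+1%:R)^-1 :> R by rewrite -natr1; field.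
  by apply: le_ln1Dx; rewrite (lt_trans (ltrN10 _)) // invr_gt0.
have aux (a b c d : R) : b - a <= c -> a <= d -> b <= d + c by lra.
by apply: aux IHk; rewrite -ln_div ?posrE ?ltr0n.
Qed.

Lemma sum_inv_sqr m : \sum_(k < m) (k.+1%:R ^+ 2)^-1 <= 2 :> R.
Proof.
suff h n : \sum_(k < n.+1) (k.+1%:R ^+ 2)^-1 <= 2 - (n.+1%:R)^-1 :> R.
  case: m => [|m]; first by rewrite big_ord0.
  by rewrite (le_trans (h m)) // gerBl invr_ge0.
elim: n => [|n IH]; first by rewrite big_ord_recr big_ord0 /= expr1n !invr1 add0r; lra.
rewrite big_ord_recr /=; apply: le_trans (lerD IH (lexx _)) _.
rewrite -addrA lerD2l -subr_ge0.
have -> : - (n.+2%:R)^-1 - (- (n.+1%:R)^-1 + (n.+2%:R ^+ 2)^-1) =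
   (n.+1%:R * n.+2%:R ^+ 2)^-1 :> R.
  by rewrite -natr1; field; rewrite !gt_eqF //= -natr1; have := ler0n R n; lra.
by rewrite invr_ge0 mulr_ge0 ?exprn_ge0.
Qed.

(** Squared, the right side is exp (2 Re z + |z|^2) >= 1 + 2 Re z + |z|^2 = |1 + z|^2. Having Re z,
    not |z|, in the linear term lets harmonic sums cancel against a power of n. *)
Lemma cabs_1D_le z : cabs (1 + z) <= expR (complex.Re z + cabs z ^+ 2 / 2).
Proof.
rewrite -(@ler_pXn2r _ 2) ?nnegrE ?cabs_ge0 ?expR_ge0 // -expRM_natl.
apply: le_trans (expR_ge1Dx _); rewrite !cabs_sqr; case: z => a b /=.
have -> : ((2 : nat)%:R : R) = 1 + 1 by rewrite -natr1.
by rewrite le_eqVlt; apply/orP; left; apply/eqP; field.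
Qed.

(** Once the factorial is distributed, the factors are z and 1 + z/k. Their linear parts add up to
    Re z times a harmonic sum, which n^(-z) offsets up to |z|; the quadratic parts are summable.
    Hence the bound is uniform in [m]. *)
Lemma gaussp_bound m z : cabs (gaussp m z) <= cabs z * expR (cabs z + cabs z ^+ 2).
Proof.
rewrite /gaussp cabsM cabsV cabs_nat cabsM cabs_cexp big_ord_recl /= addr0 cabsM.
rewrite -!mulrA ler_wpM2l ?cabs_ge0 // cabs_prod.
have fE : (m.+1)`!%:R = \prod_(k < m.+1) k.+1%:R :> R.
  by rewrite fact_prod big_add1 /= big_mkord natr_prod.
rewrite mulrCA fE -prodfV -big_split /=.
have -> : expR (complex.Re (- (ln m.+1%:R)%:C * z)) = expR (- (complex.Re z * ln m.+1%:R)).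
  by case: z => a b /=; congr expR; ring.
have h : \prod_(i < m.+1) (cabs (z + (bump 0 i)%:R) * (i.+1%:R)^-1) <=
    expR (\sum_(i < m.+1) (complex.Re z / i.+1%:R + cabs z ^+ 2 / 2 / i.+1%:R ^+ 2)).
  rewrite expR_sum; apply: ler_prod => i _; apply/andP; split.
    by rewrite mulr_ge0 ?cabs_ge0 ?invr_ge0.
  have -> : cabs (z + (bump 0 i)%:R) * (i.+1%:R)^-1 = cabs (1 + z / i.+1%:R).
    rewrite /bump /= add1n -(cabs_nat R i.+1) -cabsV -cabsM mulrDl divff ?pnatr_eq0 //.
    by rewrite addrC.
  apply: le_trans (cabs_1D_le _) _; rewrite ler_expR cabsM cabsV cabs_nat.
  rewrite exprMn exprVn.
  have -> : complex.Re (z / i.+1%:R) = complex.Re z / i.+1%:R.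
    case: z => a b; rewrite -(rmorph_nat (real_complex R)) -fmorphV /=.
    by rewrite mulr0 subr0.
  by rewrite mulrAC.
apply: le_trans (ler_wpM2l (expR_ge0 _) h) _.
rewrite -expRD ler_expR big_split /= -!mulr_sumr.
have := harmonic_le m; have := harmonic_ge m; have := sum_inv_sqr m.+1.
set Q := \sum_(i < m.+1) (_ ^+ 2)^-1; set L := ln _; set H := \sum_(i < m.+1) _^-1 => h1 h2 h3.
have hR := cabs_Re z; have c0 := cabs_ge0 z.
have h4 : complex.Re z * (H - L) <= cabs z.
  rewrite (le_trans (ler_norm _)) // normrM -[leRHS]mulr1 ler_pM //.
  by rewrite ger0_norm; lra.
have h5 : cabs z ^+ 2 / 2 * Q <= cabs z ^+ 2.
  rewrite mulrAC ler_pdivrMr // ler_wpM2l ?exprn_ge0 //.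
rewrite mulrBr in h4; lra.
Qed.

Lemma gaussp_shift m z :
  gaussp m z * (1 + (z + 1) / m.+1%:R) = z * gaussp m (z + 1).
Proof.
rewrite /gaussp big_ord_recl /= addr0 [in RHS]big_ord_recr /=.
have -> : \prod_(i < m.+1) (z + (bump 0 i)%:R) = \prod_(i < m.+1) (z + 1 + i%:R).
  by apply: eq_bigr => i _; rewrite /bump /= -addrA natrD.
have n0 : m.+1%:R != 0 :> R[i] by rewrite pnatr_eq0.
have -> : cexp (- (ln m.+1%:R)%:C * (z + 1)) = cexp (- (ln m.+1%:R)%:C * z) / m.+1%:R.
  rewrite mulrDr mulr1 cexpD -[in X in _ * cexp X]rmorphN cexp_real expRN lnK ?posrE ?ltr0n //.
  by rewrite fmorphV rmorph_nat.
have f0 : (m.+1)`!%:R != 0 :> R[i] by rewrite pnatr_eq0 -lt0n fact_gt0.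
have -> : z + 1 + m.+1%:R = m.+1%:R * (1 + (z + 1) / m.+1%:R) by field.
by field; rewrite f0 /= ?natr1 ?nat1r ?n0.
Qed.

(** The defect in [gaussp_shift] is [gaussp m z] times (z + 1)/(m + 1), which tends to 0 because the
    products are bounded in [m]. *)
Lemma gaussp_lim_shift z l : ccvg (fun m => gaussp m (z + 1)) l ->
  ccvg (fun m => gaussp m z) (z * l).
Proof.
move=> h.
have h0 : ccvg (fun m => gaussp m z * ((z + 1) / m.+1%:R)) 0.
  pose B := cabs z * expR (cabs z + cabs z ^+ 2) * cabs (z + 1).
  apply: (@ccvg_squeeze _ _ _ (fun m => B * (m.+1%:R)^-1)).
    rewrite -(mulr0 B); apply: cvgMr; exact: cvg_harmonic.
  exists 0%N => m _; rewrite subr0 cabsM cabsM cabsV cabs_nat mulrA.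
  by rewrite !ler_wpM2r ?invr_ge0 ?cabs_ge0 // gaussp_bound.
have := ccvgB (ccvgZ z h) h0; rewrite subr0; apply: ccvg_ext => m.
by rewrite -gaussp_shift mulrDr mulr1 addrK.
Qed.

Lemma gaussp_lim_shiftn z l j : ccvg (fun m => gaussp m (z + j%:R)) l ->
  ccvg (fun m => gaussp m z) ((\prod_(k < j) (z + k%:R)) * l).
Proof.
elim: j z l => [|j IH] z l; first by rewrite big_ord0 mul1r addr0.
rewrite -natr1 addrA addrAC => h.
have := gaussp_lim_shift (IH (z + 1) l h); rewrite mulrA; congr (ccvg _ (_ * _)).
rewrite big_ord_recl /= addr0; congr (_ * _); apply: eq_bigr => i _.
by rewrite /bump /= -addrA natrD.
Qed.

Lemma gaussp_neq0 m z : 0 < complex.Re z -> gaussp m z != 0.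
Proof.
move=> z0; rewrite /gaussp mulf_neq0 ?invr_eq0 ?pnatr_eq0 -?lt0n ?fact_gt0 //.
rewrite mulf_neq0 ?cexp_neq0 //.
apply/prodf_neq0 => i _; rewrite -cabs_gt0 (lt_le_trans _ (cabs_Re _)) //.
rewrite normr_gt0 gt_eqF // -(rmorph_nat (real_complex R)); case: z z0 => a b /= a0.
by rewrite ltr_wpDr.
Qed.

End GaussProducts.

(** * Euler's integral as a limit of inverse Gauss products *)

Section EulerIntegral.
Variable R : realType.
Local Notation mu := (@lebesgue_measure R).
Implicit Types (z : R[i]) (u : R).

Lemma cabs_cpow u z : cabs (cpow u z) = expR (complex.Re z * ln u).
Proof. by rewrite /cpow cabs_cexp; case: z => a b /=; congr expR; ring. Qed.

Lemma cpowD u z w : cpow u (z + w) = cpow u z * cpow u w.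
Proof. by rewrite /cpow mulrDr cexpD. Qed.

Lemma cpow1 u : 0 < u -> cpow u 1 = u%:C.
Proof. by move=> u0; rewrite /cpow mulr1 cexp_real lnK. Qed.

Lemma cpowE u (s t : R) : cpow u (s +i* t) =
  (expR (s * ln u) * cos (t * ln u)) +i* (expR (s * ln u) * sin (t * ln u)).
Proof.
have -> : cpow u (s +i* t) = cexp ((s * ln u) +i* (t * ln u)).
  by rewrite /cpow; congr cexp; simpc; congr (_ +i* _); rewrite mulrC.
by rewrite /cexp /=; simpc.
Qed.

(** Real and imaginary parts of a complex constant times u^z, z = s + it, have this form; the
    constant 1/z yields an antiderivative of u^(z-1). *)
Lemma is_derive_pow_trig (s t p q u : R) : 0 < u ->
  is_derive u 1 (fun v : R => expR (s * ln v) * (p * cos (t * ln v) + q * sin (t * ln v)))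
   (expR ((s - 1) * ln u) * ((s * p + t * q) * cos (t * ln u) + (s * q - t * p) * sin (t * ln u))).
Proof.
move=> u0; have dln := is_derive1_ln u0.
have e : expR ((s - 1) * ln u) = expR (s * ln u) / u.
  by rewrite mulrBl mul1r expRB lnK.
apply: is_derive_eq; rewrite e /GRing.scale /=; field; exact: lt0r_neq0.
Qed.

Lemma real_FTC (F f : R -> R) (a b : R) : 0 < a -> a < b ->
  (forall u, 0 < u -> is_derive u 1 F (f u)) ->
  (forall u, 0 < u -> derivable f u 1) ->
  rintg `[a, b] f /\ \int[mu]_(u in `[a, b]) f u = F b - F a.
Proof.
move=> a0 ab dF df.
have pos u : u \in `[a, b] -> 0 < u by rewrite in_itv /= => /andP[/(lt_le_trans a0)].
have cont (g : R -> R) u : derivable g u 1 -> {for u, continuous g}.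
  by move=> dg; apply: differentiable_continuous; apply/derivable1_diffP.
have cf : {within `[a, b], continuous f}.
  by apply: continuous_in_subspaceT => u /set_mem /= /pos /df /cont.
split.
  apply: (@continuous_compact_integrable _ f); first exact: segment_compact.
  exact: cf.
rewrite /Rintegral (@continuous_FTC2 _ f F a b) //.
- have cF u : 0 < u -> {for u, continuous F}.
    by move=> /dF h; apply: cont; case: h.
  split; first by move=> u; rewrite in_itv /= => /andP[/(lt_trans a0) /dF h _]; case: h.
    by apply: cvg_at_right_filter; apply: cF.
  by apply: cvg_at_left_filter; apply: cF; exact: lt_trans ab.
- move=> u; rewrite in_itv /= => /andP[/(lt_trans a0) /dF h _].
  by rewrite derive1E; case: h.
Qed.

Lemma cintegral_cpow_itv z (a b : R) : 0 < a -> a < b -> z != 0 ->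
  cintg `[a, b] (fun u => cpow u (z - 1)) /\
  cintegral `[a, b] (fun u => cpow u (z - 1)) = (cpow b z - cpow a z) / z.
Proof.
move=> a0 ab z0; case E: z z0 => [s t] z0; case E': (z^-1) => [p q].
rewrite E in E'.
have [e1 e2] : s * p - t * q = 1 /\ s * q + t * p = 0.
  by have := divff z0; rewrite E'; simpc; case.
have -> : (fun u => cpow u ((s +i* t) - 1)) = (fun u =>
   (expR ((s - 1) * ln u) * (1 * cos (t * ln u) + 0 * sin (t * ln u))) +i*
   (expR ((s - 1) * ln u) * (0 * cos (t * ln u) + 1 * sin (t * ln u)))).
  apply/funext => u; rewrite -[1]/(1 +i* 0); simpc; rewrite cpowE.
  by [].
have [|u u0|iR vR] := @real_FTC (fun u => expR (s * ln u) * (p * cos (t * ln u) + (- q) * sin (t * ln u)))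
   (fun u => expR ((s - 1) * ln u) * (1 * cos (t * ln u) + 0 * sin (t * ln u))) a b a0 ab.
- move=> u u0; have := is_derive_pow_trig s t p (- q) u0.
  by rewrite mulrN e1 (_ : s * - q - t * p = 0) // mulrN -opprD e2 oppr0.
- by case: (is_derive_pow_trig (s - 1) t 1 0 u0).
have [|u u0|iI vI] := @real_FTC (fun u => expR (s * ln u) * (q * cos (t * ln u) + p * sin (t * ln u)))
   (fun u => expR ((s - 1) * ln u) * (0 * cos (t * ln u) + 1 * sin (t * ln u))) a b a0 ab.
- move=> u u0; have := is_derive_pow_trig s t q p u0.
  by rewrite e1 e2.
- by case: (is_derive_pow_trig (s - 1) t 0 1 u0).
split; first by split.
rewrite /cintegral /= vR vI !cpowE E'; simpc.
by congr (_ +i* _); ring.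
Qed.

Lemma expR_ln_cvg0 (s b : R) : 0 < s -> 0 < b -> forall e, 0 < e ->
  exists n0, forall n, (n0 <= n)%N -> expR (s * ln (b / n.+2%:R)) < e.
Proof.
move=> s0 b0 e e0; pose d := expR (ln e / s).
exists (Num.truncn (b / d)) => n hn.
rewrite -[ltRHS](lnK e0) ltr_expR [s * _]mulrC -ltr_pdivlMr // -ltr_expR.
rewrite -/d lnK ?posrE ?divr_gt0 // ltr_pdivrMr // mulrC -ltr_pdivrMr ?expR_gt0 //.
apply: (@lt_le_trans _ _ (n.+1%:R)); first by rewrite -truncn_le_nat.
by rewrite ler_nat.
Qed.

Lemma rintegral_restrict (D P : set R) (h : R -> R) : P `<=` D ->
  \int[mu]_(u in D) (\1_P u * h u) = \int[mu]_(u in P) h u.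
Proof.
move=> PD; rewrite Rintegral_mkcond [RHS]Rintegral_mkcond; congr (Rintegral _ _ _).
apply/funext => u; rewrite !patchE indicE.
case: (boolP (u \in P)) => [uP|uP]; first by rewrite mem_set ?mul1r //; apply: PD; exact: set_mem.
by rewrite mul0r; case: ifP.
Qed.

Lemma cintegral_restrict (D P : set R) (f : R -> R[i]) : P `<=` D ->
  cintegral D (fun u => (\1_P u)%:C * f u) = cintegral P f.
Proof.
move=> PD; rewrite /cintegral -!(rintegral_restrict _ PD).
by congr (_ +i* _); apply: eq_Rintegral => u _; case: (f u) => x y /=; rewrite mul0r ?subr0 ?addr0.
Qed.

Local Notation itv b := (`]0%R, b]%classic : set R).

(** Monotone convergence along [b/(n+2), b], where the integrals are bounded by b^s / s. The shift
    by 2 keeps the left endpoint strictly below [b]. *)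
Lemma rintg_pow_at0 (s b : R) : 0 < s -> 0 < b ->
  rintg (itv b) (fun u => expR ((s - 1) * ln u)).
Proof.
move=> s0 b0.
pose F n : set R := `[b / n.+2%:R, b]%classic.
have UF : \bigcup_n F n = itv b.
  apply/seteqP; split => [u [n _]|u] /=; rewrite /F /= !in_itv /=.
    by move=> /andP[h ->]; rewrite andbT (lt_le_trans _ h) // divr_gt0.
  move=> /andP[u0 ub]; exists (Num.truncn (b / u)) => //=.
  rewrite in_itv /= ub andbT ler_pdivrMr // mulrC -ler_pdivrMr // ltW //.
  apply: (@lt_le_trans _ _ ((Num.truncn (b / u)).+1%:R)); first exact: truncnS_gt.
  by rewrite ler_nat.
have mf : measurable_fun setT (fun u : R => expR ((s - 1) * ln u)).
  apply: (measurableT_comp (@measurable_expR R)).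
  by apply: measurable_funM; [exact: measurable_cst|exact: measurable_ln].
have h := @ge0_nondecreasing_set_cvg_integral _ (measurableTypeR R) R F (fun u => (expR ((s - 1) * ln u))%:E) mu _ _ _ _.
have {}h : (\int[mu]_(x in F i) (expR ((s - 1) * ln x))%:E)%E @[i --> \oo] -->
    (\int[mu]_(x in itv b) (expR ((s - 1) * ln x))%:E)%E.
  rewrite -UF; apply: h.
  - move=> m n mn; apply/subsetPset => u; rewrite /F /= !in_itv /= => /andP[h ->].
    rewrite andbT (le_trans _ h) // ler_pM2l // lef_pV2 ?posrE ?ltr0n // ler_nat !ltnS //.
  - by move=> i; exact: measurable_itv.
  - by move=> i; apply/measurable_EFinP; exact: measurable_funTS.
  - by move=> i u _; rewrite lee_fin expR_ge0.
apply/integrableP; split.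
  by apply/measurable_EFinP; exact: measurable_funTS.
under eq_integral do rewrite /= ger0_norm ?expR_ge0 //.
apply: (@le_lt_trans _ _ (expR (s * ln b) / s)%:E); last exact: ltry.
rewrite -(cvg_lim (@ereal_hausdorff R) h).
apply: lime_le; first exact: cvgP h.
apply: nearW => n.
have ab : b / n.+2%:R < b by rewrite ltr_pdivrMr // ltr_pMr // ltr1n.
have a0 : 0 < b / n.+2%:R by rewrite divr_gt0.
(* A real power is the case t = 0 of [is_derive_pow_trig], hence the cosines and sines of 0. *)
have [|u u0|iF vF] := @real_FTC (fun u => expR (s * ln u) * (s^-1 * cos (0 * ln u) + 0 * sin (0 * ln u)))
   (fun u => expR ((s - 1) * ln u) * (1 * cos (0 * ln u) + 0 * sin (0 * ln u))) _ _ a0 ab.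
- move=> u u0; have := is_derive_pow_trig s 0 s^-1 0 u0.
  have -> : s / s + 0 * 0 = 1 by rewrite divff ?gt_eqF // mul0r addr0.
  by have -> : s * 0 - 0 / s = 0 by rewrite mulr0 mul0r subrr.
- by case: (is_derive_pow_trig (s - 1) 0 1 0 u0).
have E : (\int[mu]_(x in F n) (expR ((s - 1) * ln x))%:E)%E =
   (\int[mu]_(u in F n) (expR ((s - 1) * ln u)  * (1 * cos (0 * ln u) + 0 * sin (0 * ln u))))%:E.
  rewrite /Rintegral fineK; last exact: integrable_fin_num iF.
  by apply: eq_integral => u _; rewrite !mul0r cos0 addr0 !mulr1.
rewrite E vF lee_fin !mul0r cos0 !mulr1 !addr0 gerBl mulr_ge0 ?expR_ge0 //.
by rewrite invr_ge0 ltW.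
Qed.

Lemma cintegral_cpow_at0 z (b : R) : 0 < complex.Re z -> 0 < b ->
  cintg (itv b) (fun u => cpow u (z - 1)) /\
  cintegral (itv b) (fun u => cpow u (z - 1)) = cpow b z / z.
Proof.
move=> z0 b0.
have zn0 : z != 0 by apply/eqP => zE; rewrite zE /= ltxx in z0.
have mD : measurable (itv b) by exact: measurable_itv.
pose F n : set R := `[b / n.+2%:R, b]%classic.
have FD n : F n `<=` itv b.
  move=> u; rewrite /F /= !in_itv /= => /andP[h ->]; rewrite andbT (lt_le_trans _ h) //.
  by rewrite divr_gt0.
pose f_ n u := (\1_(F n) u)%:C * cpow u (z - 1).
have mf n : cmeas (itv b) (f_ n).
  apply: cmeasM; last exact: cmeas_cpow.
  by apply: cmeas_real; apply: measurable_funTS; apply: measurable_indic; exact: measurable_itv.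
have ReE : complex.Re (z - 1) = complex.Re z - 1 by case: (z).
have ff u : itv b u -> ccvg (fun n => f_ n u) (cpow u (z - 1)).
  rewrite /= in_itv /= => /andP[u0 ub].
  apply: (@ccvg_near _ (fun=> cpow u (z - 1))); last exact: ccvg_cst.
  exists (Num.truncn (b / u)) => n hn; rewrite /f_ indicE mem_set ?mul1r //=.
  rewrite /F /= in_itv /= ub andbT ler_pdivrMr // mulrC -ler_pdivrMr // ltW //.
  apply: (@lt_le_trans _ _ n.+1%:R); last by rewrite ler_nat.
  by rewrite -truncn_le_nat.
have fB n u : itv b u -> cabs (f_ n u) <= expR ((complex.Re z - 1) * ln u).
  move=> _; rewrite cabsM cabs_cpow ReE cabsR indicE ler_piMl ?expR_ge0 //.
  by case: (_ \in _); rewrite ?normr1 ?normr0.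
have [i h] := cdct mD mf ff (rintg_pow_at0 z0 b0) fB.
split => //; apply: (ccvg_unique h).
have lim0 : ccvg (fun n => cpow (b / n.+2%:R) z) 0.
  move=> e e0; have [n0 Hn0] := expR_ln_cvg0 z0 b0 e0.
  by exists n0 => n /Hn0; rewrite subr0 cabs_cpow.
have := ccvgZ z^-1 (ccvgB (ccvg_cst (cpow b z)) lim0).
rewrite subr0 mulrC; apply: ccvg_ext => n; rewrite /f_ cintegral_restrict //.
have ab : b / n.+2%:R < b by rewrite ltr_pdivrMr // ltr_pMr // ltr1n.
have a0 : 0 < b / n.+2%:R by rewrite divr_gt0.
by have [_ ->] := cintegral_cpow_itv a0 ab zn0; rewrite mulrC.
Qed.

(** A Beta integral, by induction on [j]: one factor 1 - u/b splits the integrand into that for z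
    and -1/b times that for z + 1. At b = j = n the value is the inverse of Gauss's product. *)
Lemma cintegral_beta j z (b : R) : 0 < complex.Re z -> 0 < b ->
  cintg (itv b) (fun u => ((1 - u / b) ^+ j)%:C * cpow u (z - 1)) /\
  cintegral (itv b) (fun u => ((1 - u / b) ^+ j)%:C * cpow u (z - 1)) =
    (j`!)%:R * cpow b z / \prod_(k < j.+1) (z + k%:R).
Proof.
move=> + b0; elim: j z => [|j IH] z z0.
  have [i v] := cintegral_cpow_at0 z0 b0.
  have -> : (fun u => ((1 - u / b) ^+ 0)%:C * cpow u (z - 1)) = (fun u => cpow u (z - 1)).
    by apply/funext => u; rewrite expr0 mul1r.
  by split => //; rewrite v big_ord1 addr0 fact0 mul1r.
have z10 : 0 < complex.Re (z + 1) by case: (z) z0 => a c /= a0; rewrite ltr_wpDr.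
have [i1 v1] := IH z z0; have [i2 v2] := IH (z + 1) z10.
have mD : measurable (itv b) by exact: measurable_itv.
pose f1 u := ((1 - u / b) ^+ j)%:C * cpow u (z - 1).
pose f2 u := (- b^-1)%:C * (((1 - u / b) ^+ j)%:C * cpow u (z + 1 - 1)).
have i2' : cintg (itv b) f2 by exact: cintgZ mD i2.
have E u : itv b u -> ((1 - u / b) ^+ j.+1)%:C * cpow u (z - 1) = f1 u + f2 u.
  rewrite /= in_itv /= => /andP[u0 _]; rewrite /f1 /f2.
  have -> : z + 1 - 1 = (z - 1) + 1 by rewrite addrK subrK.
  rewrite (cpowD u (z - 1) 1) cpow1 // exprS !(rmorphM, rmorphB, rmorphN, rmorph1, fmorphV) /=.
  ring.
have i12 := cintgD mD i1 i2'.
split.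
  split; [apply: eq_rintg i12.1|apply: eq_rintg i12.2] => // u /E -> //.
rewrite (eq_cintegral E) cintegralD // v1 /f2 (cintegralZ _ mD i2) v2.
rewrite (cpowD b z 1) cpow1 // [in X in X + _]big_ord_recl /= addr0.
rewrite [in RHS]big_ord_recl [in RHS]big_ord_recr /= addr0.
rewrite [in X in _ + X]big_ord_recr /=.
have E2 : \prod_(i < j) (z + (bump 0 i)%:R) = \prod_(i < j) (z + 1 + i%:R).
  by apply: eq_bigr => i _; rewrite /bump /= -addrA natrD.
rewrite E2 /bump /= add1n factS natrM.
have nz (k : nat) : z + k%:R != 0.
  rewrite -cabs_gt0 (lt_le_trans _ (cabs_Re _)) // normr_gt0 gt_eqF //.
  rewrite -(rmorph_nat (real_complex R)); case: (z) z0 => a c /= a0.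
  by rewrite ltr_wpDr.
set Pz := \prod_(i < j) _.
have Pn0 : Pz != 0.
  apply/prodf_neq0 => k _; have := nz k.+1; rewrite -natr1 addrA addrAC //.
have h1 := nz 0%N; rewrite addr0 in h1; have h2 := nz j.+1.
have h3 : z + 1 + j%:R != 0 by have := h2; rewrite -natr1 addrA addrAC.
have b1 : b%:C != 0 :> R[i] by rewrite realC_neq0 // gt_eqF.
have -> : z + j.+1%:R = z + 1 + j%:R by rewrite -natr1 addrA addrAC.
rewrite rmorphN fmorphV -natr1.
by field; rewrite b1 h1 h3 Pn0.
Qed.


Lemma rintg_restrict (D P : set R) (h : R -> R) : measurable D -> measurable P ->
  rintg P h -> rintg D (fun u => \1_P u * h u).
Proof.
move=> mD mP ih.
have h1 : rintg setT (fun u => \1_P u * h u).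
  have := (@integrable_mkcond _ _ _ mu P (EFin \o h) mP).1 ih.
  apply: (@eq_integrable _ _ _ mu setT measurableT) => u _ /=.
  by rewrite patchE indicE /=; case: (u \in P); rewrite ?mul1r ?mul0r.
exact: (@integrableS _ _ _ mu setT D _ measurableT mD (@subsetT _ D) h1).
Qed.

Lemma rintg_expN (c : R) : 0 < c -> rintg `[0, +oo[ (fun u => expR (- c * u)).
Proof.
move=> c0; have h := @integrable_exponential_pdf R c c0.
have mD : measurable (`[0, +oo[%classic : set R) by exact: measurable_itv.
have {}h : rintg `[0, +oo[ (exponential_pdf c).
  exact: (@integrableS _ _ _ mu setT _ _ measurableT mD (@subsetT _ _) h).
apply: (eq_rintg mD _ (rintgZ c^-1 mD h)) => u /= u0.
by rewrite /exponential_pdf patchE mem_set // mulrA mulVf ?gt_eqF // mul1r.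
Qed.

(** From ln v < v at v = u / (2a). It lets half of an exponential decay absorb any power of u. *)
Lemma ln_le_linear (a u : R) : 0 < a -> 0 < u ->
  a * ln u <= u / 2 + a * ln (2 * a).
Proof.
move=> a0 u0; have a2 : 0 < 2 * a by rewrite mulr_gt0.
rewrite -lerBlDr -mulrBr -ln_div ?posrE // -ler_pdivlMl //.
apply: le_trans (ltW (ln_sublinear _)) _; first by rewrite divr_gt0.
by rewrite le_eqVlt; apply/orP; left; apply/eqP; field; rewrite gt_eqF.
Qed.

Local Notation pos := (`]0%R, +oo[%classic : set R).

Lemma measurable_pos : measurable pos.
Proof. exact: measurable_itv. Qed.

(** On ]0, 1] the power alone dominates; beyond 1 it is traded for half of the exponential decay. *)
Lemma rintg_gamma (s : R) : 0 < s ->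
  rintg pos (fun u => expR ((s - 1) * ln u) * expR (- u)).
Proof.
move=> s0; pose a := `|s - 1| + 1.
have a0 : 0 < a by rewrite ltr_wpDl.
pose K := expR (a * ln (2 * a)).
have i1 : rintg pos (fun u => \1_(itv 1) u * expR ((s - 1) * ln u)).
  by apply: rintg_restrict; [exact: measurable_pos|exact: measurable_itv|exact: rintg_pow_at0].
have i2 : rintg pos (fun u => expR (- 2^-1 * u)).
  apply: (@integrableS _ _ _ mu _ pos _ _ measurable_pos _ (@rintg_expN 2^-1 _)).
  - exact: measurable_itv.
  - by move=> u /=; rewrite !in_itv /= !andbT => /ltW.
  - by rewrite invr_gt0.
apply: (rintg_le measurable_pos _ (rintgD measurable_pos i1 (rintgZ K measurable_pos i2))).
  apply: measurable_funM; apply: measurable_funTS; apply: (measurableT_comp (@measurable_expR R)).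
    by apply: measurable_funM; [exact: measurable_cst|exact: measurable_ln].
  exact: measurable_funN.
move=> u /=; rewrite in_itv /= andbT => u0.
rewrite ger0_norm ?mulr_ge0 ?expR_ge0 // indicE.
have [u1|u1] := leP u 1.
  rewrite mem_set /= ?in_itv /= ?u0 // mul1r.
  rewrite ler_wpDr ?mulr_ge0 ?expR_ge0 // ler_piMr ?expR_ge0 //.
  by rewrite -expR0 ler_expR oppr_le0 ltW.
have -> : (u \in itv 1) = false.
  by apply: memNset; rewrite /= in_itv /= u0 leNgt u1.
rewrite mul0r add0r /K -!expRD ler_expR.
have l0 : 0 <= ln u by rewrite ln_ge0 // ltW.
have h : (s - 1) * ln u <= a * ln u.
  by rewrite ler_wpM2r // (le_trans (ler_norm _)) // lerDl.
have := ln_le_linear a0 u0; lra.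
Qed.

Lemma one_sub_le_expR (u : R) n : 0 <= u <= n.+1%:R ->
  0 <= (1 - u / n.+1%:R) ^+ n.+1 <= expR (- u).
Proof.
move=> /andP[u0 un]; have n0 : (0 : R) < n.+1%:R by [].
have h0 : 0 <= 1 - u / n.+1%:R by rewrite subr_ge0 ler_pdivrMr // mul1r.
rewrite exprn_ge0 //=; have -> : - u = (- (u / n.+1%:R)) *+ n.+1.
  by rewrite -mulr_natl; field; rewrite ?natr1 ?nat1r gt_eqF.
rewrite -[X in expR X]mulr_natl expRM_natl lerXn2r ?nnegrE ?expR_ge0 //.
exact: expR_ge1Dx.
Qed.

Lemma bernoulli_le (x : R) n : 0 <= x <= 1 -> 1 - x *+ n <= (1 - x) ^+ n.
Proof.
move=> /andP[x0 x1]; elim: n => [|n IH]; first by rewrite mulr0n subr0 expr0.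
rewrite exprS mulrSr; have h : 0 <= 1 - x by rewrite subr_ge0.
apply: le_trans (ler_wpM2l h IH); rewrite mulrBr mulr1 mulrBl mul1r.
have : 0 <= x * (x *+ n) by rewrite mulr_ge0 // mulrn_wge0.
lra.
Qed.

(** Write n for [n.+1] and v = u/n. Divided by e^(-u), the right side is ((1 - v) e^v)^n >= (1 -
    v^2)^n, and Bernoulli's inequality gives 1 - n v^2 = 1 - u^2/n. *)
Lemma expR_sub_le (u : R) n : 0 <= u <= n.+1%:R ->
  expR (- u) * (1 - u ^+ 2 / n.+1%:R) <= (1 - u / n.+1%:R) ^+ n.+1.
Proof.
move=> /andP[u0 un]; have n0 : (0 : R) < n.+1%:R by [].
set v := u / n.+1%:R.
have v0 : 0 <= v by rewrite divr_ge0.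
have v1 : v <= 1 by rewrite ler_pdivrMr // mul1r.
have -> : expR (- u) = (expR (- v)) ^+ n.+1.
  by rewrite -expRM_natl; congr expR; rewrite /v; field; rewrite ?natr1 ?nat1r gt_eqF.
have e1 : 1 - v = expR (- v) * ((1 - v) * expR v).
  by rewrite mulrCA -expRD addNr expR0 mulr1.
rewrite [in leRHS]e1 exprMn ler_wpM2l ?exprn_ge0 ?expR_ge0 //.
have h : 1 - v ^+ 2 <= (1 - v) * expR v.
  have -> : 1 - v ^+ 2 = (1 - v) * (1 + v) by ring.
  by rewrite ler_wpM2l ?subr_ge0 ?expR_ge1Dx.
have v2 : 0 <= v ^+ 2 <= 1 by rewrite exprn_ge0 //= exprn_ile1.
apply: (@le_trans _ _ ((1 - v ^+ 2) ^+ n.+1)); last first.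
  rewrite lerXn2r ?nnegrE ?mulr_ge0 ?subr_ge0 ?expR_ge0 //; by case/andP: v2.
apply: le_trans (bernoulli_le _ v2).
rewrite -mulr_natl /v le_eqVlt; apply/orP; left; apply/eqP.
by field; rewrite ?natr1 ?nat1r gt_eqF.
Qed.

Lemma one_sub_cvg_expR (u : R) : 0 < u ->
  (\1_(itv n.+1%:R) u * (1 - u / n.+1%:R) ^+ n.+1) @[n --> \oo] --> expR (- u).
Proof.
move=> u0; apply/cvgrPdist_lt => e e0.
exists (maxn (Num.truncn u) (Num.truncn (expR (- u) * u ^+ 2 / e))) => // n /=.
rewrite geq_max => /andP[h1 h2].
have un : u <= n.+1%:R by rewrite ltW // -truncn_le_nat.
rewrite indicE mem_set /= ?in_itv /= ?u0 // mul1r.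
have hu : 0 <= u <= n.+1%:R by rewrite un ltW.
have /andP[_ a1] := one_sub_le_expR hu; have a2 := expR_sub_le hu.
rewrite ger0_norm ?subr_ge0 //.
have h3 : expR (- u) * u ^+ 2 / n.+1%:R < e.
  by rewrite ltr_pdivrMr // [e * _]mulrC -ltr_pdivrMr // -truncn_le_nat.
have aux (E X P : R) : E - X <= P -> X < e -> E - P < e by lra.
by apply: aux h3; rewrite mulrBr mulr1 mulrA in a2.
Qed.

(** With n = m + 1, each inverse product is the integral of (1 - u/n)^n u^(z-1) over ]0, n]; these
    integrands converge to Euler's and are dominated by its modulus. *)
Lemma euler_gamma_limit z : 0 < complex.Re z ->
  ccvg (fun m => (gaussp m z)^-1) (euler_gamma z).
Proof.
move=> z0; rewrite /euler_gamma.
pose f_ m u := (\1_(itv m.+1%:R) u)%:C *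
  (((1 - u / m.+1%:R) ^+ m.+1)%:C * cpow u (z - 1)).
have ReE : complex.Re (z - 1) = complex.Re z - 1 by case: (z).
have mf m : cmeas pos (f_ m).
  apply: cmeasM.
    apply: cmeas_real; apply: measurable_funTS; apply: measurable_indic; exact: measurable_itv.
  apply: cmeasM; last exact: cmeas_cpow.
  apply: cmeas_real; apply: measurable_funX; apply: measurable_funB; first exact: measurable_cst.
  by apply: measurable_funM; [exact: measurable_id|exact: measurable_cst].
have ff u : pos u -> ccvg (fun m => f_ m u) (cpow u (z - 1) * (expR (- u))%:C).
  rewrite /= in_itv /= andbT => u0; rewrite mulrC.
  have := ccvgM (ccvg_real (one_sub_cvg_expR u0)) (ccvg_cst (cpow u (z - 1))).
  by apply: ccvg_ext => m; rewrite rmorphM /= /f_ mulrA.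
have fB m u : pos u -> cabs (f_ m u) <= expR ((complex.Re z - 1) * ln u) * expR (- u).
  rewrite /= in_itv /= andbT => u0; rewrite /f_ cabsM cabsR cabsM cabsR cabs_cpow ReE indicE.
  have [um|um] := leP u m.+1%:R; last first.
    have -> : (u \in itv m.+1%:R) = false.
      by apply: memNset; rewrite /= in_itv /= u0 leNgt um.
    by rewrite normr0 mul0r mulr_ge0 ?expR_ge0.
  rewrite mem_set /= ?in_itv /= ?u0 // normr1 mul1r mulrC ler_wpM2l ?expR_ge0 //.
  have hu : 0 <= u <= m.+1%:R by rewrite um ltW.
  by have /andP[h1 h2] := one_sub_le_expR hu; rewrite ger0_norm.
have [_ h] := cdct measurable_pos mf ff (rintg_gamma z0) fB.
apply: ccvg_ext h => m; rewrite /f_ cintegral_restrict; last first.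
  by move=> u /=; rewrite !in_itv /= andbT => /andP[].
have m0 : (0 : R) < m.+1%:R by [].
have [_ ->] := cintegral_beta m.+1 z0 m0.
rewrite /gaussp invfM invrK invfM -cexpN mulNr opprK -/(cpow _ z).
by rewrite [LHS]mulrC [_`!%:R * _]mulrC mulrA.
Qed.

(** Boundedness of the products in [m] turns convergence of their inverses into convergence of
    gaussp times Gamma to 1, which excludes a zero of Gamma. *)
Lemma gaussp_limit_right z : 0 < complex.Re z ->
  euler_gamma z != 0 /\ ccvg (fun m => gaussp m z) (euler_gamma z)^-1.
Proof.
move=> z0; have h := euler_gamma_limit z0.
have h1 : ccvg (fun m => gaussp m z * euler_gamma z - 1) 0.
  pose B := cabs z * expR (cabs z + cabs z ^+ 2).
  have B0 : 0 <= B by rewrite mulr_ge0 ?cabs_ge0 ?expR_ge0.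
  move=> e e0; have B1 : 0 < B + 1 by rewrite ltr_wpDl.
  have [n0 H] := h _ (divr_gt0 e0 B1); exists n0 => n /H; rewrite ltr_pdivlMr // => hn.
  have -> : gaussp n z * euler_gamma z - 1 - 0 =
     gaussp n z * (euler_gamma z - (gaussp n z)^-1).
    by rewrite subr0 mulrBr divff ?gaussp_neq0.
  rewrite cabsM cabsB (le_lt_trans _ hn) // mulrC ler_wpM2l ?cabs_ge0 //.
  by rewrite (le_trans (gaussp_bound n z)) // lerDl.
have G0 : euler_gamma z != 0.
  apply/eqP => e; have : (0 : R[i]) = -1.
    apply: (ccvg_unique h1); apply: ccvg_ext (ccvg_cst (-1)) => m.
    by rewrite e mulr0 sub0r.
  by move/eqP; rewrite eq_sym oppr_eq0 oner_eq0.
split => //; have := ccvgD h1 (ccvg_cst 1); rewrite add0r => h2.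
have := ccvgZ (euler_gamma z)^-1 h2; rewrite mulr1; apply: ccvg_ext => m.
by rewrite subrK mulrCA mulVf // mulr1.
Qed.

(** The limit does not see the number of factors chosen in [rgamma]; the functional equation and
    analyticity are read off from it. *)
Lemma gaussp_limit z : ccvg (fun m => gaussp m z) (rgamma z).
Proof.
rewrite /rgamma; set n := (Num.truncn `|complex.Re z|).+1.
apply: gaussp_lim_shiftn.
have zn : 0 < complex.Re (z + n%:R).
  have : `|complex.Re z| < n%:R by exact: truncnS_gt.
  rewrite -(rmorph_nat (real_complex R)); case: (z) => a b /=.
  by rewrite ltr_norml => /andP[h _]; rewrite -ltrBlDr sub0r.
by have [] := gaussp_limit_right zn.
Qed.

Lemma rgamma_neq0 z : (forall k : nat, z + k%:R != 0) -> rgamma z != 0.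
Proof.
move=> hz; rewrite /rgamma; set n := (Num.truncn `|complex.Re z|).+1.
have zn : 0 < complex.Re (z + n%:R).
  have : `|complex.Re z| < n%:R by exact: truncnS_gt.
  rewrite -(rmorph_nat (real_complex R)); case: (z) => a b /=.
  by rewrite ltr_norml => /andP[h _]; rewrite -ltrBlDr sub0r.
have [G0 _] := gaussp_limit_right zn.
by rewrite mulf_neq0 ?invr_eq0 //; apply/prodf_neq0 => k _.
Qed.

Lemma rgammaS z : rgamma z = z * rgamma (z + 1).
Proof.
exact: ccvg_unique (gaussp_limit z) (gaussp_lim_shift (gaussp_limit (z + 1))).
Qed.

Lemma rgamma_right z : 0 < complex.Re z -> rgamma z = (euler_gamma z)^-1.
Proof.
by move=> z0; apply: ccvg_unique (gaussp_limit z) _; have [] := gaussp_limit_right z0.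
Qed.

Lemma entire_rgamma : entire_fun (@rgamma R).
Proof.
have h m : exists a, entire a /\ forall z, psum a z (gaussp m z).
  by have [a ea ha] := @entire_gaussp R m; exists a.
have [a ha] := choice h.
have [||||c ec hc] := @entire_limit R a (fun m z => gaussp m z) (@rgamma R).
- by move=> m; case: (ha m).
- by move=> m; case: (ha m).
- exact: gaussp_limit.
- move=> rho; exists (`|rho| * expR (`|rho| + `|rho| ^+ 2)) => m z zr.
  have zr' : cabs z <= `|rho| by rewrite (le_trans zr) ?ler_norm.
  apply: le_trans (gaussp_bound m z) _; rewrite ler_pM ?cabs_ge0 ?expR_ge0 //.
  by rewrite ler_expR lerD // lerXn2r ?nnegrE ?cabs_ge0.
by exists c.
Qed.

End EulerIntegral.

(** * 1/Gamma and Gamma at matrices *)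

Section MatrixFunctions.
Variable R : realType.
Implicit Types (z : R[i]).

Lemma coef_unique (a b : nat -> R[i]) (f : R[i] -> R[i]) : entire a -> entire b ->
  (forall z, psum a z (f z)) -> (forall z, psum b z (f z)) -> a =1 b.
Proof.
move=> ea eb ha hb j.
have [_ e1] := cintegral_coef j ltr01 ea ha; have [_ e2] := cintegral_coef j ltr01 eb hb.
apply: (mulfI (_ : (2 * pi)%:C != 0 :> R[i])); last by rewrite -e1 -e2.
by rewrite realC_neq0 // gt_eqF // mulr_gt0 ?pi_gt0.
Qed.

Variable N : nat.
Implicit Types (M X Z : 'M[R[i]]_N).

Lemma ccvg_entry (u : nat -> 'M[R[i]]_N) X : u @ \oo --> X ->
  forall i j, ccvg (fun n => u n i j) (X i j).
Proof.
move=> uX i j e e0.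
have h : nbhs X (fun Y : 'M[R[i]]_N => cabs (Y i j - X i j) < e).
  exists (fun i' j' => (fun z : R[i] => cabs (z - X i' j') < e)).
    move=> i' j'; apply/nbhs_ballP; exists (e%:C) => /=; first by rewrite ltcR.
    by rewrite /ball /= => z /=; rewrite cabsE ltcR cabsB.
  by move=> Y /= /(_ i j).
by case: (uX _ h) => n0 _ h0; exists n0 => n nn0; exact: h0.
Qed.

Lemma cvg_entry (u : nat -> 'M[R[i]]_N) X :
  (forall i j, ccvg (fun n => u n i j) (X i j)) -> u @ \oo --> X.
Proof.
move=> uX A [P hP PA].
have h i j : exists n0, forall n, (n0 <= n)%N -> P i j (u n i j).
  have /nbhs_ballP[e /= e0 he] := hP i j.
  have e0' : 0 < complex.Re e by move: e0; rewrite ltcE => /andP[].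
  have eE : e = (complex.Re e)%:C.
    by rewrite RRe_real // realE ltW.
  have [n0 H] := uX i j _ e0'; exists n0 => n /H hn; apply: he.
  by rewrite /ball /= eE cabsE ltcR cabsB.
pose n0 i j := projT1 (cid (h i j)).
exists (\max_i \max_j n0 i j)%N => // n /= hn; apply: PA => i j.
apply: (projT2 (cid (h i j))); apply: leq_trans hn; rewrite -/(n0 i j).
apply: leq_trans (leq_bigmax (F := fun i => \max_j n0 i j)%N i).
exact: (leq_bigmax (F := fun j => n0 i j) j).
Qed.

Lemma limn_entry (u : nat -> 'M[R[i]]_N) X :
  (forall i j, ccvg (fun n => u n i j) (X i j)) -> limn u = X.
Proof.
move=> uX; have cv : u @ \oo --> limn u by apply: cvgP (cvg_entry uX).
by apply/matrixP => i j; exact: ccvg_unique (ccvg_entry cv i j) (uX i j).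
Qed.

Lemma series_entry (u : nat -> 'M[R[i]]_N) n i j :
  series u n i j = \sum_(k < n) u k i j.
Proof. by rewrite seriesEnat /= big_mkord summxE. Qed.

Lemma mxholo_entire f M : entire_fun f -> exists2 a, entire a &
  (forall z, psum a z (f z)) /\ mxpsum a M (mxholo f M).
Proof. by move=> [a ea ha]; exists a => //; split => //; exact: mxholo_psum. Qed.

Lemma mxrgamma_comm M Z : M *m Z = Z *m M ->
  mxrgamma M *m Z = Z *m mxrgamma M.
Proof.
by move=> MZ; have [a _ [_ h]] := mxholo_entire M (entire_rgamma R); exact: mxpsum_comm MZ h.
Qed.

(** The scalar equation is an identity of entire functions, hence of coefficients, with [e] the
    series of z and [d] that of 1/Gamma (z + 1); evaluation at [M] gives the matrix equation. *)
Lemma mxrgammaS M : mxrgamma M = M *m mxrgamma (M + 1%:M).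
Proof.
have [a ea ha] := entire_rgamma R.
have [d [hd ed]] := entire_taylor 1 ea.
have hdz z : psum d z (rgamma (z + 1)).
  have h0 : 0 <= cabs (1 : R[i]) + cabs z + 1 by rewrite !addr_ge0 ?cabs_ge0.
  have [|s [h1 h2]] := psum_recenter (h := z) hd (ea _ h0); first by rewrite ltrDl.
  by rewrite addrC -(cseries_unique h1 (ha _)).
have hX : mxpsum d M (mxrgamma (M + 1%:M)).
  by apply: (mxpsum_recenter ea hd); apply: mxholo_psum.
pose e (k : nat) : R[i] := (k == 1%N)%:R.
have he z : psum e z z.
  have := @cseries_finite R 2 (fun k => e k * z ^+ k).
  rewrite !big_ord_recr big_ord0 /= /e /= mul0r !add0r mul1r expr1; apply.
  by move=> [|[|k]] //= _; rewrite mul0r.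
have ee : entire e.
  move=> t t0; exists t => -[|[|k]] /=; rewrite /e /= ?cabs0 ?mul0r //.
  by rewrite cabs1 mul1r expr1.
have heM : mxpsum e M M.
  move=> i j; have := @cseries_finite R 2 (fun k => e k * (M ^+ k) i j).
  rewrite !big_ord_recr big_ord0 /= /e /= mul0r !add0r mul1r expr1; apply.
  by move=> [|[|k]] //= _; rewrite mul0r.
have c : cauchy_prod e d =1 a.
  apply: (coef_unique (f := @rgamma R)) => //; first exact: entire_cauchy_prod.
  by move=> z; rewrite rgammaS; exact: psum_cauchy_prod.
apply: (@mxpsum_unique _ _ a M); first exact: mxholo_psum.
by apply: mxpsum_ext c _; exact: mxpsum_cauchy_prod.
Qed.

Lemma mxpochS M n : mxpoch M n.+1 = mxpoch M n *m (M + n%:R%:M).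
Proof. by rewrite /mxpoch big_ord_recr. Qed.

Lemma mxrgamma_poch M n : mxrgamma M = mxpoch M n *m mxrgamma (M + n%:R%:M).
Proof.
elim: n => [|n IH].
  by rewrite /mxpoch big_ord0 -[1 *m _]/(1%:M *m _) mul1mx raddf0 addr0.
rewrite mxpochS -mulmxA; have -> : M + n.+1%:R%:M = M + n%:R%:M + 1%:M.
  by rewrite -natr1 raddfD addrA.
by rewrite -mxrgammaS.
Qed.

(** The kernel of [X] is nonzero and stable under [M], and over an algebraically closed field [M]
    has an eigenvector in it. *)
Lemma singular_eigen M X : X *m M = M *m X -> X \notin unitmx ->
  exists (v : 'rV[R[i]]_N) (l : R[i]), [/\ v != 0, v *m M = l *: v & v *m X = 0].
Proof.
move=> XM; rewrite -row_free_unit -kermx_eq0 => K0.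
pose K := row_base (kermx X); pose k := \rank (kermx X).
have k0 : (0 < k)%N by rewrite lt0n mxrank_eq0.
have KX : K *m X = 0 by apply/sub_kermxP; rewrite eq_row_base.
have /submxP[D hD] : (K *m M <= K)%MS.
  rewrite eq_row_base; apply/sub_kermxP.
  by rewrite -mulmxA -XM mulmxA KX mul0mx.
have [l /eigenvalueP[w wD w0]] := eigenvalue_closed D k0.
exists (w *m K), l; split.
- by rewrite mulmx_free_eq0 // row_base_free.
- by rewrite -mulmxA hD mulmxA wD scalemxAl.
- by rewrite -mulmxA KX mulmx0.
Qed.

(** Otherwise [mxrgamma M] kills an eigenvector of [M], whose eigenvalue l is a zero of 1/Gamma.
    Invertibility of M + k excludes l = -k, and there are no other zeros. *)
Lemma mxrgamma_unit M : (forall l : nat, M + l%:R%:M \in unitmx) ->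
  mxrgamma M \in unitmx.
Proof.
move=> hM; apply: contraT => nu.
have [a ea [ha h]] := mxholo_entire M (entire_rgamma R).
have [v [l [v0 vM vX]]] := singular_eigen (mxpsum_comm erefl h) nu.
have e := mxpsum_eigen h vM (ha l).
have /rgamma_neq0 : forall k : nat, l + k%:R != 0.
  move=> k; apply: contraNneq v0 => lk; rewrite -(mulmxK (hM k) v) mulmxDr vM.
  by rewrite mul_mx_scalar -scalerDl lk scale0r mul0mx.
move: e; rewrite -/(mxrgamma M) vX => /esym/eqP; rewrite scaler_eq0 (negbTE v0) orbF => /eqP -> //.
by rewrite eqxx.
Qed.

Lemma mxpoch_unit M n : (forall l : nat, M + l%:R%:M \in unitmx) ->
  mxpoch M n \in unitmx.
Proof.
move=> hM; elim: n => [|n IH]; first by rewrite /mxpoch big_ord0 unitmx1.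
by rewrite mxpochS unitmx_mul IH hM.
Qed.

Lemma unit_shift M n : (forall l : nat, M + l%:R%:M \in unitmx) ->
  forall l : nat, M + n%:R%:M + l%:R%:M \in unitmx.
Proof. by move=> hM l; have := hM (n + l)%N; rewrite natrD raddfD addrA. Qed.

Lemma mxrgamma_gamma_shift M n : (forall l : nat, M + l%:R%:M \in unitmx) ->
  mxrgamma M *m mxgamma (M + n%:R%:M) = mxpoch M n.
Proof.
move=> hM; rewrite (mxrgamma_poch M n) /mxgamma mulmxK //.
by apply: mxrgamma_unit; exact: unit_shift.
Qed.

Lemma mxgamma_rgamma_shift M n : (forall l : nat, M + l%:R%:M \in unitmx) ->
  mxgamma M *m mxrgamma (M + n%:R%:M) = invmx (mxpoch M n).
Proof.
move=> hM; rewrite /mxgamma.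
have u1 := mxrgamma_unit hM; have u2 := mxrgamma_unit (unit_shift n hM).
have u3 := mxpoch_unit n hM.
rewrite -[RHS](mulKmx u1) (mxrgamma_poch M n).
congr (invmx _ *m _); rewrite -mulmxA.
have c : mxrgamma (M + n%:R%:M) *m mxpoch M n = mxpoch M n *m mxrgamma (M + n%:R%:M).
  apply: mxrgamma_comm.
  have : GRing.comm (M + n%:R%:M) (mxpoch M n).
    apply: commr_prod => k _; apply: commrD.
      apply: commr_sym; apply: commrD; first exact: commr_refl.
      by apply: commr_sym; exact: comm_scalar_mxC.
    by apply: commr_sym; exact: comm_scalar_mxC.
  by [].
by rewrite mulmxA -c mulmxK.
Qed.

End MatrixFunctions.

(** * The incomplete Gamma ratio *)

Section IncompleteGamma.
Variable R : realType.
Local Notation mu := (@lebesgue_measure R).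
Variable x : R.
Hypothesis x_gt0 : 0 < x.
Implicit Types (z : R[i]) (u : R).
Local Notation D := (`[x, +oo[%classic : set R).

Let mD : measurable D.
Proof. exact: measurable_itv. Qed.

Lemma sum_exp_le (t : R) n : 0 <= t -> \sum_(k < n) t ^+ k / k`!%:R <= expR t.
Proof.
move=> t0; have -> : \sum_(k < n) t ^+ k / k`!%:R = series (exp_coeff t) n.
  by rewrite seriesEnat /= big_mkord.
apply: nondecreasing_cvgn_le; last exact: is_cvg_series_exp_coeff.
apply/nondecreasing_seqP => m; rewrite !seriesEnat /= big_nat_recr //= lerDl.
by rewrite /exp_coeff /= divr_ge0 ?exprn_ge0.
Qed.

(** For u >= 1 the power is absorbed by half of the decay; on [x, 1] the logarithm is bounded by |ln
    x|. *)
Lemma exp_ln_bound (rho : R) : 0 <= rho -> exists2 K, 0 <= K &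
  forall u, D u -> expR (- u) * expR (rho * `|ln u|) <= K * expR (- 2^-1 * u).
Proof.
move=> r0; pose C := (rho + 1) * ln (2 * (rho + 1)) + rho * `|ln x|.
exists (expR C); first exact: expR_ge0.
move=> u /=; rewrite in_itv /= andbT => xu.
have u0 : 0 < u by apply: lt_le_trans xu.
rewrite -!expRD ler_expR.
have r1 : 0 < rho + 1 by rewrite ltr_wpDl.
have l2 : 0 <= ln (2 * (rho + 1)) by apply: ln_ge0; lra.
have h1 : 0 <= (rho + 1) * ln (2 * (rho + 1)) by rewrite mulr_ge0 // ltW.
have h2 : 0 <= rho * `|ln x| by rewrite mulr_ge0.
have [u1|u1] := leP 1 u.
  have l0 : 0 <= ln u by exact: ln_ge0.
  rewrite ger0_norm //; have := ln_le_linear r1 u0.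
  by rewrite /C mulrDl mul1r; lra.
have lu : ln u <= 0 by rewrite ln_le0 // ltW.
have lx : ln x <= ln u by rewrite ler_ln ?posrE.
have : rho * `|ln u| <= rho * `|ln x|.
  by rewrite ler_wpM2l // !ler0_norm ?lerN2 // (le_trans lx).
by rewrite /C; lra.
Qed.

Lemma rintg_exp_half : rintg D (fun u => expR (- 2^-1 * u)).
Proof.
apply: (@integrableS _ _ _ mu _ D _ _ mD _ (@rintg_expN R 2^-1 _)).
- exact: measurable_itv.
- by move=> u /=; rewrite !in_itv /= !andbT; apply: le_trans; exact: ltW.
- by rewrite invr_gt0.
Qed.

(** Taylor coefficients of Gamma(z, x) at z = 1, obtained by expanding u^(z-1) in powers of (z - 1)
    ln u. *)
Definition igamma_coef (k : nat) : R[i] :=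
  cintegral D (fun u => (expR (- u) * (ln u ^+ k / k`!%:R))%:C).

Lemma cmeas_igamma_coef k : cmeas D (fun u => (expR (- u) * (ln u ^+ k / k`!%:R))%:C).
Proof.
apply: cmeas_real; apply: measurable_funM; apply: measurable_funTS.
  by apply: (measurableT_comp (@measurable_expR R)); exact: measurable_funN.
by apply: measurable_funM; [apply: measurable_funX; exact: measurable_ln|exact: measurable_cst].
Qed.

Lemma igamma_coef_term_le rho k u : 0 <= rho ->
  cabs (expR (- u) * (ln u ^+ k / k`!%:R))%:C * rho ^+ k <=
  expR (- u) * expR (rho * `|ln u|).
Proof.
move=> r0; rewrite cabsR normrM ger0_norm ?expR_ge0 // -mulrA ler_wpM2l ?expR_ge0 //.
have t0 : 0 <= rho * `|ln u| by rewrite mulr_ge0.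
apply: le_trans (sum_exp_le k.+1 t0); rewrite big_ord_recr /= ler_wpDl //.
  by rewrite sumr_ge0 // => i _; rewrite divr_ge0 ?exprn_ge0.
by rewrite normrM normfV normr_nat normrX exprMn mulrC mulrA.
Qed.

Lemma cintg_igamma_coef k : cintg D (fun u => (expR (- u) * (ln u ^+ k / k`!%:R))%:C).
Proof.
have [K K0 hK] := exp_ln_bound ler01.
apply: (cintg_dom mD (cmeas_igamma_coef k) (rintgZ K mD rintg_exp_half)) => u Du.
apply: le_trans (hK u Du); have := igamma_coef_term_le k u ler01.
by rewrite expr1n mulr1.
Qed.

Lemma entire_igamma_coef : entire igamma_coef.
Proof.
move=> t t0; have t1 : 0 < t + 1 by rewrite ltr_wpDl.
apply: (bounded_at_le t0 (_ : t <= t + 1)); first by rewrite lerDl.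
have [K K0 hK] := exp_ln_bound (ltW t1).
exists (2 * \int[mu]_(u in D) (K * expR (- 2^-1 * u))) => k.
rewrite -ler_pdivlMr ?exprn_gt0 //.
have := cintegral_le mD (cmeas_igamma_coef k)
  (rintgZ ((t + 1) ^- k) mD (rintgZ K mD rintg_exp_half)) _.
rewrite RintegralZl //; last exact: rintgZ K mD rintg_exp_half.
rewrite mulrCA mulrC; apply => u Du.
rewrite [leRHS]mulrC ler_pdivlMr ?exprn_gt0 //.
by apply: le_trans (hK u Du); apply: igamma_coef_term_le; exact: ltW.
Qed.

(** [d k] is either (z-1)^k or an entry of (M-1)^k. Geometric growth of [d] is enough to integrate
    the exponential series termwise, dominated by a multiple of e^(-u) e^(rho |ln u|). *)
Lemma igamma_series (d : nat -> R[i]) (S : R -> R[i]) (rho B : R) : 0 <= rho ->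
  (forall k, cabs (d k) <= B * rho ^+ k) ->
  (forall u, D u -> cseries (fun k => (ln u ^+ k / k`!%:R)%:C * d k) (S u)) ->
  cseries (fun k => igamma_coef k * d k) (cintegral D (fun u => (expR (- u))%:C * S u)).
Proof.
move=> r0 dB hS.
have B0 : 0 <= B by have := dB 0%N; rewrite expr0 mulr1; apply: le_trans; exact: cabs_ge0.
pose g k u := (expR (- u) * (ln u ^+ k / k`!%:R))%:C.
pose f_ K u := \sum_(k < K) d k * g k u.
have ig k : cintg D (fun u => d k * g k u) by apply: cintgZ mD (cintg_igamma_coef k).
have [K K0 hK] := exp_ln_bound r0.
have mf n : cmeas D (f_ n).
  by apply: cmeas_sum => k; apply: cintg_cmeas mD (ig k).
have ff u : D u -> ccvg (fun n => f_ n u) ((expR (- u))%:C * S u).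
  move=> Du; apply: ccvg_ext (ccvgZ (expR (- u))%:C (hS u Du)) => n.
  rewrite mulr_sumr; apply: eq_bigr => k _; rewrite /g rmorphM /=; ring.
have fB n u : D u -> cabs (f_ n u) <= B * (K * expR (- 2^-1 * u)).
  move=> Du; apply: le_trans (ler_wpM2l B0 (hK u Du)).
  have t0 : 0 <= rho * `|ln u| by rewrite mulr_ge0.
  apply: le_trans (ler_wpM2l B0 (ler_wpM2l (expR_ge0 _) (sum_exp_le n t0))).
  apply: le_trans (cabs_sum _ _ _) _; rewrite mulrA mulr_sumr; apply: ler_sum => k _.
  rewrite cabsM cabsR normrM ger0_norm ?expR_ge0 // normrM normfV normr_nat normrX.
  have -> : B * expR (- u) * ((rho * `|ln u|) ^+ k / k`!%:R) =
    (B * rho ^+ k) * (expR (- u) * (`|ln u| ^+ k / k`!%:R)) by rewrite exprMn; ring.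
  by rewrite ler_wpM2r // mulr_ge0 ?expR_ge0 ?divr_ge0 ?exprn_ge0.
have [_ h] := cdct mD mf ff (rintgZ B mD (rintgZ K mD rintg_exp_half)) fB.
apply: ccvg_ext h => n.
have [_ ->] := cintegral_sum (index_enum 'I_n) mD (fun k : 'I_n => ig k).
apply: eq_bigr => k _; rewrite (cintegralZ _ mD (cintg_igamma_coef k)) mulrC //.
Qed.

Definition igamma z : R[i] := cintegral D (fun u => (expR (- u))%:C * cpow u (z - 1)).

Lemma psum_igamma_coef z : psum igamma_coef (z - 1) (igamma z).
Proof.
apply: (@igamma_series (fun k => (z - 1) ^+ k) _ (cabs (z - 1)) 1).
- exact: cabs_ge0.
- by move=> k; rewrite mul1r cabsX.
- move=> u _; apply: cseries_ext (psum_cexp ((ln u)%:C * (z - 1))) => k.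
  rewrite exprMn mulrA rmorphM /= fmorphV rmorph_nat rmorphXn; congr (_ * _).
  by rewrite mulrC.
Qed.

Lemma mxpsum_igamma_coef N (M : 'M[R[i]]_N) : mxpsum igamma_coef (M - 1%:M) (mxigamma M x).
Proof.
move=> i j; rewrite mxE.
have E u : mxpsum (inv_fact R) ((ln u)%:C *: (M - 1%:M)) (mxpow u (M - 1%:M)).
  have [X hX] := mxpsum_ex ((ln u)%:C *: (M - 1%:M)) (@entire_inv_fact R).
  suff -> : mxpow u (M - 1%:M) = X by [].
  apply: limn_entry => i' j'; apply: ccvg_ext (hX i' j') => n.
  by rewrite series_entry; apply: eq_bigr => k _; rewrite mxE.
have -> : cintegral D (fun u => ((expR (- u))%:C *: mxpow u (M - 1%:M)) i j) =
    cintegral D (fun u => (expR (- u))%:C * mxpow u (M - 1%:M) i j).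
  by apply: eq_cintegral => u _; rewrite mxE.
apply: (@igamma_series (fun k => ((M - 1%:M) ^+ k) i j) _ (mxn (M - 1%:M)) 1).
- exact: mxn_ge0.
- by move=> k; rewrite mul1r entryX_le.
- move=> u _; apply: cseries_ext (E u i j) => k.
  have -> : ((ln u)%:C *: (M - 1%:M)) ^+ k = (ln u)%:C ^+ k *: (M - 1%:M) ^+ k.
    elim: k => [|k IH]; first by rewrite !expr0 scale1r.
    by rewrite !exprS IH -[LHS]/(_ *m _) -scalemxAl -scalemxAr scalerA -exprS.
  rewrite [in LHS]mxE mulrA rmorphM /= fmorphV rmorph_nat rmorphXn; congr (_ * _).
  by rewrite mulrC.
Qed.

(** One coefficient sequence, moved from the centre 1 to 0, serves numbers and matrices of every
    size, so that scalar estimates can be transferred to the matrix integral. *)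
Lemma igamma_calculus : exists F, [/\ entire F, forall z, psum F z (igamma z) &
  forall N (M : 'M[R[i]]_N), mxpsum F M (mxigamma M x)].
Proof.
have [F [hF eF]] := entire_taylor (-1) entire_igamma_coef.
exists F; split => //.
  move=> z; have h0 : 0 <= cabs (- 1 : R[i]) + cabs z + 1 by rewrite !addr_ge0 ?cabs_ge0.
  have [|s [h1 h2]] := psum_recenter (h := z) hF (entire_igamma_coef h0); first by rewrite ltrDl.
  by rewrite addrC in h1; rewrite (cseries_unique (psum_igamma_coef z) h1).
move=> N M; apply: (mxpsum_recenter entire_igamma_coef hF).
by rewrite raddfN; exact: mxpsum_igamma_coef.
Qed.

Definition gratio z := igamma z * rgamma z.

Lemma gratio_calculus : exists g, [/\ entire g, forall z, psum g z (gratio z) &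
  forall N (M : 'M[R[i]]_N), mxpsum g M (mxigamma M x *m mxrgamma M)].
Proof.
have [F [eF hF hFM]] := igamma_calculus; have [a ea ha] := entire_rgamma R.
exists (cauchy_prod F a); split.
- exact: entire_cauchy_prod.
- by move=> z; exact: psum_cauchy_prod.
- by move=> N M; apply: mxpsum_cauchy_prod => //; exact: mxholo_psum.
Qed.

End IncompleteGamma.

(** * Decay of Gamma(z,x)/Gamma(z) - 1 in sectors *)

Section GammaRatioEstimate.
Variable R : realType.
Local Notation mu := (@lebesgue_measure R).
Implicit Types (z : R[i]) (u s t : R).
Local Notation pos := (`]0%R, +oo[%classic : set R).

Lemma cpow_real u s : cpow u s%:C = (expR (s * ln u))%:C.
Proof. by rewrite -[s%:C]/(s +i* 0) cpowE mul0r cos0 sin0 mulr0 mulr1. Qed.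

Lemma Rintegral_pow_at0 s b : 0 < s -> 0 < b ->
  \int[mu]_(u in (`]0%R, b]%classic : set R)) expR ((s - 1) * ln u) = expR (s * ln b) / s.
Proof.
move=> s0 b0; have [|_ h] := @cintegral_cpow_at0 R s%:C b _ b0; first by [].
transitivity (complex.Re (cintegral (`]0%R, b]%classic : set R) (fun u => cpow u (s%:C - 1)))).
  apply: eq_Rintegral => u _.
  have -> : s%:C - 1 = (s - 1)%:C :> R[i] by rewrite rmorphB rmorph1.
  by rewrite cpow_real.
by rewrite h cpow_real -fmorphV -rmorphM.
Qed.

(** The difference is the integral over ]0, x[, where e^(-u) <= 1. *)
Lemma gamma_split x z : 0 < x -> 0 < complex.Re z ->
  cabs (euler_gamma z - igamma x z) <=
  2 * (expR (complex.Re z * ln x) / complex.Re z).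
Proof.
move=> x0 z0; pose f u := cpow u (z - 1) * (expR (- u))%:C.
pose P1 : set R := `]0%R, x[%classic; pose P2 : set R := `[x, +oo[%classic.
pose D1 : set R := `]0%R, x]%classic.
have mP1 : measurable P1 by exact: measurable_itv.
have mP2 : measurable P2 by exact: measurable_itv.
have mD1 : measurable D1 by exact: measurable_itv.
have s1 : P1 `<=` pos by move=> u; rewrite /P1 /= !in_itv /= andbT => /andP[].
have s2 : P2 `<=` pos.
  by move=> u; rewrite /P2 /= !in_itv /= !andbT; apply: lt_le_trans.
have s3 : P1 `<=` D1.
  by move=> u; rewrite /P1 /D1 /= !in_itv /= => /andP[-> /ltW].
have mf D : cmeas D f.
  apply: cmeasM; first exact: cmeas_cpow.
  apply: cmeas_real; apply: measurable_funTS; apply: (measurableT_comp (@measurable_expR R)).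
  exact: measurable_funN.
have m1 D P : measurable P -> cmeas D (fun u => (\1_P u)%:C * f u).
  move=> mP; apply: cmeasM => //; apply: cmeas_real; apply: measurable_funTS.
  exact: measurable_indic.
have i1 (P : set R) : measurable P -> cintg pos (fun u => (\1_P u)%:C * f u).
  move=> mP; apply: (cintg_dom (@measurable_pos R) (m1 _ _ mP) (rintg_gamma z0)) => u _.
  rewrite cabsM cabsR cabsM cabs_cpow cabsR [X in _ * (_ * X)]ger0_norm ?expR_ge0 //.
  have -> : complex.Re (z - 1) = complex.Re z - 1 by case: (z).
  rewrite indicE ler_piMl ?mulr_ge0 ?expR_ge0 //.
  by case: (_ \in _); rewrite ?normr1 ?normr0.
have e2 : igamma x z = cintegral P2 f.
  by apply: eq_cintegral => u _; rewrite /f mulrC.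
have -> : euler_gamma z - igamma x z = cintegral P1 f.
  rewrite e2 -(cintegral_restrict f s1) -(cintegral_restrict f s2).
  apply/eqP; rewrite subr_eq -(cintegralD (@measurable_pos R) (i1 _ mP1) (i1 _ mP2)); apply/eqP.
  apply: eq_cintegral => u; rewrite /= in_itv /= andbT => u0.
  rewrite -mulrDl -rmorphD /= !indicE.
  have [ux|xu] := ltP u x.
    rewrite mem_set /P1 /= ?in_itv /= ?u0 ?ux // memNset ?addr0 ?rmorph1 ?mul1r //.
    by rewrite /P2 /= in_itv /= andbT leNgt ux.
  rewrite memNset; last by rewrite /P1 /= in_itv /= u0 ltNge xu.
  by rewrite mem_set ?add0r ?rmorph1 ?mul1r // /P2 /= in_itv /= andbT.
rewrite -(cintegral_restrict f s3) -Rintegral_pow_at0 //.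
apply: (cintegral_le mD1 (m1 _ _ mP1) (rintg_pow_at0 z0 x0)) => u.
rewrite /D1 /= in_itv /= => /andP[u0 _].
rewrite cabsM cabsR cabsM cabs_cpow cabsR [X in _ * (_ * X)]ger0_norm ?expR_ge0 //.
have -> : complex.Re (z - 1) = complex.Re z - 1 by case: (z).
rewrite indicE; apply: (@le_trans _ _ (expR ((complex.Re z - 1) * ln u) * expR (- u))).
  rewrite ler_piMl ?mulr_ge0 ?expR_ge0 //.
  by case: (_ \in _); rewrite ?normr1 ?normr0.
by rewrite ler_piMr ?expR_ge0 // -expR0 ler_expR oppr_le0 ltW.
Qed.

(** Euler's integral is cut down to [T, T + 1]. Since [T] is free, Gamma(s) is seen to outgrow every
    exponential. *)
Lemma euler_gamma_ge (T s : R) : 1 <= T -> 1 <= s ->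
  expR ((s - 1) * ln T) * expR (- (T + 1)) <= cabs (euler_gamma s%:C).
Proof.
move=> T1 s1; have s0 : 0 < s by apply: lt_le_trans s1.
have T0 : 0 < T by apply: lt_le_trans T1.
apply: le_trans (cabs_Re _); apply: le_trans (ler_norm _).
have -> : complex.Re (euler_gamma s%:C) =
    \int[mu]_(u in pos) (expR ((s - 1) * ln u) * expR (- u)).
  apply: eq_Rintegral => u _.
  have -> : s%:C - 1 = (s - 1)%:C :> R[i] by rewrite rmorphB rmorph1.
  by rewrite cpow_real -rmorphM.
pose I : set R := `[T, T + 1]%classic.
have mI : measurable I by exact: measurable_itv.
have sI : I `<=` pos.
  by move=> u; rewrite /I /= !in_itv /= andbT => /andP[h _]; apply: lt_le_trans h.
set c := expR ((s - 1) * ln T) * expR (- (T + 1)).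
have ic : rintg I (fun=> c).
  apply: continuous_compact_integrable; first exact: segment_compact.
  by apply: continuous_subspaceT => v; exact: cvg_cst.
have cE : \int[mu]_(u in I) c = c.
  rewrite /Rintegral integral_cst //= lebesgue_measure_itv /= lte_fin ltrDl ltr01.
  by rewrite -EFinD -EFinM /= addrAC subrr add0r mulr1.
rewrite -[leLHS]cE -(rintegral_restrict _ sI).
apply: le_Rintegral; first exact: measurable_pos.
- exact: (rintg_restrict (@measurable_pos R) mI ic).
- exact: rintg_gamma.
move=> u; rewrite /= in_itv /= andbT => u0; rewrite indicE.
have [/set_mem|_] := boolP (u \in I); last by rewrite mul0r mulr_ge0 ?expR_ge0.
rewrite /I /= in_itv /= => /andP[Tu uT]; rewrite mul1r ler_pM ?expR_ge0 //.
  by rewrite ler_expR ler_wpM2l ?subr_ge0 // ler_ln ?posrE.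
by rewrite ler_expR lerN2.
Qed.

Lemma sum_inv_sqr_shift s n : 1 <= s ->
  \sum_(k < n) ((s + k%:R) ^+ 2)^-1 <= 2 / s.
Proof.
move=> s1; have s0 : 0 < s by apply: lt_le_trans s1.
suff h m : \sum_(k < m.+1) ((s + k%:R) ^+ 2)^-1 <= 2 / s - (s + m%:R)^-1.
  case: n => [|n]; first by rewrite big_ord0 divr_ge0 // ltW.
  by rewrite (le_trans (h n)) // gerBl invr_ge0 addr_ge0 // ltW.
elim: m => [|m IH].
  rewrite big_ord_recr big_ord0 /= add0r addr0 mulrDl mul1r addrK expr2 invfM.
  by rewrite ler_piMr ?invr_ge0 ?(ltW s0) // invf_le1.
rewrite big_ord_recr /=; apply: le_trans (lerD IH (lexx _)) _.
rewrite -addrA lerD2l -subr_ge0; have m0 := ler0n R m.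
have a0 : s + m%:R != 0 by rewrite gt_eqF // ltr_wpDr.
have a1 : s + (m%:R + 1) != 0 by rewrite gt_eqF // ltr_wpDr // addr_ge0.
have -> : - (s + m.+1%:R)^-1 - (- (s + m%:R)^-1 + ((s + m.+1%:R) ^+ 2)^-1) =
   ((s + m%:R) * (s + m.+1%:R) ^+ 2)^-1.
  by rewrite -natr1; field; rewrite a0 a1.
by rewrite invr_ge0 mulr_ge0 ?exprn_ge0 ?addr_ge0 // ltW.
Qed.

(* Termwise in the Gauss product: [|s+k+it|^2 <= (s+k)^2 exp(t^2/(s+k)^2)]. *)
Lemma rgamma_le_real s t : 1 <= s ->
  cabs (rgamma (s +i* t)) <= cabs (rgamma s%:C) * expR (t ^+ 2 / s).
Proof.
move=> s1; have s0 : 0 < s by apply: lt_le_trans s1.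
have h m : cabs (gaussp m (s +i* t)) <= cabs (gaussp m s%:C) * expR (t ^+ 2 / s).
  rewrite /gaussp [leLHS]cabsM [cabs (_ / _)]cabsM -[leRHS]mulrA [X in _ <= _ * X]mulrC [leRHS]mulrA.
  rewrite ler_wpM2r ?cabs_ge0 // cabsM [X in _ <= X * _]cabsM !cabs_cexp.
  have -> : complex.Re (- (ln m.+1%:R)%:C * (s +i* t)) =
      complex.Re (- (ln m.+1%:R)%:C * s%:C) by simpc.
  rewrite mulrAC ler_wpM2r ?expR_ge0 // !cabs_prod.
  apply: (@le_trans _ _ ((\prod_(i < m.+2) cabs (s%:C + i%:R)) *
      expR (\sum_(i < m.+2) t ^+ 2 / 2 * ((s + i%:R) ^+ 2)^-1))); last first.
    rewrite ler_wpM2l ?prodr_ge0 // => [i _|]; first exact: cabs_ge0.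
    rewrite ler_expR -mulr_sumr.
    apply: le_trans (ler_wpM2l _ (sum_inv_sqr_shift m.+2 s1)) _.
      by rewrite divr_ge0 ?sqr_ge0.
    by rewrite le_eqVlt; apply/orP; left; apply/eqP; field; rewrite gt_eqF.
  rewrite expR_sum -big_split /=; apply: ler_prod => i _; rewrite cabs_ge0 /=.
  have si : 0 < s + i%:R by rewrite ltr_wpDr.
  have e1 : s%:C + i%:R = (s + i%:R)%:C :> R[i] by rewrite rmorphD rmorph_nat.
  have e2 : (s +i* t) + i%:R = (s + i%:R) +i* t :> R[i].
    by rewrite -(rmorph_nat (real_complex R)); simpc.
  rewrite e1 e2 cabsR gtr0_norm // -(@ler_pXn2r _ 2) ?nnegrE ?mulr_ge0 ?cabs_ge0 ?expR_ge0 ?(ltW si) //.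
  rewrite cabs_sqr /= exprMn -expRM_natl.
  have -> : 2%:R * (t ^+ 2 / 2 * ((s + i%:R) ^+ 2)^-1) = t ^+ 2 / (s + i%:R) ^+ 2.
    by field; rewrite gt_eqF.
  have -> : (s + i%:R) ^+ 2 + t ^+ 2 = (s + i%:R) ^+ 2 * (1 + t ^+ 2 / (s + i%:R) ^+ 2).
    by field; rewrite gt_eqF.
  by rewrite ler_wpM2l ?sqr_ge0 // expR_ge1Dx.
have c1 := ccvg_cabs (gaussp_limit (s +i* t)).
have c2 : (fun m => cabs (gaussp m s%:C) * expR (t ^+ 2 / s)) @ \oo -->
    cabs (rgamma s%:C) * expR (t ^+ 2 / s).
  by apply: cvgMl; exact: ccvg_cabs (gaussp_limit s%:C).
by apply: (ler_cvg_to c1 c2); apply: nearW.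
Qed.

(** The defect is the integral over ]0, x[ divided by Gamma(z). In the sector t^2/s <= kappa^2 s, so
    every factor except 1/Gamma(s) is at most exponential in s, and a suitable [T] in
    [euler_gamma_ge] beats them all. *)
Lemma gratio_estimate x kappa : 0 < x -> 0 <= kappa ->
  exists2 C, 0 <= C & forall z, 1 <= complex.Re z ->
    `|complex.Im z| <= kappa * complex.Re z ->
    cabs (gratio x z - 1) <= C * expR (- complex.Re z).
Proof.
move=> x0 k0.
(* The three exponents come from x^s, from the comparison of 1/Gamma(s + it) with 1/Gamma(s), and
   from the decay e^(-s) that is to remain. *)
pose b := `|ln x| + kappa ^+ 2 + 1; pose T := expR b.
have b0 : 0 <= b by rewrite !addr_ge0 ?sqr_ge0.
have T1 : 1 <= T by rewrite -expR0 ler_expR.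
exists (2 * T * expR (T + 1)); first by rewrite !mulr_ge0 ?expR_ge0.
move=> z; case E : z => [s t] /= s1 ts.
have s0 : 0 < s by apply: lt_le_trans s1.
have z0 : 0 < complex.Re z by rewrite E.
have [G0 _] := gaussp_limit_right z0.
have -> : gratio x (s +i* t) - 1 = - ((euler_gamma z - igamma x z) * rgamma z).
  by rewrite /gratio -E mulrBl (rgamma_right z0) divff // opprB.
rewrite cabsN cabsM.
have h1 := gamma_split x0 z0; have ReE : complex.Re z = s by rewrite E.
rewrite ReE in h1.
have h2 := rgamma_le_real t s1; rewrite -E in h2.
have h3 := euler_gamma_ge T1 s1.
have h4 : cabs (rgamma s%:C) <= expR (- ((s - 1) * b)) * expR (T + 1).
  rewrite (rgamma_right (z := s%:C)) // cabsV -[leRHS]invrK.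
  rewrite lef_pV2 ?posrE ?invr_gt0 ?mulr_gt0 ?expR_gt0 //; last first.
    by apply: lt_le_trans h3; rewrite mulr_gt0 ?expR_gt0.
  by rewrite invfM -!expRN opprK; move: h3; rewrite /T expRK.
have t2 : t ^+ 2 / s <= kappa ^+ 2 * s.
  rewrite ler_pdivrMr // -[t ^+ 2]real_normK ?num_real //.
  have -> : kappa ^+ 2 * s * s = (kappa * s) ^+ 2 by ring.
  by rewrite lerXn2r // nnegrE ?mulr_ge0 // ltW.
apply: le_trans (ler_pM (cabs_ge0 _) (cabs_ge0 _) h1 h2) _.
have h5 : expR (s * ln x) / s <= expR (s * `|ln x|).
  rewrite ler_pdivrMr // -[leLHS]mulr1 ler_pM ?expR_ge0 // ler_expR.
  by rewrite ler_wpM2l ?(ltW s0) ?ler_norm.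
have h6 : expR (t ^+ 2 / s) <= expR (kappa ^+ 2 * s) by rewrite ler_expR.
apply: (@le_trans _ _ (2 * expR (s * `|ln x|) *
    (expR (- ((s - 1) * b)) * expR (T + 1) * expR (kappa ^+ 2 * s)))).
  apply: ler_pM; rewrite ?mulr_ge0 ?cabs_ge0 ?expR_ge0 ?invr_ge0 ?(ltW s0) //.
    by rewrite ler_wpM2l.
  by apply: ler_pM; rewrite ?cabs_ge0 ?expR_ge0.
rewrite le_eqVlt; apply/orP; left; apply/eqP.
have -> : 2 * expR (s * `|ln x|) * (expR (- ((s - 1) * b)) * expR (T + 1) * expR (kappa ^+ 2 * s)) =
  2 * expR (T + 1) * (expR (s * `|ln x|) * expR (- ((s - 1) * b)) * expR (kappa ^+ 2 * s)) by ring.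
have -> : 2 * T * expR (T + 1) * expR (- s) = 2 * expR (T + 1) * (T * expR (- s)) by ring.
by congr (_ * _); rewrite /T -!expRD; congr expR; rewrite /b; ring.
Qed.

End GammaRatioEstimate.

(** * Commuting matrices *)

Section Bicommutant.
Variables (R : realType) (N : nat) (S : seq 'M[R[i]]_N).
Hypothesis S_comm : forall F G, F \in S -> G \in S -> F *m G = G *m F.
Implicit Types (X Y Z : 'M[R[i]]_N).

(* Unlike the commutant, the bicommutant of a commuting family is commutative,
   and it is stable under inverses and under the functional calculus. *)
Definition bic X := forall Z, (forall F, F \in S -> F *m Z = Z *m F) -> X *m Z = Z *m X.

Lemma bic_mem F : F \in S -> bic F.
Proof. by move=> FS Z hZ; exact: hZ. Qed.

Lemma bic_comm X Y : bic X -> bic Y -> X *m Y = Y *m X.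
Proof.
move=> hX hY; apply: hX => F FS; apply/esym; apply: hY => G GS.
exact: S_comm.
Qed.

Lemma bicM X Y : bic X -> bic Y -> bic (X *m Y).
Proof. by move=> hX hY Z hZ; rewrite -mulmxA hY // mulmxA hX // mulmxA. Qed.

Lemma bicD X Y : bic X -> bic Y -> bic (X + Y).
Proof. by move=> hX hY Z hZ; rewrite mulmxDl mulmxDr hX // hY. Qed.

Lemma bic_scalar c : bic c%:M.
Proof. by move=> Z _; rewrite scalar_mxC. Qed.

Lemma bic_shift X c : bic X -> bic (X + c%:M).
Proof. by move=> hX; apply: bicD => //; exact: bic_scalar. Qed.

Lemma bic_inv X : bic X -> bic (invmx X).
Proof.
move=> hX Z hZ; have [uX|nX] := boolP (X \in unitmx); last first.
  by rewrite /invmx (negbTE nX) hX.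
by rewrite -[RHS](mulKmx uX) [X *m _]mulmxA hX // -[Z *m X *m _]mulmxA mulmxV // mulmx1.
Qed.

Lemma bic_prod (I : Type) (r : seq I) (F : I -> 'M[R[i]]_N) :
  (forall i, bic (F i)) -> bic (\prod_(i <- r) F i).
Proof.
move=> hF; apply: (big_ind bic) => [|X Y hX hY|i _] //; first exact: bic_scalar.
exact: bicM.
Qed.

Lemma bic_poch X n : bic X -> bic (mxpoch X n).
Proof. by move=> hX; apply: bic_prod => k; exact: bic_shift. Qed.

Lemma bic_rgamma X : bic X -> bic (mxrgamma X).
Proof. by move=> hX Z hZ; apply: mxrgamma_comm; exact: hX. Qed.

Lemma bic_gamma X : bic X -> bic (mxgamma X).
Proof. by move=> hX; apply: bic_inv; exact: bic_rgamma. Qed.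

Lemma prod_mul_bic (I : Type) (r : seq I) (F G : I -> 'M[R[i]]_N) :
  (forall i, bic (F i)) -> (forall i, bic (G i)) ->
  \prod_(i <- r) (F i *m G i) = (\prod_(i <- r) F i) *m (\prod_(i <- r) G i).
Proof.
move=> hF hG; elim: r => [|i r IH]; first by rewrite !big_nil -[RHS]/(1 * 1) mulr1.
rewrite !big_cons IH -![_ * _]/(_ *m _) -!mulmxA; congr (_ *m _); rewrite !mulmxA.
by rewrite (bic_comm (hG i)) //; exact: bic_prod.
Qed.

Lemma prod_unit (I : Type) (r : seq I) (F : I -> 'M[R[i]]_N) :
  (forall i, F i \in unitmx) -> \prod_(i <- r) F i \in unitmx.
Proof.
move=> hF; apply: (big_ind (fun X : 'M[R[i]]_N => X \in unitmx)) => //; first exact: unitmx1.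
by move=> X Y uX uY; rewrite -[_ * _]/(_ *m _) unitmx_mul uX.
Qed.

Lemma invmx_uniq X Y : X *m Y = 1%:M -> invmx X = Y.
Proof.
by move=> XY; have [uX _] := mulmx1_unit XY; rewrite -[RHS](mulKmx uX) XY mulmx1.
Qed.

Lemma invmx_mul_bic X Y : bic X -> bic Y -> X \in unitmx -> Y \in unitmx ->
  invmx (X *m Y) = invmx X *m invmx Y.
Proof.
move=> hX hY uX uY; apply: invmx_uniq.
by rewrite (bic_comm hX hY) mulmxA -[Y *m X *m _]mulmxA mulmxV // mulmx1 mulmxV.
Qed.

Lemma prod_invmx_bic (I : Type) (r : seq I) (F : I -> 'M[R[i]]_N) :
  (forall i, bic (F i)) -> (forall i, F i \in unitmx) ->
  \prod_(i <- r) invmx (F i) = invmx (\prod_(i <- r) F i).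
Proof.
move=> hF uF; elim: r => [|i r IH]; first by rewrite !big_nil; apply/esym; exact: invmx1.
rewrite !big_cons IH -![_ * _]/(_ *m _) invmx_mul_bic //; first exact: bic_prod.
exact: prod_unit.
Qed.

Lemma mxpochD X n l : mxpoch X (n + l) = mxpoch X n *m mxpoch (X + n%:R%:M) l.
Proof.
elim: l => [|l IH].
  by rewrite addn0 /mxpoch big_ord0 -[RHS]/(_ * 1) mulr1.
rewrite addnS !mxpochS IH -mulmxA; congr (_ *m (_ *m _)).
by rewrite natrD raddfD addrA.
Qed.

Definition wcoef r s (A : 'I_r -> 'M[R[i]]_N) (B : 'I_s -> 'M[R[i]]_N) l :=
  (\prod_(i < r) mxpoch (A i) l) *m invmx (\prod_(j < s) mxpoch (B j) l).

Section Coefficients.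
Variables (r s : nat) (A : 'I_r -> 'M[R[i]]_N) (B : 'I_s -> 'M[R[i]]_N).
Hypothesis bA : forall i, bic (A i).
Hypothesis bB : forall j, bic (B j).
Hypothesis uA : forall (i : 'I_r) (l : nat), A i + l%:R%:M \in unitmx.
Hypothesis uB : forall (j : 'I_s) (l : nat), B j + l%:R%:M \in unitmx.

(** (C)_(n+l) = (C)_n (C + n)_l for each parameter; the bicommutant supplies the commutations that
    regroup products and inverses. *)
Lemma wcoef_shift n l :
  wcoef A B n *m wcoef (mxshift A n) (mxshift B n) l = wcoef A B (n + l).
Proof.
rewrite /wcoef.
have bPA m : bic (\prod_(i < r) mxpoch (A i) m) by apply: bic_prod => i; exact: bic_poch.
have bPB m : bic (\prod_(i < s) mxpoch (B i) m) by apply: bic_prod => i; exact: bic_poch.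
have bPA' : bic (\prod_(i < r) mxpoch (mxshift A n i) l).
  by apply: bic_prod => i; apply: bic_poch; exact: bic_shift.
have bPB' : bic (\prod_(i < s) mxpoch (mxshift B n i) l).
  by apply: bic_prod => i; apply: bic_poch; exact: bic_shift.
have -> : \prod_(i < r) mxpoch (A i) (n + l) =
    (\prod_(i < r) mxpoch (A i) n) *m \prod_(i < r) mxpoch (mxshift A n i) l.
  rewrite -prod_mul_bic => [|i|i]; [|exact: bic_poch|by apply: bic_poch; exact: bic_shift].
  by apply: eq_bigr => i _; rewrite mxpochD.
have -> : \prod_(i < s) mxpoch (B i) (n + l) =
    (\prod_(i < s) mxpoch (B i) n) *m \prod_(i < s) mxpoch (mxshift B n i) l.
  rewrite -prod_mul_bic => [|i|i]; [|exact: bic_poch|by apply: bic_poch; exact: bic_shift].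
  by apply: eq_bigr => i _; rewrite mxpochD.
rewrite invmx_mul_bic //.
- rewrite -!mulmxA; congr (_ *m _); rewrite !mulmxA; congr (_ *m _).
  by apply: bic_comm => //; exact: bic_inv.
- by apply: prod_unit => i; exact: mxpoch_unit.
- by apply: prod_unit => i; apply: mxpoch_unit; exact: unit_shift.
Qed.

(** Gamma^(-1)(A_i) Gamma(A_i + n) is (A_i)_n, and Gamma(B_j) Gamma^(-1)(B_j + n) is the inverse of
    (B_j)_n; the rest is commutation. *)
Lemma gamma_prefactor n :
  (\prod_(j < s) mxgamma (B j)) *m (\prod_(i < r) mxrgamma (A i)) *m
    ((\prod_(i < r) mxgamma (A i + n%:R%:M)) *m (\prod_(j < s) mxrgamma (B j + n%:R%:M))) =
  wcoef A B n.
Proof.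
set GB := \prod_(j < s) mxgamma _; set RA := \prod_(i < r) mxrgamma _.
set GA := \prod_(i < r) mxgamma _; set RB := \prod_(j < s) mxrgamma _.
have e1 : RA *m GA = \prod_(i < r) mxpoch (A i) n.
  rewrite -prod_mul_bic => [|i|i]; [|exact: bic_rgamma|by apply: bic_gamma; exact: bic_shift].
  by apply: eq_bigr => i _; rewrite mxrgamma_gamma_shift.
have e2 : GB *m RB = invmx (\prod_(j < s) mxpoch (B j) n).
  rewrite -prod_mul_bic => [|i|i]; [|exact: bic_gamma|by apply: bic_rgamma; exact: bic_shift].
  rewrite -prod_invmx_bic => [|i|i]; [|exact: bic_poch|exact: mxpoch_unit].
  by apply: eq_bigr => i _; rewrite mxgamma_rgamma_shift.
rewrite /wcoef -e1 -e2.
have bGB : bic GB by apply: bic_prod => i; exact: bic_gamma.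
have bRA : bic RA by apply: bic_prod => i; exact: bic_rgamma.
have bGA : bic GA by apply: bic_prod => i; apply: bic_gamma; exact: bic_shift.
rewrite -!mulmxA; rewrite (bic_comm bGB (bicM bRA (bicM bGA _))); last first.
  by apply: bic_prod => i; apply: bic_rgamma; exact: bic_shift.
rewrite -!mulmxA; congr (_ *m (_ *m _)); apply: bic_comm => //.
by apply: bic_prod => i; apply: bic_rgamma; exact: bic_shift.
Qed.

End Coefficients.
End Bicommutant.

(** * Spectral decomposition of the identity *)

Section SpectralPartition.
Variables (R : realType) (n : nat) (P : 'M[R[i]]_n.+1).
Implicit Types (p : {poly R[i]}) (E Z : 'M[R[i]]_n.+1).

Definition mx_central E := forall Z, P *m Z = Z *m P -> E *m Z = Z *m E.

Lemma mx_central_horner p : mx_central (horner_mx P p).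
Proof.
by move=> Z PZ; apply/esym/comm_mx_horner/esym.
Qed.

Lemma mx_centralM E F : mx_central E -> mx_central F -> mx_central (E *m F).
Proof. by move=> hE hF Z hZ; rewrite -mulmxA hF // mulmxA hE // mulmxA. Qed.

(* Bezout splits off one root of the annihilating polynomial at a time. *)
Lemma primary_splitting p E : p != 0 -> p %| char_poly P -> mx_central E ->
  horner_mx P p *m E = 0 ->
  exists (t : seq (R[i] * 'M[R[i]]_n.+1)) (m : nat), E = \sum_(a <- t) a.2 /\
    forall a, a \in t -> [/\ eigenvalue P a.1, mx_central a.2 &
      (P - a.1%:M) ^+ m *m a.2 = 0].
Proof.
have [k] := ubnP (size p); elim: k p E => // k IH p E; rewrite ltnS => sp p0 pc cE pE.
have [/eqP/size_poly1P[c c0 pc']|sp1] := eqVneq (size p) 1%N.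
  exists [::], 0%N; rewrite big_nil; split => //.
  move: pE; rewrite pc' horner_mx_C mul_scalar_mx => /eqP.
  by rewrite scaler_eq0 (negbTE c0) => /eqP.
have [a ra] := closed_rootP _ sp1.
have [q [m [nqa pq]]] : exists q m, ~~ root q a /\ p = q * ('X - a%:P) ^+ m.
  have [m [q nq ->]] := multiplicity_XsubC p a.
  by exists q, m; split => //; move: nq; rewrite p0.
have q0 : q != 0 by apply: contraNneq nqa => ->; rewrite root0.
have cop : coprimep (('X - a%:P) ^+ m) q.
  by rewrite coprimep_expl // coprimep_sym coprimep_XsubC.
have /Bezout_coprimepP[[u v] /= uv] := cop.
have {uv} [u' [v' uv]] : exists u' v', u' * ('X - a%:P) ^+ m + v' * q = 1.
  have := uv; rewrite -size_poly_eq1 => /size_poly1P[c c0 e].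
  exists (c^-1 *: u), (c^-1 *: v); rewrite -!scalerAl -scalerDr e.
  by rewrite -mul_polyC -polyCM mulVf.
have m0 : (0 < m)%N.
  by rewrite lt0n; apply: contraNneq nqa => m0; move: ra; rewrite pq m0 expr0 mulr1.
pose E1 := horner_mx P (u' * ('X - a%:P) ^+ m) *m E.
pose E2 := horner_mx P (v' * q) *m E.
have EE : E = E2 + E1.
  by rewrite /E1 /E2 -mulmxDl -rmorphD /= addrC uv rmorph1 mul1mx.
have cE1 : mx_central E1 by apply: mx_centralM => //; exact: mx_central_horner.
have cE2 : mx_central E2 by apply: mx_centralM => //; exact: mx_central_horner.
have qE1 : horner_mx P q *m E1 = 0.
  rewrite /E1 mulmxA -[horner_mx P q *m _]/(horner_mx P q * _) -rmorphM /=.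
  have -> : q * (u' * ('X - a%:P) ^+ m) = u' * p by rewrite pq; ring.
  by rewrite rmorphM /= -[_ * horner_mx P p]/(_ *m _) -mulmxA pE mulmx0.
have aE2 : (P - a%:M) ^+ m *m E2 = 0.
  have -> : (P - a%:M) ^+ m = horner_mx P (('X - a%:P) ^+ m).
    by rewrite rmorphXn rmorphB /= horner_mx_X horner_mx_C.
  rewrite /E2 mulmxA -[horner_mx P _ *m horner_mx P _]/(horner_mx P _ * _) -rmorphM /=.
  have -> : ('X - a%:P) ^+ m * (v' * q) = v' * p by rewrite pq; ring.
  by rewrite rmorphM /= -[_ * horner_mx P p]/(_ *m _) -mulmxA pE mulmx0.
have ea : eigenvalue P a.
  by rewrite eigenvalue_root_char -dvdp_XsubCl (dvdp_trans _ pc) // dvdp_XsubCl.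
have sq : (size q < k)%N.
  apply: leq_trans sp; rewrite pq size_mul ?expf_neq0 ?polyXsubC_eq0 //.
  by rewrite size_exp_XsubC addnS /= -[X in (X < _)%N]addn0 ltn_add2l.
have qc : q %| char_poly P by apply: dvdp_trans pc; rewrite pq dvdp_mulr.
have [t [m' [tE ht]]] := IH q E1 sq q0 qc cE1 qE1.
exists ((a, E2) :: t), (maxn m m'); split; first by rewrite big_cons /= -tE.
move=> b; rewrite inE => /orP[/eqP ->|/ht [h1 h2 h3]] /=.
  split; [exact: ea|exact: cE2|].
  by rewrite -(subnK (leq_maxl m m')) exprD -[_ * _]/(_ *m _) -mulmxA aE2 mulmx0.
split; [exact: h1|exact: h2|].
by rewrite -(subnK (leq_maxr m m')) exprD -[_ * _]/(_ *m _) -mulmxA h3 mulmx0.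
Qed.

(** Cayley-Hamilton starts the splitting at the identity. The summands play the role of the spectral
    projections of [P]; only their sum, commutation and annihilation properties are recorded. *)
Lemma spectral_partition :
  exists (t : seq (R[i] * 'M[R[i]]_n.+1)) (m : nat), 1%:M = \sum_(a <- t) a.2 /\
    forall a, a \in t -> [/\ eigenvalue P a.1, mx_central a.2 &
      (P - a.1%:M) ^+ m *m a.2 = 0].
Proof.
apply: (@primary_splitting (char_poly P)) => //.
- by rewrite monic_neq0 // char_poly_monic.
- by move=> Z _; rewrite mul1mx mulmx1.
- by rewrite Cayley_Hamilton mul0mx.
Qed.

End SpectralPartition.

(** * Growth of the coefficients *)

Section GammaRatioGrowth.
Variables (R : realType) (n : nat).
Local Notation N := n.+1.
Implicit Types (P Q X Y Z E F U V : 'M[R[i]]_n.+1).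

Definition polyb (u : nat -> 'M[R[i]]_n.+1) :=
  exists2 K : R, 0 <= K & exists m, forall l, mxn (u l) <= K * l.+1%:R ^+ m.

Lemma polyb_near u (l0 m : nat) (K : R) : 0 <= K ->
  (forall l, (l0 <= l)%N -> mxn (u l) <= K * l.+1%:R ^+ m) -> polyb u.
Proof.
move=> K0 h; exists (K + \sum_(k < l0) mxn (u k)).
  by rewrite addr_ge0 // sumr_ge0 // => k _; exact: mxn_ge0.
exists m => l; have e1 : 1 <= l.+1%:R ^+ m :> R by rewrite exprn_ege1 // ler1n.
have s0 : 0 <= \sum_(k < l0) mxn (u k) by rewrite sumr_ge0 // => k _; exact: mxn_ge0.
rewrite mulrDl; have [l0l|ll0] := leqP l0 l.
  by rewrite (le_trans (h l l0l)) // lerDl mulr_ge0 // (le_trans _ e1).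
rewrite ler_wpDl ?mulr_ge0 ?(le_trans _ e1) //.
rewrite -[leLHS]mulr1 ler_pM ?mxn_ge0 //.
by rewrite (bigD1 (Ordinal ll0)) //= lerDl sumr_ge0 // => k _; exact: mxn_ge0.
Qed.

Lemma polybD u v : polyb u -> polyb v -> polyb (fun l => u l + v l).
Proof.
move=> [K K0 [m hK]] [L L0 [k hL]]; apply: (@polyb_near _ 0 (m + k) (K + L)).
  by rewrite addr_ge0.
move=> l _; apply: le_trans (mxnD _ _) _; rewrite mulrDl; apply: lerD.
  apply: le_trans (hK l) _; rewrite ler_wpM2l // exprD ler_peMr ?exprn_ge0 //.
  by rewrite exprn_ege1 // ler1n.
apply: le_trans (hL l) _; rewrite ler_wpM2l // exprD ler_peMl ?exprn_ge0 //.
by rewrite exprn_ege1 // ler1n.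
Qed.

Lemma polyb_sum (I : eqType) (r : seq I) (G : I -> nat -> 'M[R[i]]_n.+1) :
  (forall a, a \in r -> polyb (G a)) -> polyb (fun l => \sum_(a <- r) G a l).
Proof.
elim: r => [|a r IH] h.
  by apply: (@polyb_near _ 0 0 0) => // l _; rewrite big_nil mxn0 mul0r.
have -> : (fun l => \sum_(b <- a :: r) G b l) = (fun l => G a l + \sum_(b <- r) G b l).
  by apply/funext => l; rewrite big_cons.
apply: polybD; first by apply: h; rewrite mem_head.
by apply: IH => b br; apply: h; rewrite in_cons br orbT.
Qed.

Lemma mxn_sum k (G : 'I_k -> 'M[R[i]]_n.+1) :
  mxn (\sum_(a < k) G a) <= \sum_(a < k) mxn (G a).
Proof.
elim/big_ind2: _ => [|X x Y y hX hY|//]; first by rewrite mxn0.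
by rewrite (le_trans (mxnD _ _)) // lerD.
Qed.

Lemma mxn_exp_mul X E k : mxn (X ^+ k *m E) <= mxn X ^+ k * mxn E.
Proof.
elim: k => [|k IH]; first by rewrite !expr0 mul1mx mul1r.
rewrite !exprS -[X * _]/(_ *m _) -mulmxA -mulrA; apply: le_trans (mxnM _ _) _.
by rewrite ler_wpM2l ?mxn_ge0.
Qed.

(** In the binomial expansion with exponent at least 2m, one of the two powers reaches m. Powers of
    [V] have to pass [E] to meet [F], whence the commutation asked of them. *)
Lemma comm_nilpotent U V E F m k : U *m V = V *m U -> V *m E = E *m V ->
  U ^+ m *m E = 0 -> V ^+ m *m F = 0 -> (m + m <= k)%N ->
  (U + V) ^+ k *m (E *m F) = 0.
Proof.
move=> UV VE hU hV mk.
have cVE j : V ^+ j *m E = E *m V ^+ j.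
  by apply/esym; have : GRing.comm E (V ^+ j) by apply: commrX; exact/esym.
rewrite (@exprDn_comm _ U V k UV) mulmx_suml big1 // => i _.
have -> : U ^+ (k - i) * V ^+ i *+ 'C(k, i) *m (E *m F) =
   (U ^+ (k - i) *m E *m (V ^+ i *m F)) *+ 'C(k, i).
  rewrite -[LHS]/(_ * _) mulrnAl -![_ * _]/(_ *m _); congr (_ *+ _).
  by rewrite !mulmxA -[U ^+ _ *m V ^+ i *m E]mulmxA cVE !mulmxA.
have [mi|im] := leqP m i.
  rewrite -(subnK mi) exprD -[_ * V ^+ m]/(_ *m _) -(mulmxA _ (V ^+ m)) hV.
  by rewrite !mulmx0 mul0rn.
have mki : (m <= k - i)%N.
  have ik : (i <= k)%N by rewrite -ltnS.
  by rewrite leq_subRL // (leq_trans _ mk) // leq_add2r ltnW.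
rewrite -(subnK mki) exprD -[_ * U ^+ m]/(_ *m _) -(mulmxA _ (U ^+ m) E) hU.
by rewrite mulmx0 mul0mx mul0rn.
Qed.

Lemma Re_natM (l : nat) (p : R[i]) : complex.Re (l%:R * p) = l%:R * complex.Re p.
Proof. by rewrite -(rmorph_nat (real_complex R)); case: p => a b /=; rewrite mul0r subr0. Qed.

Lemma Im_natM (l : nat) (p : R[i]) : complex.Im (l%:R * p) = l%:R * complex.Im p.
Proof. by rewrite -(rmorph_nat (real_complex R)); case: p => a b /=; rewrite mul0r addr0. Qed.

(** [eta] allows for the unit circle of Cauchy's estimate around l p + q. The slope arises from |Im
    w| <= l |p| + |q| + 1 <= l (|p| + d) against Re w >= l d. *)
Lemma sector_of_progression (p q : R[i]) : 0 < complex.Re p ->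
  exists (l0 : nat) (kappa delta : R), [/\ 0 <= kappa, 0 < delta & forall l eta,
    (l0 <= l)%N -> cabs eta <= 1 -> let w := l%:R * p + q + eta in
    [/\ 1 <= complex.Re w, `|complex.Im w| <= kappa * complex.Re w &
        l%:R * delta <= complex.Re w]].
Proof.
move=> p0; pose d := complex.Re p / 2; have d0 : 0 < d by rewrite divr_gt0.
(* For l > L both l d >= |q| + 1 and l d >= 1: the first leaves Re w >= l d out of l Re p = 2 l d,
   the second makes this at least 1. *)
pose L := (cabs q + 1) / d + 1 / d.
exists (Num.truncn L).+1, ((cabs p + d) / d), d; split => //.
  by rewrite divr_ge0 ?addr_ge0 ?cabs_ge0 // ltW.
move=> l eta hl e1 w.
have Ll : L < l%:R by apply: lt_le_trans (truncnS_gt L) _; rewrite ler_nat.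
have q0 := cabs_ge0 q.
have L1 : (cabs q + 1) / d <= L by rewrite lerDl divr_ge0 // ltW.
have L2 : 1 / d <= L by rewrite lerDr divr_ge0 ?(ltW d0) // addr_ge0.
have h1 : cabs q + 1 <= l%:R * d.
  by rewrite -ler_pdivrMr // (le_trans L1) // ltW.
have h2 : 1 <= l%:R * d by rewrite -ler_pdivrMr // (le_trans L2) // ltW.
have ReE : complex.Re w = l%:R * complex.Re p + complex.Re q + complex.Re eta.
  by rewrite /w !raddfD /= Re_natM.
have ImE : complex.Im w = l%:R * complex.Im p + complex.Im q + complex.Im eta.
  by rewrite /w !raddfD /= Im_natM.
have Rq : - cabs q <= complex.Re q by have := cabs_Re q; rewrite ler_norml => /andP[].
have Re' : - 1 <= complex.Re eta.
  by have := le_trans (cabs_Re eta) e1; rewrite ler_norml => /andP[].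
have pd : complex.Re p = d + d by rewrite /d; field.
have h3 : l%:R * d <= complex.Re w by rewrite ReE pd mulrDr; lra.
split => //; first exact: le_trans h3.
apply: (@le_trans _ _ (l%:R * (cabs p + d))); last first.
  have -> : l%:R * (cabs p + d) = (cabs p + d) / d * (l%:R * d) by field; rewrite gt_eqF.
  by rewrite ler_wpM2l // divr_ge0 ?addr_ge0 ?cabs_ge0 // ltW.
rewrite ImE; apply: le_trans (ler_normD _ _) _; apply: le_trans (lerD (ler_normD _ _) (lexx _)) _.
have := cabs_Im q; have := le_trans (cabs_Im eta) e1.
have : `|l%:R * complex.Im p| <= l%:R * cabs p.
  by rewrite normrM normr_nat ler_wpM2l // cabs_Im.
rewrite mulrDr; lra.
Qed.

Variable x : R.
Hypothesis x_gt0 : 0 < x.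

Definition gterm P Q (l : nat) : 'M[R[i]]_n.+1 :=
  mxigamma (l%:R *: P + Q) x *m mxrgamma (l%:R *: P + Q).

(* On a joint generalized eigenspace, [gterm] is a polynomial of degree < 2m in
   the nilpotent part of [l P + Q], with coefficients bounded by Cauchy's
   estimate on a unit circle around [l p + q]. *)
Lemma gterm_block_bound P Q (p q : R[i]) E F m : P *m Q = Q *m P ->
  mx_central P E -> 0 < complex.Re p ->
  (P - p%:M) ^+ m *m E = 0 -> (Q - q%:M) ^+ m *m F = 0 ->
  polyb (fun l => gterm P Q l *m (E *m F)).
Proof.
move=> PQ cE p0 hE hF.
have [l0 [kappa [delta [k0 d0 sec]]]] := sector_of_progression q p0.
have [C C0 hC] := gratio_estimate x_gt0 k0.
have [g [eg hg hgM]] := gratio_calculus x_gt0.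
pose U := P - p%:M; pose V := Q - q%:M.
pose K0 := mxn U + mxn V.
have K00 : 0 <= K0 by rewrite addr_ge0 ?mxn_ge0.
have UV : U *m V = V *m U.
  rewrite /U /V !(mulmxBl, mulmxBr) PQ -!(scalar_mxC _ P) -!(scalar_mxC _ Q).
  by rewrite (scalar_mxC p q%:M) !opprB [LHS]addrACA [RHS]addrACA [X in _ = _ + X]addrC.
have VE : V *m E = E *m V.
  have h : Q *m E = E *m Q by apply/esym; exact: cE.
  by rewrite /V mulmxBl mulmxBr h scalar_mxC.
apply: (@polyb_near _ l0 (m + m) ((m + m)%:R * (2 * (1 + C)) * (1 + K0) ^+ (m + m) * mxn (E *m F))).
  have C10 : 0 <= 1 + C by rewrite addr_ge0.
  have K10 : 0 <= 1 + K0 by rewrite addr_ge0.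
  by rewrite !mulr_ge0 ?exprn_ge0 ?mxn_ge0 ?ler0n.
(* [w] is the eigenvalue of l P + Q on this block and [T] its nilpotent part: T^(2m) annihilates
   [E *m F]. *)
move=> l hl; pose w := l%:R * p + q; pose T := l%:R *: U + V.
have TE : l%:R *: P + Q = T + w%:M.
  rewrite /w (raddfD (@scalar_mx _ _)) /= addrACA -scale_scalar_mx -scalerDr.
  by rewrite /U /V !subrK.
have [d [hd ed]] := entire_taylor w eg.
have dT : mxpsum d T (gterm P Q l).
  by apply: (mxpsum_recenter eg hd); rewrite -TE; exact: hgM.
have hdz z : psum d z (gratio x (w + z)).
  have h0 : 0 <= cabs w + cabs z + 1 by rewrite !addr_ge0 ?cabs_ge0.
  have [|s [h1 h2]] := psum_recenter (h := z) hd (eg _ h0); first by rewrite ltrDl.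
  by rewrite -(cseries_unique h1 (hg _)).
(* On |z| = 1 the point w + z stays in the sector, so the ratio is at most 1 + C there, uniformly in
   [l]. *)
have dB k : cabs (d k) <= 2 * (1 + C).
  have := @cauchy_estimate R d (fun z => gratio x (w + z)) 1 (1 + C) k ltr01 ed hdz.
  rewrite expr1n mulr1; apply => z z1.
  have z1' : cabs z <= 1 by rewrite z1.
  have [h1 h2 _] := sec l z hl z1'.
  rewrite -[gratio x _](subrK 1) (le_trans (cabsD _ _)) // cabs1 addrC lerD2l.
  apply: le_trans (hC _ h1 h2) _; rewrite ler_piMr // -expR0 ler_expR oppr_le0.
  exact: le_trans h1.
have fin : gterm P Q l *m (E *m F) = \sum_(k < m + m) d k *: (T ^+ k *m (E *m F)).
  apply/matrixP => i j.
  apply: (ccvg_unique (ccvg_mulmxr_entry (E *m F) i j (mxpsum_partial dT))).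
  apply: (@ccvg_near _ (fun=> (\sum_(k < m + m) d k *: (T ^+ k *m (E *m F))) i j)); last exact: ccvg_cst.
  exists (m + m)%N => k mk; congr (fun_of_matrix _ i j).
  rewrite mulmx_suml -(subnKC mk) [RHS]big_split_ord /= [X in _ + X]big1 ?addr0.
    by apply: eq_bigr => a _; rewrite scalemxAl.
  move=> a _; rewrite -scalemxAl.
  have -> : T ^+ (m + m + a) *m (E *m F) = 0; last by rewrite scaler0.
  apply: (@comm_nilpotent (l%:R *: U) V E F m _ _ VE _ hF (leq_addr _ _)).
    by rewrite -scalemxAl -scalemxAr UV.
  by rewrite exprZn -scalemxAl hE scaler0.
rewrite fin.
have l1 : 1 <= l.+1%:R :> R by rewrite ler1n.
have TK : mxn T <= (1 + K0) * l.+1%:R.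
  apply: le_trans (mxnD _ _) _; rewrite mxnZ cabs_nat.
  have := mxn_ge0 U; have := mxn_ge0 V; rewrite /K0 => v0 u0.
  have h1 : l%:R * mxn U <= l.+1%:R * mxn U by rewrite ler_wpM2r // ler_nat.
  have h2 : mxn V <= l.+1%:R * mxn V by rewrite ler_peMl.
  by rewrite [leRHS]mulrC; move: h1 h2; lra.
have TK1 : 1 <= (1 + K0) * l.+1%:R by rewrite mulr_ege1 // lerDl.
apply: (le_trans (mxn_sum (fun k : 'I_(m + m) => d k *: (T ^+ k *m (E *m F))))).
apply: (@le_trans _ _ (\sum_(k < m + m) 2 * (1 + C) * (((1 + K0) * l.+1%:R) ^+ (m + m) * mxn (E *m F)))).
  apply: ler_sum => k _; rewrite mxnZ; apply: ler_pM; rewrite ?cabs_ge0 ?mxn_ge0 //.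
  apply: le_trans (mxn_exp_mul _ _ _) _; rewrite ler_wpM2r ?mxn_ge0 //.
  apply: (@le_trans _ _ (((1 + K0) * l.+1%:R) ^+ k)).
    by rewrite lerXn2r ?nnegrE ?mxn_ge0 // (le_trans _ TK1).
  by rewrite ler_weXn2l // ltnW.
rewrite sumr_const card_ord -mulr_natl exprMn le_eqVlt; apply/orP; left; apply/eqP; ring.
Qed.

(** Inserting the partitions of the identity belonging to [P] and to [Q] reduces to blocks; the
    larger of the two nilpotency exponents serves both. *)
Lemma gterm_polyb P Q : P *m Q = Q *m P -> pos_spectrum P ->
  polyb (gterm P Q).
Proof.
move=> PQ hP.
have [t [m [tE ht]]] := spectral_partition P.
have [t' [m' [tE' ht']]] := spectral_partition Q.
have -> : gterm P Q = fun l => \sum_(a <- t) \sum_(b <- t') gterm P Q l *m (a.2 *m b.2).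
  apply/funext => l; under eq_bigr do rewrite -mulmx_sumr -mulmx_sumr -tE' mulmx1.
  by rewrite -mulmx_sumr -tE mulmx1.
apply: polyb_sum => a /ht [ea ca na]; apply: polyb_sum => b /ht' [eb cb nb].
apply: (@gterm_block_bound P Q a.1 b.1 _ _ (maxn m m')) => //; first exact: hP.
  by rewrite -(subnK (leq_maxl m m')) exprD -[_ * _]/(_ *m _) -mulmxA na mulmx0.
by rewrite -(subnK (leq_maxr m m')) exprD -[_ * _]/(_ *m _) -mulmxA nb mulmx0.
Qed.

(** The functional calculus is scalar on a common eigenvector, and there the ratio tends to 1; any
    positive constant below 1 could replace 1/2. *)
Lemma gterm_eigen P Q (v : 'rV[R[i]]_n.+1) (p q : R[i]) :
  v *m P = p *: v -> v *m Q = q *: v -> 0 < complex.Re p ->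
  exists2 gam : nat -> R[i], forall l, v *m gterm P Q l = gam l *: v &
    exists l0, forall l, (l0 <= l)%N -> 1 / 2 <= cabs (gam l).
Proof.
move=> vP vQ p0.
have [l0 [kappa [delta [k0 d0 sec]]]] := sector_of_progression q p0.
have [C C0 hC] := gratio_estimate x_gt0 k0.
have [g [eg hg hgM]] := gratio_calculus x_gt0.
exists (fun l => gratio x (l%:R * p + q)).
  move=> l; apply: (mxpsum_eigen (hgM _ _) _ (hg _)).
  by rewrite mulmxDr -scalemxAr vP vQ scalerA scalerDl.
exists (maxn l0 (Num.truncn (2 * C / delta)).+1) => l; rewrite geq_max => /andP[hl hl'].
have c01 : cabs (0 : R[i]) <= 1 by rewrite cabs0.
have [h1 h2 h3] := sec l 0 hl c01; rewrite addr0 in h1 h2 h3.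
set w := l%:R * p + q in h1 h2 h3 *.
have h4 := hC _ h1 h2.
(* As e^(-Re w) <= 1/(1 + Re w) and Re w >= l delta, this makes the defect at most 1/2. *)
have ld : 2 * C <= l%:R * delta.
  rewrite -ler_pdivrMr // ltW //; apply: lt_le_trans (truncnS_gt _) _.
  by rewrite ler_nat.
have h5 : C * expR (- complex.Re w) <= 1 / 2.
  rewrite expRN ler_pdivrMr ?expR_gt0 //.
  have := expR_ge1Dx (complex.Re w); lra.
have := cabs_sub_ge 1 (1 - gratio x w); rewrite subKr cabs1 cabsB; lra.
Qed.

End GammaRatioGrowth.

(** * Growth of the Pochhammer quotients *)

Section HypergeometricGrowth.
Variable R : realType.

Lemma eventually_nonincreasing_bounded (t : nat -> R) l0 :
  (forall l, (l0 <= l)%N -> t l.+1 <= t l) -> exists B, forall l, t l <= B.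
Proof.
move=> ht; exists (`|t l0| + \sum_(k < l0) `|t k|) => l.
have s0 : 0 <= \sum_(k < l0) `|t k| by exact: sumr_ge0.
have [l0l|ll0] := leqP l0 l; last first.
  rewrite (le_trans (ler_norm _)) // (bigD1 (Ordinal ll0)) //= addrCA lerDl.
  by rewrite addr_ge0 // sumr_ge0.
rewrite ler_wpDr //; apply: le_trans (ler_norm (t l0)).
rewrite -(subnK l0l); elim: (l - l0)%N => // k IH.
by rewrite addSn (le_trans (ht _ _)) // leq_addl.
Qed.

(** Bernoulli: ((l+1)/(l+2))^m >= 1 - m/(l+2). A strict contraction can therefore absorb any
    polynomial weight. *)
Lemma succ_pow_ratio (theta : R) m : theta < 1 ->
  exists l0, forall l, (l0 <= l)%N -> theta * l.+2%:R ^+ m <= l.+1%:R ^+ m.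
Proof.
move=> th1; have th0 : 0 < 1 - theta by rewrite subr_gt0.
exists (Num.truncn (m%:R / (1 - theta))).+1 => l hl.
have l2 : 0 < l.+2%:R :> R by rewrite ltr0n.
have hm : m%:R <= (1 - theta) * l.+2%:R.
  rewrite mulrC -ler_pdivrMr // ltW // (lt_trans (truncnS_gt _)) // ltr_nat.
  by rewrite (leq_ltn_trans hl).
have bern k : 1 - k%:R / l.+2%:R <= (l.+1%:R / l.+2%:R) ^+ k :> R.
  have e1 : l.+1%:R / l.+2%:R = 1 - l.+2%:R^-1 :> R.
    by rewrite -[in X in X / _](addrK 1 l.+1%:R) natr1 mulrBl divff ?gt_eqF // mul1r.
  have i0 : 0 <= l.+2%:R^-1 :> R by rewrite invr_ge0 ltW.
  have i1 : l.+2%:R^-1 <= 1 :> R by rewrite invf_le1 // ler1n.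
  elim: k => [|k IH]; first by rewrite mul0r subr0 expr0.
  rewrite exprS; apply: (@le_trans _ _ (l.+1%:R / l.+2%:R * (1 - k%:R / l.+2%:R))).
    rewrite e1 -natr1 mulrDl mul1r.
    have : 0 <= l.+2%:R^-1 * (k%:R / l.+2%:R) :> R by rewrite !mulr_ge0.
    by move: (_^-1) => a; nra.
  by rewrite ler_wpM2l // divr_ge0 // ltW.
rewrite -ler_pdivlMr ?exprn_gt0 // -expr_div_n; apply: le_trans (bern m).
by rewrite lerBrDr addrC -lerBrDr ler_pdivrMr.
Qed.

Lemma eigen_le_mxn N (v : 'rV[R[i]]_N) X (w : R[i]) : v != 0 -> v *m X = w *: v ->
  cabs w <= mxn X.
Proof.
move=> v0 vX.
have s0 : 0 < \sum_j cabs (v 0 j).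
  have [j vj] := rV0Pn _ v0.
  by rewrite (bigD1 j) //= ltr_pwDl ?cabs_gt0 // sumr_ge0 // => k _; exact: cabs_ge0.
rewrite -(ler_pM2r s0) [leRHS]mulr_sumr mulr_sumr.
apply: (@le_trans _ _ (\sum_j \sum_k cabs (v 0 k) * cabs (X k j))).
  apply: ler_sum => j _; rewrite -cabsM.
  have -> : w * v 0 j = \sum_k v 0 k * X k j.
    by have := congr1 (fun u : 'rV_N => u 0 j) vX; rewrite !mxE => <-.
  by apply: le_trans (cabs_sum _ _ _) _; apply: ler_sum => k _; rewrite cabsM.
rewrite exchange_big /=; apply: ler_sum => k _; rewrite -mulr_sumr mulrC.
by rewrite ler_wpM2r ?cabs_ge0 ?row_le_mxn.
Qed.

Section NearOne.
Variable n : nat.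
Implicit Types (u v : nat -> 'M[R[i]]_n.+1).

(** The rate 1/l is recorded because convergence to 1 alone would not decide the case r = s + 1, |y|
    = 1, where the correction K/l is set against the binomial weights. *)
Definition near_one u :=
  exists2 K : R, 0 <= K & forall l, mxn (u l - 1%:M) <= K / l.+1%:R.

Lemma near_one_eventually u l0 (K : R) : 0 <= K ->
  (forall l, (l0 <= l)%N -> mxn (u l - 1%:M) <= K / l.+1%:R) -> near_one u.
Proof.
move=> K0 h; exists (K + \sum_(k < l0) mxn (u k - 1%:M) * k.+1%:R).
  by rewrite addr_ge0 // sumr_ge0 // => k _; rewrite mulr_ge0 ?mxn_ge0.
move=> l; have l1 : 0 < l.+1%:R :> R by rewrite ltr0n.
rewrite ler_pdivlMr //; have [l0l|ll0] := leqP l0 l.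
  rewrite ler_wpDr -?ler_pdivlMr ?h // sumr_ge0 // => k _.
  by rewrite mulr_ge0 ?mxn_ge0.
rewrite (bigD1 (Ordinal ll0)) //= addrCA lerDl addr_ge0 // sumr_ge0 // => k _.
by rewrite mulr_ge0 ?mxn_ge0.
Qed.

Lemma near_oneM u v : near_one u -> near_one v -> near_one (fun l => u l *m v l).
Proof.
move=> [K K0 hK] [L L0 hL]; exists (K * L + (K + L)).
  by rewrite !addr_ge0 // mulr_ge0.
move=> l; have l1 : 0 < l.+1%:R :> R by rewrite ltr0n.
have -> : u l *m v l - 1%:M =
    (u l - 1%:M) *m (v l - 1%:M) + ((u l - 1%:M) + (v l - 1%:M)).
  rewrite mulmxBl !mulmxBr !mulmx1 mul1mx; move: (u l *m v l) => w.
  by apply/matrixP => i j; rewrite !mxE; ring.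
rewrite mulrDl mulrDl; apply: le_trans (mxnD _ _) _; apply: lerD; last first.
  by apply: le_trans (mxnD _ _) _; exact: lerD.
apply: le_trans (mxnM _ _) _.
apply: (@le_trans _ _ (K / l.+1%:R * (L / l.+1%:R))).
  by apply: ler_pM; rewrite ?mxn_ge0.
rewrite mulrACA mulrA ler_piMr //; last by rewrite invf_le1 // ler1n.
by rewrite !mulr_ge0 // invr_ge0 ltW.
Qed.

Lemma near_one_prod (I : Type) (t : seq I) (F : I -> nat -> 'M[R[i]]_n.+1) :
  (forall i, near_one (F i)) -> near_one (fun l => \prod_(i <- t) F i l).
Proof.
move=> hF; elim: t => [|i t IH].
  by exists 0 => // l; rewrite big_nil subrr mxn0 mul0r.
have [K K0 hK] := near_oneM (hF i) IH; exists K => // l.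
by rewrite big_cons; exact: hK.
Qed.

(** From u^(-1) - 1 = -(u - 1)(u^(-1) - 1) - (u - 1): once [mxn] of u - 1 is at most 1/2, the first
    term is absorbed on the left, which doubles the constant. *)
Lemma near_oneV u : (forall l, u l \in unitmx) -> near_one u ->
  near_one (fun l => invmx (u l)).
Proof.
move=> uu [K K0 hK]; apply: (@near_one_eventually _ (Num.truncn (2 * K)).+1 (2 * K)).
  by rewrite mulr_ge0.
move=> l hl; have l1 : 0 < l.+1%:R :> R by rewrite ltr0n.
have e : K / l.+1%:R <= 1 / 2.
  have h1 : 2 * K <= l.+1%:R by rewrite ltW // (lt_trans (truncnS_gt _)) // ltr_nat.
  by rewrite ler_pdivrMr //; lra.
have eV : invmx (u l) - 1%:M = - ((u l - 1%:M) *m (invmx (u l) - 1%:M)) - (u l - 1%:M).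
  rewrite mulmxBl !mulmxBr mulmx1 mul1mx mulmxV // mul1mx.
  by apply/matrixP => i j; move: (invmx _) => w; rewrite !mxE; ring.
have : mxn (invmx (u l) - 1%:M) <= K / l.+1%:R * mxn (invmx (u l) - 1%:M) + K / l.+1%:R.
  rewrite {1}eV; apply: le_trans (mxnD _ _) _; rewrite !mxnN; apply: lerD => //.
  by apply: le_trans (mxnM _ _) _; rewrite ler_wpM2r ?mxn_ge0.
have := mxn_ge0 (invmx (u l) - 1%:M); rewrite -[2 * K / _]mulrA.
by move: (mxn _) (K / _) e => a b; nra.
Qed.

Lemma near_one_shift (X : 'M[R[i]]_n.+1) :
  near_one (fun l => l.+1%:R^-1 *: (X + l%:R%:M)).
Proof.
exists (mxn (X - 1%:M)); first exact: mxn_ge0.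
move=> l; have l1 : (l.+1%:R : R[i]) != 0 by rewrite pnatr_eq0.
have -> : l.+1%:R^-1 *: (X + l%:R%:M) - 1%:M = l.+1%:R^-1 *: (X - 1%:M).
  have -> : 1%:M = l.+1%:R^-1 *: (l.+1%:R%:M : 'M[R[i]]_n.+1).
    by rewrite scale_scalar_mx mulVf.
  rewrite -scalerBr scale_scalar_mx mulVf //; congr (_ *: _).
  by rewrite -natr1 raddfD opprD addrA addrK.
by rewrite mxnZ cabsV cabs_nat mulrC.
Qed.

End NearOne.

Section Coefficients.
Variables (n : nat) (S : seq 'M[R[i]]_n.+1).
Hypothesis S_comm : forall F G, F \in S -> G \in S -> F *m G = G *m F.
Variables (r s : nat) (A : 'I_r -> 'M[R[i]]_n.+1) (B : 'I_s -> 'M[R[i]]_n.+1).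
Hypothesis AS : forall i, A i \in S.
Hypothesis BS : forall j, B j \in S.
Hypothesis uA : forall (i : 'I_r) (l : nat), A i + l%:R%:M \in unitmx.
Hypothesis uB : forall (j : 'I_s) (l : nat), B j + l%:R%:M \in unitmx.

Let bA i : bic S (A i). Proof. exact: bic_mem. Qed.
Let bB j : bic S (B j). Proof. exact: bic_mem. Qed.

(** The coefficient of the series without the incomplete Gamma ratio, which is estimated
    separately. *)
Definition hcoef l := (l`!%:R)^-1 *: wcoef A B l.

(** Each factor (C + l)/(l + 1) tends to 1, so that the powers of l + 1 in [hcoefS] carry the main
    growth. *)
Definition hratio l :=
  (\prod_(i < r) (l.+1%:R^-1 *: (A i + l%:R%:M))) *m
  invmx (\prod_(j < s) (l.+1%:R^-1 *: (B j + l%:R%:M))).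

Let uB' (l : nat) (j : 'I_s) : l.+1%:R^-1 *: (B j + l%:R%:M) \in unitmx.
Proof. by rewrite unitmxZ ?uB // unitfE invr_eq0 pnatr_eq0. Qed.

Lemma near_one_hratio : near_one hratio.
Proof.
apply: near_oneM; first by apply: near_one_prod => i; exact: near_one_shift.
apply: near_oneV => [l|]; first exact: prod_unit.
by apply: near_one_prod => i; exact: near_one_shift.
Qed.

(** Cleared of denominators, so that r and s + 1 are compared without subtracting exponents; the
    extra 1 is due to the factorial. *)
Lemma hcoefS l :
  l.+1%:R ^+ s.+1 *: hcoef l.+1 = l.+1%:R ^+ r *: (hcoef l *m hratio l).
Proof.
have l1 : (l.+1%:R : R[i]) != 0 by rewrite pnatr_eq0.
have l0 : (l`!%:R : R[i]) != 0 by rewrite pnatr_eq0 -lt0n fact_gt0.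
have poch1 k (C : 'I_k -> 'M[R[i]]_n.+1) :
    \prod_(i < k) mxpoch (mxshift C l i) 1 = \prod_(i < k) (C i + l%:R%:M).
  by apply: eq_bigr => i _; rewrite /mxpoch big_ord1 raddf0 addr0.
have prodZ k (C : 'I_k -> 'M[R[i]]_n.+1) :
    \prod_(i < k) (l.+1%:R^-1 *: (C i + l%:R%:M)) =
    (l.+1%:R^-1) ^+ k *: \prod_(i < k) (C i + l%:R%:M).
  by rewrite scaler_prod prodr_const card_ord.
have uPB : \prod_(j < s) (B j + l%:R%:M) \in unitmx by apply: prod_unit => j; exact: uB.
rewrite /hcoef -(addn1 l) -(wcoef_shift S_comm) // [in X in _ *m X]/wcoef !poch1.
rewrite /hratio !prodZ invmxZ ?unitfE ?expf_neq0 ?invr_eq0 //; last first.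
  by rewrite unitmxZ // unitfE expf_neq0 // invr_eq0.
rewrite addn1 factS natrM -!scalemxAl -!scalemxAr -?scalemxAl !scalerA; congr (_ *: _).
by rewrite !exprVn exprS; field; rewrite l0 !nat1r ?natr1 ?l1 ?expf_neq0.
Qed.

(** The ratio is at most about rho (l+1)^(r-s-1). It tends to 0 if r <= s, where 1/2 is enough, and
    is close to rho if r = s + 1, where the midpoint of rho and 1 is enough. *)
Lemma hcoef_ratio_bound (rho : R) : 0 <= rho ->
  (r <= s)%N \/ (r = s.+1 /\ rho < 1) ->
  exists2 theta : R, theta < 1 & exists l0, forall l, (l0 <= l)%N ->
    mxn (hcoef l.+1) * rho <= theta * mxn (hcoef l).
Proof.
move=> rho0 hrs; have [K K0 hK] := near_one_hratio.
have step l : l.+1%:R ^+ s.+1 * mxn (hcoef l.+1) <=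
    l.+1%:R ^+ r * (mxn (hcoef l) * (1 + K / l.+1%:R)).
  have := congr1 (@mxn _ _) (hcoefS l).
  rewrite (mxnZ _ (hcoef _)) (mxnZ _ (hcoef l *m _)) !cabsX !cabs_nat => ->; rewrite ler_wpM2l ?exprn_ge0 //.
  have -> : hcoef l *m hratio l = hcoef l + hcoef l *m (hratio l - 1%:M).
    by rewrite mulmxBr mulmx1 addrC subrK.
  apply: le_trans (mxnD _ _) _; rewrite [leRHS]mulrDr mulr1 lerD2l.
  by apply: le_trans (mxnM _ _) _; rewrite ler_wpM2l ?mxn_ge0.
case: hrs => [rs|[rs rho1]].
  exists (1 / 2); first by lra.
  exists (Num.truncn (2 * rho * (1 + K))).+1 => l hl.
  have l1 : 1 <= l.+1%:R :> R by rewrite ler1n.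
  have l0 : 0 < l.+1%:R :> R by rewrite ltr0n.
  have h1 : 2 * rho * (1 + K) <= l.+1%:R.
    by rewrite ltW // (lt_trans (truncnS_gt _)) // ltr_nat.
  have h2 : l.+1%:R * mxn (hcoef l.+1) <= mxn (hcoef l) * (1 + K).
    apply: (@le_trans _ _ (l.+1%:R ^+ (s - r).+1 * mxn (hcoef l.+1))).
      by rewrite ler_wpM2r ?mxn_ge0 // exprS ler_peMr ?exprn_ege1 // ltW.
    have := step l; rewrite -{1}(subnK rs) -addSn exprD -mulrA mulrCA.
    rewrite ler_pM2l ?exprn_gt0 // => h; apply: le_trans h _.
    rewrite ler_wpM2l ?mxn_ge0 // lerD2l ler_pdivrMr // ler_peMr //.
  rewrite -(ler_pM2l l0).
  have x0 := mxn_ge0 (hcoef l).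
  apply: (@le_trans _ _ (mxn (hcoef l) * (1 + K) * rho)).
    by rewrite mulrA ler_wpM2r.
  by move: (mxn (hcoef l)) x0 h1 => a; nra.
exists ((1 + rho) / 2); first by lra.
have q0 : 0 < 1 - rho by rewrite subr_gt0.
exists (Num.truncn (2 * rho * K / (1 - rho))).+1 => l hl.
have l0 : 0 < l.+1%:R :> R by rewrite ltr0n.
have h1 : 2 * rho * K <= l.+1%:R * (1 - rho).
  by rewrite -ler_pdivrMr // ltW // (lt_trans (truncnS_gt _)) // ltr_nat.
have h2 : mxn (hcoef l.+1) <= mxn (hcoef l) * (1 + K / l.+1%:R).
  by have := step l; rewrite rs ler_pM2l ?exprn_gt0.
apply: le_trans (ler_wpM2r rho0 h2) _; rewrite -(mulrA (mxn _)) [leRHS]mulrC.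
apply: ler_wpM2l; first exact: mxn_ge0.
have : rho * (K / l.+1%:R) <= (1 - rho) / 2.
  by rewrite mulrA ler_pdivrMr //; lra.
move=> ht; rewrite mulrDl mul1r [X in _ + X]mulrC; move: (rho * _) ht => t; lra.
Qed.

(** The contraction factor absorbs the polynomial weight, which is there to pay for the growth of
    [gterm]. *)
Lemma hcoef_growth (rho : R) m : 0 <= rho ->
  (r <= s)%N \/ (r = s.+1 /\ rho < 1) ->
  exists K, forall l, mxn (hcoef l) * l.+1%:R ^+ m * rho ^+ l <= K.
Proof.
move=> rho0 hrs; have [theta th1 [l0 h0]] := hcoef_ratio_bound rho0 hrs.
have [l1 h1] := succ_pow_ratio m th1.
apply: (@eventually_nonincreasing_bounded _ (maxn l0 l1)) => l.
rewrite geq_max => /andP[/h0 hl /h1 hl'].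
rewrite exprS mulrA; apply: ler_wpM2r; first exact: exprn_ge0.
rewrite mulrAC; apply: (@le_trans _ _ (theta * mxn (hcoef l) * l.+2%:R ^+ m)).
  by apply: ler_wpM2r; first exact: exprn_ge0.
by rewrite -mulrA mulrCA ler_wpM2l ?mxn_ge0.
Qed.

Lemma common_eigen : exists2 v : 'rV[R[i]]_n.+1, v != 0 &
  forall F, F \in S -> exists a, v *m F = a *: v.
Proof.
have [//|F G FS GS|v v0 /allP hv] := @common_eigenvector _ n.+1 S _ _.
  exact: S_comm.
by exists v => // F /hv /sub_rVP.
Qed.

Section Eigenvector.
Variable v : 'rV[R[i]]_n.+1.
Hypothesis v_neq0 : v != 0.
Hypothesis vS : forall F, F \in S -> exists a, v *m F = a *: v.

Let eig X := exists a, v *m X = a *: v.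

Let eigM X Y : eig X -> eig Y -> eig (X *m Y).
Proof. by move=> [a e] [b f]; exists (a * b); rewrite mulmxA e -scalemxAl f scalerA. Qed.

Let eig_scalar c : eig c%:M.
Proof. by exists c; rewrite mul_mx_scalar. Qed.

Let eigD X Y : eig X -> eig Y -> eig (X + Y).
Proof. by move=> [a e] [b f]; exists (a + b); rewrite mulmxDr e f scalerDl. Qed.

Let eigZ c X : eig X -> eig (c *: X).
Proof. by move=> [a e]; exists (c * a); rewrite -scalemxAr e scalerA. Qed.

Let eig_prod (I : Type) (t : seq I) (F : I -> 'M[R[i]]_n.+1) :
  (forall i, eig (F i)) -> eig (\prod_(i <- t) F i).
Proof.
by move=> hF; apply: (big_ind eig) => [|X Y hX hY|i _] //; [exact: eig_scalar|exact: eigM].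
Qed.

Let eigV X : X \in unitmx -> eig X -> eig (invmx X).
Proof.
move=> uX [a e]; have a0 : a != 0.
  apply: contra_neq v_neq0 => a0; move: e; rewrite a0 scale0r => e.
  by rewrite -(mulmxK uX v) e mul0mx.
by exists a^-1; rewrite -[in RHS](mulmxK uX v) e -scalemxAl scalerA mulVf // scale1r.
Qed.

(** All factors of [hcoef] and [hratio] have [v] as eigenvector. Invertibility of [hcoef l] keeps
    its eigenvalue away from 0, and the distance of [hratio] to the identity bounds the growth from
    below. *)
Lemma hcoef_eigen : exists xi : nat -> R[i],
  [/\ forall l, v *m hcoef l = xi l *: v, forall l, xi l != 0 &
    exists2 K : R, 0 <= K & forall l, l.+1%:R ^+ r * (1 - K / l.+1%:R) * cabs (xi l) <=
      l.+1%:R ^+ s.+1 * cabs (xi l.+1)].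
Proof.
have eA i l : eig (A i + l%:R%:M) by apply: eigD; [exact/vS/AS|exact: eig_scalar].
have eB i l : eig (B i + l%:R%:M) by apply: eigD; [exact/vS/BS|exact: eig_scalar].
have uPB l : \prod_(j < s) mxpoch (B j) l \in unitmx.
  by apply: prod_unit => j; exact: mxpoch_unit.
have /choice[xi hxi] : forall l, exists a, v *m hcoef l = a *: v.
  move=> l; apply: eigZ; apply: eigM.
    by apply: eig_prod => i; apply: eig_prod => k; exact: eA.
  apply: eigV; first exact: uPB.
  by apply: eig_prod => i; apply: eig_prod => k; exact: eB.
have /choice[u hu] : forall l, exists a, v *m hratio l = a *: v.
  move=> l; apply: eigM; first by apply: eig_prod => i; exact/eigZ/eA.
  by apply: eigV; [exact: prod_unit|apply: eig_prod => i; exact/eigZ/eB].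
have [K K0 hK] := near_one_hratio.
exists xi; split => //.
  move=> l; apply: contra_neq v_neq0 => x0; have := hxi l; rewrite x0 scale0r => e.
  have uh : hcoef l \in unitmx.
    rewrite unitmxZ ?unitfE ?invr_eq0 ?pnatr_eq0 -?lt0n ?fact_gt0 //.
    rewrite unitmx_mul unitmx_inv uPB andbT; apply: prod_unit => i; exact: mxpoch_unit.
  by rewrite -(mulmxK uh v) e mul0mx.
exists K => // l.
have u1 : 1 - K / l.+1%:R <= cabs (u l).
  have h1 : cabs (u l - 1) <= K / l.+1%:R.
    apply: le_trans (hK l); apply: (eigen_le_mxn v_neq0).
    by rewrite mulmxBr hu mulmx1 scalerBl scale1r.
  have := cabs_sub_ge 1 (1 - u l); rewrite subKr cabs1 cabsB; apply: le_trans.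
  by rewrite lerD2l lerN2.
have rel : l.+1%:R ^+ s.+1 * xi l.+1 = l.+1%:R ^+ r * (xi l * u l).
  have := congr1 (mulmx v) (hcoefS l).
  rewrite -(scalemxAr _ v (hcoef _)) -(scalemxAr _ v (hcoef l *m _)) hxi mulmxA hxi -scalemxAl hu !scalerA => /eqP.
  by rewrite -subr_eq0 -scalerBl scaler_eq0 (negbTE v_neq0) orbF subr_eq0 -?mulrA => /eqP.
have := congr1 (@cabs _) rel; rewrite !cabsM !cabsX !cabs_nat => ->.
rewrite -mulrA ler_wpM2l ?exprn_ge0 // mulrC ler_wpM2l ?cabs_ge0 //.
Qed.

End Eigenvector.
End Coefficients.
End HypergeometricGrowth.

(** * The multiplication formula *)

Section Multiplication.
Variables (R : realType) (n : nat) (S : seq 'M[R[i]]_n.+1).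
Hypothesis S_comm : forall F G, F \in S -> G \in S -> F *m G = G *m F.
Variables (r s : nat) (x : R) (P Q : 'M[R[i]]_n.+1).
Variables (A : 'I_r -> 'M[R[i]]_n.+1) (B : 'I_s -> 'M[R[i]]_n.+1).
Hypothesis PS : P \in S.
Hypothesis QS : Q \in S.
Hypothesis AS : forall i, A i \in S.
Hypothesis BS : forall j, B j \in S.
Hypothesis uA : forall (i : 'I_r) (l : nat), A i + l%:R%:M \in unitmx.
Hypothesis uB : forall (j : 'I_s) (l : nat), B j + l%:R%:M \in unitmx.
Hypothesis x_gt0 : 0 < x.
Hypothesis P_pos : pos_spectrum P.

Let bA i : bic S (A i). Proof. exact: bic_mem. Qed.
Let bB j : bic S (B j). Proof. exact: bic_mem. Qed.

Definition rEs_coef l := hcoef A B l *m gterm x P Q l.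

Lemma rEs_termE z l : rEs_term x P Q z A B l = z ^+ l *: rEs_coef l.
Proof.
by rewrite /rEs_term /rEs_coef /hcoef /gterm /wcoef -scalemxAl scalerA !mulmxA.
Qed.

Lemma rEs_coef_bounded (rho : R) i j : 0 <= rho ->
  (r <= s)%N \/ (r = s.+1 /\ rho < 1) ->
  bounded_at (fun l => rEs_coef l i j) rho.
Proof.
move=> rho0 hrs.
have [K K0 [m hK]] := gterm_polyb x_gt0 (S_comm PS QS) P_pos.
have [L hL] := hcoef_growth S_comm AS BS uB m rho0 hrs.
exists (L * K) => l; apply: (@le_trans _ _ (mxn (hcoef A B l) * l.+1%:R ^+ m * rho ^+ l * K)).
  apply: (@le_trans _ _ (mxn (hcoef A B l) * (K * l.+1%:R ^+ m) * rho ^+ l)).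
    rewrite ler_wpM2r ?exprn_ge0 //; apply: le_trans (entry_le_mxn _ _ _) _.
    apply: le_trans (mxnM _ _) _; apply: ler_wpM2l; first exact: mxn_ge0.
    exact: hK.
  by rewrite le_eqVlt; apply/orP; left; apply/eqP; ring.
by rewrite ler_wpM2r.
Qed.

(** Pochhammer factors of shifts m and l combine to those of m + l, l P + (m P + Q) = (m + l) P + Q,
    and (m + l)! = binom(m + l, m) m! l!. *)
Lemma inner_termE m y l :
  wcoef A B m *m rEs_term x P (m%:R *: P + Q) y (mxshift A m) (mxshift B m) l =
  (m`!%:R * ('C(m + l, m)%:R * y ^+ l)) *: rEs_coef (m + l).
Proof.
have f0 k : (k`!%:R : R[i]) != 0 by rewrite pnatr_eq0 -lt0n fact_gt0.
have assoc c (U V G : 'M[R[i]]_n.+1) : U *m (c *: (V *m G)) = c *: (U *m V *m G).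
  by rewrite -scalemxAr mulmxA.
rewrite /rEs_term -[_ *m mxrgamma _]mulmxA -/(wcoef (mxshift A m) (mxshift B m) l).
rewrite assoc (wcoef_shift S_comm bA bB uB) addrA -scalerDl -natrD (addnC l m) -/(gterm x P Q (m + l)).
rewrite /rEs_coef /hcoef -scalemxAl scalerA; congr (_ *: _).
have := bin_fact (leq_addr l m); rewrite addKn => <-; rewrite !natrM.
by field; rewrite !f0 !pnatr_eq0 -!lt0n bin_gt0 leq_addr.
Qed.

Lemma mult_termE y z m :
  (\prod_(j < s) mxgamma (B j)) *m (\prod_(i < r) mxrgamma (A i)) *m
    mult_term x P Q y z A B m =
  (y ^+ m * (z - 1) ^+ m / m`!%:R) *:
    (wcoef A B m *m rEs x P (m%:R *: P + Q) y (mxshift A m) (mxshift B m)).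
Proof.
rewrite /mult_term -scalemxAr mulmxA; congr (_ *: (_ *m _)).
exact: (gamma_prefactor S_comm).
Qed.

Section Convergence.
Variable y : R[i].
Hypothesis inner_cvg : forall m : nat,
  cvgn (series (rEs_term x P (m%:R *: P + Q) y (mxshift A m) (mxshift B m))).

(** Convergence of the inner series supplies exactly what [taylor] demands at [y], before anything
    is known about the radius of convergence. *)
Lemma rEs_coef_taylor i j : taylor (fun l => rEs_coef l i j) y
  (fun m => (m`!%:R)^-1 *
    (wcoef A B m *m rEs x P (m%:R *: P + Q) y (mxshift A m) (mxshift B m)) i j).
Proof.
move=> m; have f0 : (m`!%:R : R[i]) != 0 by rewrite pnatr_eq0 -lt0n fact_gt0.
have h := ccvg_mulmx_entry (wcoef A B m) i j (ccvg_entry (@inner_cvg m)).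
apply: ccvg_ext (ccvgZ (m`!%:R)^-1 h) => k.
rewrite seriesEnat /= big_mkord mulmx_sumr summxE mulr_sumr.
apply: eq_bigr => l _; rewrite inner_termE mxE mulrA mulKf //.
by rewrite mulrAC.
Qed.

Lemma inner_term_cvg0 m i j : ccvg (fun l =>
  'C(m + l, m)%:R * y ^+ l * rEs_coef (m + l) i j) 0.
Proof.
apply: cseries_term0; apply: cseries_ext (rEs_coef_taylor i j m) => l.
by rewrite mulrAC.
Qed.

(* On a common eigenvector the coefficients are scalars [c_l] with
   [|c_(l+1) y| >= (1 - K/(l+1)) |c_l|] when the conclusion fails, so for [m >= K]
   the terms [binom(m+l, m) c_(m+l) y^l] of the inner series cannot tend to 0. *)
Lemma inner_radius : y != 0 -> (r <= s)%N \/ (r = s.+1 /\ cabs y < 1).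
Proof.
move=> y0; have [rs|sr] := leqP r s; [by left|right].
have rho0 : 0 < cabs y by rewrite cabs_gt0.
suff hF : ~ ((s.+1 < r)%N \/ (r = s.+1 /\ 1 <= cabs y)).
  have rE : r = s.+1.
    by apply/eqP; rewrite eqn_leq sr andbT leqNgt; apply/negP => h; apply: hF; left.
  by split => //; rewrite ltNge; apply/negP => h; apply: hF; right.
move=> hrs.
have [v v0 vS] := common_eigen S_comm.
have [xi [vxi xi0 [K K0 hK]]] := hcoef_eigen S_comm AS BS uA uB v0 vS.
have [[p vP] [q vQ]] := (vS _ PS, vS _ QS).
have p0 : 0 < complex.Re p by apply: P_pos; apply/eigenvalueP; exists v.
have [gam vg [l1 hg]] := gterm_eigen x_gt0 vP vQ p0.
(* For r > s + 1 a surplus factor of at least l + 1 makes up for a small |y| as soon as l + 1 > K +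
   1/|y|; for r = s + 1 the bound follows from |y| >= 1. *)
have [l0 h0] : exists l0, forall l, (l0 <= l)%N ->
    (1 - K / l.+1%:R) * cabs (xi l) <= cabs y * cabs (xi l.+1).
  case: hrs => [rs|[rs y1]].
    exists (Num.truncn (K + (cabs y)^-1)).+1 => l hl.
    have lp : 0 < l.+1%:R :> R by rewrite ltr0n.
    have hb : K + (cabs y)^-1 < l.+1%:R.
      by rewrite (lt_trans (truncnS_gt _)) // ltr_nat.
    have yi : 0 < (cabs y)^-1 by rewrite invr_gt0.
    have X0 : 0 <= (1 - K / l.+1%:R) * cabs (xi l).
      by rewrite mulr_ge0 ?cabs_ge0 // subr_ge0 ler_pdivrMr // mul1r; lra.
    have h1 : l.+1%:R * ((1 - K / l.+1%:R) * cabs (xi l)) <= cabs (xi l.+1).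
      have := hK l; rewrite -(subnK rs) addnS -addSn exprD -!mulrA mulrCA.
      rewrite ler_pM2l ?exprn_gt0 // => h; apply: le_trans h; apply: ler_wpM2r => //.
      by rewrite exprS ler_peMr ?exprn_ege1 ?ler1n // ltW.
    apply: (@le_trans _ _ (cabs y * (l.+1%:R * ((1 - K / l.+1%:R) * cabs (xi l))))).
      move: X0; set t := (1 - _) * _ => X0; rewrite mulrA ler_peMl //.
      rewrite mulrC -ler_pdivrMr // div1r; lra.
    by rewrite ler_pM2l.
  exists 0%N => l _; apply: (@le_trans _ _ (cabs (xi l.+1))).
    by have := hK l; rewrite rs -mulrA ler_pM2l // exprn_gt0 ?ltr0n.
  by rewrite ler_peMl ?cabs_ge0.
(* The ratio of consecutive [e l] is at least (m + l + 1 - K)/(l + 1), hence at least 1 when m >= K;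
   and m >= l0 brings all indices m + l within reach of [h0]. *)
pose m := maxn l0 (Num.truncn K).+1.
have mK : K <= m%:R.
  by rewrite ltW // (lt_le_trans (truncnS_gt _)) // ler_nat leq_maxr.
pose e l := 'C(m + l, m)%:R * cabs (xi (m + l)%N) * cabs y ^+ l.
have e_mono l : e 0%N <= e l.
  elim: l => // l IH; apply: le_trans IH _.
  have lp : 0 < l.+1%:R :> R by rewrite ltr0n.
  have mp : 0 < (m + l).+1%:R :> R by rewrite ltr0n.
  rewrite -(ler_pM2l lp) /e addnS exprS.
  have bE : l.+1%:R * 'C((m + l).+1, m)%:R = (m + l).+1%:R * 'C(m + l, m)%:R :> R.
    rewrite -!natrM; congr _%:R; have := mul_bin_diag (m + l).+1 l.
    have -> : 'C((m + l).+1, l.+1) = 'C((m + l).+1, m).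
      by rewrite -[RHS]bin_sub ?leqW ?leq_addr // subSn ?leq_addr // addKn.
    have -> : 'C((m + l).+1.-1, l) = 'C(m + l, m).
      by rewrite -[RHS]bin_sub ?leq_addr // addKn.
    by move=> <-.
  have h := h0 (m + l)%N (leq_trans (leq_maxl _ _) (leq_addr _ _)).
  set c := 'C(_, _)%:R in bE *; set b := 'C(_, _)%:R in bE *.
  have b0 : 0 <= b by rewrite ler0n.
  apply: (@le_trans _ _ ((m + l).+1%:R * b * ((1 - K / (m + l).+1%:R) * cabs (xi (m + l)%N)) * cabs y ^+ l)).
    have -> : (m + l).+1%:R * b * ((1 - K / (m + l).+1%:R) * cabs (xi (m + l)%N)) * cabs y ^+ l =
        ((m + l).+1%:R - K) * (b * cabs (xi (m + l)%N) * cabs y ^+ l).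
      by field; rewrite ?nat1r ?natr1 gt_eqF.
    rewrite ler_wpM2r //; first by rewrite !mulr_ge0 ?cabs_ge0 ?exprn_ge0 ?cabs_ge0.
    by rewrite -addnS natrD; lra.
  have -> : l.+1%:R * (c * cabs (xi (m + l).+1) * (cabs y * cabs y ^+ l)) =
      l.+1%:R * c * (cabs y * cabs (xi (m + l).+1)) * cabs y ^+ l by ring.
  rewrite bE ler_wpM2r ?exprn_ge0 ?cabs_ge0 // ler_wpM2l // mulr_ge0 //.
have e0 : 0 < e 0%N.
  by rewrite /e addn0 binn expr0 mulr1 mul1r cabs_gt0.
have [j vj] := rV0Pn _ v0.
have lim0 : ccvg (fun l => 'C(m + l, m)%:R * y ^+ l * (xi (m + l)%N * gam (m + l)%N)) 0.
  have c0 : forall i j, ccvg (fun l =>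
      (('C(m + l, m)%:R * y ^+ l) *: rEs_coef (m + l)) i j) ((0 : 'M[R[i]]_n.+1) i j).
    by move=> i k; rewrite mxE; apply: ccvg_ext (inner_term_cvg0 m i k) => l; rewrite [RHS]mxE.
  have := ccvgZ (v 0 j)^-1 (ccvg_mulmx_entry v 0 j c0).
  rewrite mulmx0 mxE mulr0; apply: ccvg_ext => l.
  rewrite -scalemxAr /rEs_coef mulmxA vxi -scalemxAl vg !scalerA mxE mulrC.
  by rewrite mulrK ?unitfE // mulrA.
(* Eventually |gam| >= 1/2, so the terms stay above half of the positive number [e 0], against
   [lim0]. *)
have e2 : 0 < e 0%N / 2 by rewrite divr_gt0.
have [k hk] := lim0 _ e2.
have := hk (maxn k l1) (leq_maxl _ _); rewrite subr0.
move: (maxn k l1) (leq_maxr k l1) => l hl.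
have := e_mono l; have := hg (m + l)%N (leq_trans hl (leq_addl _ _)).
rewrite !cabsM cabs_nat cabsX mulrA -(mulrAC _ (cabs (xi _))) -/(e l) => g2 el.
apply/negP; rewrite -leNgt; apply: (@le_trans _ _ (e l * (1 / 2))); first by lra.
by rewrite ler_wpM2l // (le_trans _ el) // ltW.
Qed.

End Convergence.

Lemma rEs_multiplication y z :
  cvgn (series (rEs_term x P Q (y * z) A B)) ->
  (forall m : nat,
    cvgn (series (rEs_term x P (m%:R *: P + Q) y (mxshift A m) (mxshift B m)))) ->
  cvgn (series (mult_term x P Q y z A B)) ->
  rEs x P Q (y * z) A B =
  (\prod_(j < s) mxgamma (B j)) *m (\prod_(i < r) mxrgamma (A i))
  *m limn (series (mult_term x P Q y z A B)).
Proof.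
move=> cvg_lhs cvg_inner cvg_outer.
set G := _ *m \prod_(i < r) _.
apply/matrixP => i j.
have hl : psum (fun l => rEs_coef l i j) (y * z) (rEs x P Q (y * z) A B i j).
  apply: ccvg_ext (ccvg_entry cvg_lhs i j) => k.
  by rewrite series_entry; apply: eq_bigr => l _; rewrite rEs_termE mxE mulrC.
have ht := rEs_coef_taylor cvg_inner i j.
have hr := ccvg_mulmx_entry G i j (ccvg_entry cvg_outer).
pose b m := (m`!%:R)^-1 *
  (wcoef A B m *m rEs x P (m%:R *: P + Q) y (mxshift A m) (mxshift B m)) i j.
rewrite -/b in ht.
have {}hr : psum b (y * z - y) ((G *m limn (series (mult_term x P Q y z A B))) i j).
  apply: ccvg_ext hr => k; rewrite seriesEnat /= big_mkord mulmx_sumr summxE.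
  apply: eq_bigr => m _; rewrite mult_termE mxE /b.
  have -> : y * z - y = y * (z - 1) by rewrite mulrBr mulr1.
  by rewrite exprMn; ring.
(* At y = 0 both sides reduce to their terms of index 0, whatever the radius of convergence. *)
have [y0|y0] := eqVneq y 0.
  have e1 : psum b 0 ((G *m limn (series (mult_term x P Q y z A B))) i j).
    by move: hr; rewrite y0 mul0r subr0.
  have e2 : psum (fun l => rEs_coef l i j) 0 (rEs x P Q (y * z) A B i j).
    by move: hl; rewrite y0 mul0r.
  have e3 : cseries (fun l => rEs_coef l i j * 0 ^+ l) (b 0%N).
    by apply: cseries_ext (ht 0%N) => l; rewrite add0n bin0 mul1r y0.
  rewrite (cseries_unique e2 e3).
  exact: (cseries_unique (psum_pow0 b) e1).
(* [rEs_coef_bounded] requires rho < 1 when r = s + 1, hence the midpoint of |y| and 1 in that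
   case. *)
have [rho yrho hrho] : exists2 rho, cabs y < rho & (r <= s)%N \/ (r = s.+1 /\ rho < 1).
  have [rs|[rs y1]] := inner_radius cvg_inner y0.
    by exists (cabs y + 1); [rewrite ltrDl|left].
  by exists ((cabs y + 1) / 2); [lra|right; split => //; lra].
apply: (taylor_series_sum _ yrho hl ht hr); apply: rEs_coef_bounded => //.
by rewrite ltW // (le_lt_trans (cabs_ge0 y)).
Qed.

End Multiplication.

Theorem theorem3p10 (R : realType) (N r s : nat) (P Q : 'M[R[i]]_N)
    (A : 'I_r -> 'M[R[i]]_N) (B : 'I_s -> 'M[R[i]]_N) (x : R) (y z : R[i])
    (hcomm : let F := P :: Q :: codom A ++ codom B in all_comm_mx F F)
    (hP : pos_spectrum P) (hQ : pos_spectrum Q)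
    (hA : forall (i : 'I_r) (l : nat), A i + l%:R%:M \in unitmx)
    (hB : forall (j : 'I_s) (l : nat), B j + l%:R%:M \in unitmx)
    (hx : 0 < x)
    (cvg_lhs : cvgn (series (rEs_term x P Q (y * z) A B)))
    (cvg_inner : forall n : nat,
      cvgn (series (rEs_term x P (n%:R *: P + Q) y (mxshift A n) (mxshift B n))))
    (cvg_outer : cvgn (series (mult_term x P Q y z A B))) :
  rEs x P Q (y * z) A B =
  (\prod_(j < s) mxgamma (B j)) *m (\prod_(i < r) mxrgamma (A i))
  *m limn (series (mult_term x P Q y z A B)).
Proof.
(* In dimension 0 there is no eigenvector to work with, but any two matrices coincide. *)
case: N P Q A B hcomm hP hQ hA hB cvg_lhs cvg_inner cvg_outer => [|n] P' Q' A' B' hcomm' hP' _ hA' hB' cl ci co.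
  by apply/matrixP => -[].
pose S := P' :: Q' :: codom A' ++ codom B'.
have S_comm F G : F \in S -> G \in S -> F *m G = G *m F.
  by move=> FS GS; have /allrelP/(_ F G FS GS)/eqP := hcomm'.
apply: (rEs_multiplication S_comm) => //.
- by rewrite mem_head.
- by rewrite !in_cons eqxx orbT.
- by move=> i; rewrite !in_cons mem_cat codom_f !orbT.
- by move=> j; rewrite !in_cons mem_cat codom_f !orbT.
Qed.
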